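(* Let $0<r<R<\infty$ and $\delta\in\mathbb{R}$. The positive zeros $x''_{\nu,k}$ of $\mathfrak{h}_{\nu,\delta}$ satisfy the following bounds. (1) If $\nu\ge|\delta|$, $k\ge2$ and $\max\{\nu,k\}$ is sufficiently large, then $$x''_{\nu,k}>\frac1R\sqrt{\nu^2+\pi^2\left(k-\frac54\right)^2}.$$ (2) If $\nu\ge|\delta|$ and $\nu$ is sufficiently large, then $x''_{\nu,k}>\nu/R$. (3) If $\nu\ge|\delta|$ and $k$ is sufficiently large, then $$\frac{\pi(k-1/2)}{R-r}<\mathcal{G}_\nu^{-1}\left(k-\frac18\right)<x''_{\nu,k}<\mathcal{G}_\nu^{-1}\left(k+\frac38\right)<\frac{\pi(k+1/2)}{R-r}.$$
   Context: $J_\nu,Y_\nu$ are Bessel functions of the first and second kind of order $\nu$; $j_\nu(x)=x^{-\delta}J_\nu(x)$, $y_\nu(x)=x^{-\delta}Y_\nu(x)$; and for $x>0$, $\nu\ge|\delta|$, $$\mathfrak{h}_{\nu,\delta}(x)=j_\nu'(Rx)y_\nu'(rx)-j_\nu'(rx)y_\nu'(Rx).$$ Its positive zeros are simple and listed in increasing order as $x''_{\nu,k}$, with $k$ beginning with $0$ if $\nu>|\delta|$ and with $1$ if $\nu=|\delta|$. Let $g(x)=\left(\sqrt{1-x^2}-x\arccos x\right)/\pi$ on $[0,1]$; $G(x)=Rg(x/R)-rg(x/r)$ for $0\le x\le r$ and $G(x)=Rg(x/R)$ for $r\le x\le R$; and $\mathcal{G}_\nu(x)=xG(\nu/x)$,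 which is a continuous strictly increasing function from $[\nu/R,\infty)$ onto $[0,\infty)$ (with $\mathcal{G}_0(x)=(R-r)x/\pi$); $\mathcal{G}_\nu^{-1}$ is its inverse function. *)

(* Defs.v *)
From Stdlib Require Import Factorial Rprod Reals ClassicalEpsilon.
From Coquelicot Require Import Coquelicot.
Open Scope R_scope.

(* 1/Gamma(z) by the Gauss-Euler limit
   1/Gamma(z) = lim_n z(z+1)...(z+n) / (n! n^z),
   which converges for every real z and vanishes at 0, -1, -2, ... *)
Definition rGamma (z : R) : R :=
  real (Lim_seq (fun n : nat =>
    prod_f_R0 (fun k => z + INR k) n / (INR (fact n) * Rpower (INR n) z))).

(* Only used at x > 0, since [Rpower] is meaningful for positive bases only. *)
Definition besselJ (nu x : R) : R :=
  Rpower (x / 2) nu *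
  Series (fun m : nat =>
    (-1) ^ m / INR (fact m) * rGamma (INR m + nu + 1) * (x / 2) ^ (2 * m)).

Definition besselY_quot (nu x : R) : R :=
  (besselJ nu x * cos (nu * PI) - besselJ (- nu) x) / sin (nu * PI).

(* At integer orders the quotient is 0/0 and Y is its limit in the order;
   Coquelicot's [Lim] at a finite point is the punctured limit. *)
Definition besselY (nu x : R) : R :=
  if Req_EM_T (sin (nu * PI)) 0
  then real (Lim (fun mu => besselY_quot mu x) nu)
  else besselY_quot nu x.

Definition jfun (delta nu x : R) : R := Rpower x (- delta) * besselJ nu x.
Definition yfun (delta nu x : R) : R := Rpower x (- delta) * besselY nu x.

(* In what follows [r] is the inner radius and [Ro] the outer one. *)
Definition hfun (r Ro delta nu x : R) : R :=
  Derive (jfun delta nu) (Ro * x) * Derive (yfun delta nu) (r * x)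
  - Derive (jfun delta nu) (r * x) * Derive (yfun delta nu) (Ro * x).

Definition increasing_listing (P : R -> Prop) (k0 : nat) (x : nat -> R) : Prop :=
  (forall k, (k0 <= k)%nat -> P (x k)) /\
  (forall k, (k0 <= k)%nat -> x k < x (S k)) /\
  (forall z, P z -> exists k, (k0 <= k)%nat /\ x k = z).

Definition first_index (delta nu : R) : nat :=
  if Rlt_dec (Rabs delta) nu then 0%nat else 1%nat.

(* A listing is unique at the indices k >= first_index delta nu; the values
   below that index carry no information. *)
Definition xpp (r Ro delta nu : R) : nat -> R :=
  epsilon (inhabits (fun _ : nat => 0))
    (increasing_listing (fun z => 0 < z /\ hfun r Ro delta nu z = 0)
                        (first_index delta nu)).

Definition gfun (x : R) : R := (sqrt (1 - x ^ 2) - x * acos x) / PI.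

(* Only used on [0, Ro]. *)
Definition Gfun (r Ro x : R) : R :=
  if Rle_dec x r then Ro * gfun (x / Ro) - r * gfun (x / r)
  else Ro * gfun (x / Ro).

(* For nu = 0 this is (Ro - r) x / PI also at x = 0, whatever [0 / 0] is. *)
Definition calG (r Ro nu x : R) : R := x * Gfun r Ro (nu / x).

(* Inverse of [calG r Ro nu] as a bijection from [nu / Ro, +oo) onto
   [0, +oo). *)
Definition calGinv (r Ro nu y : R) : R :=
  epsilon (inhabits 0) (fun x => nu / Ro <= x /\ calG r Ro nu x = y).

(* Main.v *)
Require Import Defs.
From Stdlib Require Import Factorial Rprod ZArith Reals Ranalysis5 Lra Lia ClassicalEpsilon.
From Coquelicot Require Import Coquelicot.
Open Scope R_scope.

(** Put [c = delta + 1/2]. The functions [W t = sqrt t * (A J_nu (x t) + B Y_nu (x t))] solve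
    [W'' + (x^2 - (nu^2 - 1/4) / t^2) W = 0], and [hfun] vanishes at [x] exactly when some nonzero
    such [W] satisfies [W' = (c / t) W] at both [t = r] and [t = Ro]. So the squares of the zeros
    are Sturm-Liouville eigenvalues. The Pruefer angle [th] of [(W', W)] that starts at
    [arccot (c / r)] satisfies [th' = cos^2 th + (x^2 - (nu^2 - 1/4) / t^2) sin^2 th]; comparison
    of first-order equations shows that its value at [Ro] is continuous and strictly increasing
    in [x], and comparison with [x = 0], [nu = |delta|], where [th t = arccot (c / t)], identifies
    [x''_k] as the point where this value is [arccot (c / Ro) + k PI].
    (1) The angle of [(W', b W)] with [b = PI (k - 1) / Ro] turns at speed at most [b] and passes
    the multiples of [PI] together with [th].
    (2) At [x = nu / Ro] an explicit supersolution keeps the angle below [arccot (c / Ro)].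
    (3) The angle of [(W', x W)] turns by [x (Ro - r) + O(1/x)], so [x''_k (Ro - r) / PI - k] tends
    to 0, and so does [y - calGinv y (Ro - r) / PI].
    For integer orders [Y_n] is [(K_n + (-1)^n K_{-n}) / PI] with [K_mu] the derivative of [J_mu]
    in the order; Wronskians are evaluated by continuity at 0. *)

(** * Differential inequalities and polar angles *)

(** The constant [c] carries the prefactor of [jfun] and [yfun]: up to a factor free of [t],
    [t^(-delta) C(x t)] is [t^(-c) W t], whose derivative vanishes exactly when [W' = (c / t) W].
    The function [t^c] meets this condition at every [t] and solves the equation at [x = 0],
    [nu = |delta|]. It is the eigenfunction of eigenvalue 0, and comparison with it decides whether
    the index starts at 0 or at 1. The angle with [b = 1] has a right-hand side that increases with
    [x], so it orders the eigenvalues, but its speed is far from uniform. A rescaled angle is easy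
    to estimate, but its scale depends on [x] or [k]; information passes between the two only at the
    multiples of [PI], which both reach together. In (3) [nu] is fixed, so the limits suffice and
    the fractions 1/8 and 3/8 only have to fit between the limits. Of [Y] two facts are used: it
    solves Bessel's equation, and its Wronskian with [J] does not vanish. Integer orders are the
    obstacle, because there the series must be differentiated in the order; this calls for a
    differentiable [1/Gamma] on the whole line and for the simplicity of its zeros at 0, -1, -2,
    ... *)

Lemma derive_continuity_pt (f : R -> R) (x l : R) : is_derive f x l -> continuity_pt f x.
Proof.
  intros H; apply continuity_pt_filterlim.
  apply (ex_derive_continuous f x); now exists l.
Qed.

Lemma derive_ge0_le (f df : R -> R) (a b : R) :
  a <= b -> (forall t, a <= t <= b -> is_derive f t (df t)) ->
  (forall t, a <= t <= b -> 0 <= df t) -> f a <= f b.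
Proof.
  intros Hab Hd Hp.
  destruct (MVT_gen f a b df) as [c [Hc E]];
    rewrite Rmin_left, Rmax_right in * by lra.
  - intros x Hx; apply Hd; lra.
  - intros x Hx; apply (derive_continuity_pt f x (df x)), Hd; lra.
  - specialize (Hp c Hc); nra.
Qed.

Lemma derive_eq0_eq (f : R -> R) (a b : R) :
  a <= b -> (forall t, a <= t <= b -> is_derive f t 0) -> f a = f b.
Proof.
  intros Hab Hd; apply Rle_antisym.
  - apply (derive_ge0_le f (fun _ => 0)); auto; intros; lra.
  - enough (- f a <= - f b) by lra.
    apply (derive_ge0_le (fun t => - f t) (fun _ => - 0)); auto; intros; try lra.
    apply (is_derive_opp f t 0); auto.
Qed.

(** Squaring removes the corner of the negative part at 0, so Gronwall's argument can differentiate
    through crossings. *)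
Lemma is_derive_Rmin0_sqr (y : R) :
  is_derive (fun y => (Rmin y 0) ^ 2) y (2 * Rmin y 0).
Proof.
  destruct (Rtotal_order y 0) as [H|[H|H]].
  - apply (is_derive_ext_loc (fun y => y ^ 2)).
    + exists (mkposreal (- y) ltac:(lra)); intros z Hz.
      unfold ball in Hz; simpl in Hz; unfold AbsRing_ball, abs, minus, plus, opp in Hz; simpl in Hz.
      apply Rabs_def2 in Hz; rewrite Rmin_left; lra.
    + rewrite Rmin_left by lra; auto_derive; auto; ring.
  - subst y; rewrite Rmin_left, Rmult_0_r by lra.
    apply is_derive_Reals; intros eps He.
    exists (mkposreal eps He); intros h Hh0 Hh; simpl in Hh.
    rewrite Rplus_0_l, (Rmin_left 0 0) by lra.
    assert (Hm : Rabs (Rmin h 0) <= Rabs h).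
    { unfold Rmin; destruct (Rle_dec h 0); try lra; rewrite Rabs_R0; apply Rabs_pos. }
    replace ((Rmin h 0 ^ 2 - 0 ^ 2) / h - 0) with (Rmin h 0 ^ 2 / h) by (field; auto).
    unfold Rdiv; rewrite Rabs_mult, Rabs_inv, <- RPow_abs.
    assert (0 < Rabs h) by now apply Rabs_pos_lt.
    apply Rle_lt_trans with (2 := Hh).
    apply Rmult_le_reg_r with (Rabs h); auto.
    rewrite Rmult_assoc, Rinv_l by lra.
    generalize (Rabs_pos (Rmin h 0)); simpl; intros; nra.
  - apply (is_derive_ext_loc (fun y => 0)).
    + exists (mkposreal y ltac:(lra)); intros z Hz.
      unfold ball in Hz; simpl in Hz; unfold AbsRing_ball, abs, minus, plus, opp in Hz; simpl in Hz.
      apply Rabs_def2 in Hz; rewrite Rmin_right; lra.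
    + rewrite Rmin_right by lra; rewrite Rmult_0_r; apply @is_derive_const.
Qed.

(** The second conclusion is rigidity: once [u <= v] is known, [(v - u) exp (L t)] is nondecreasing,
    so a gap that is closed at [b] was never open. *)
Lemma ode_compare (f : R -> R -> R) (L a b : R) (u v du dv : R -> R) :
  a <= b -> 0 <= L ->
  (forall t y z, a <= t <= b -> Rabs (f t y - f t z) <= L * Rabs (y - z)) ->
  (forall t, a <= t <= b -> is_derive u t (du t)) ->
  (forall t, a <= t <= b -> is_derive v t (dv t)) ->
  (forall t, a <= t <= b -> du t <= f t (u t)) ->
  (forall t, a <= t <= b -> f t (v t) <= dv t) ->
  u a <= v a ->
  (forall t, a <= t <= b -> u t <= v t) /\
  (u b = v b -> forall t, a <= t <= b -> u t = v t).
Proof.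
  intros Hab HL Hlip Hu Hv Hdu Hdv H0.
  assert (Hle : forall t, a <= t <= b -> u t <= v t).
  { intros t1 Ht1.
    (* Gronwall's inequality for the squared negative part of [v - u]. *)
    pose (m := fun t => (Rmin (v t - u t) 0) ^ 2).
    assert (Hm : - (m a * exp (- (2 * L) * a)) <= - (m t1 * exp (- (2 * L) * t1))).
    { apply (derive_ge0_le (fun t => - (m t * exp (- (2 * L) * t)))
        (fun t => - ((dv t - du t) * (2 * Rmin (v t - u t) 0) * exp (- (2 * L) * t)
                     + m t * (- (2 * L) * exp (- (2 * L) * t))))); try lra.
      - intros t Ht; apply @is_derive_opp.
        apply (is_derive_mult m (fun t => exp (- (2 * L) * t)) t).
        + unfold m.
          apply (is_derive_comp (fun y => (Rmin y 0) ^ 2) (fun t => v t - u t)).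
          * apply is_derive_Rmin0_sqr.
          * apply (is_derive_minus v u); [apply Hv | apply Hu]; lra.
        + auto_derive; auto; ring.
        + intros; apply Rmult_comm.
      - intros t Ht.
        assert (He : 0 < exp (- (2 * L) * t)) by apply exp_pos.
        unfold m.
        enough ((dv t - du t) * (2 * Rmin (v t - u t) 0)
                - 2 * L * Rmin (v t - u t) 0 ^ 2 <= 0).
        { set (m0 := Rmin (v t - u t) 0) in *; set (e := exp (- (2 * L) * t)) in *.
          replace (- ((dv t - du t) * (2 * m0) * e + m0 ^ 2 * (- (2 * L) * e)))
            with (- ((dv t - du t) * (2 * m0) - 2 * L * m0 ^ 2) * e) by ring.
          apply Rmult_le_pos; lra. }
        assert (Hl := Hlip t (v t) (u t) ltac:(lra)).
        specialize (Hdu t ltac:(lra)); specialize (Hdv t ltac:(lra)).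
        apply Rabs_le_between in Hl.
        unfold Rmin; destruct (Rle_dec (v t - u t) 0); [|nra].
        rewrite Rabs_left1 in Hl by lra.
        assert (L * (v t - u t) <= dv t - du t) by lra. nra. }
    unfold m in Hm; rewrite (Rmin_right (v a - u a)) in Hm by lra.
    assert (He : 0 < exp (- (2 * L) * t1)) by apply exp_pos.
    destruct (Rle_lt_dec (u t1) (v t1)); auto.
    rewrite Rmin_left in Hm by lra.
    assert (0 < (v t1 - u t1) ^ 2 * exp (- (2 * L) * t1)) by (apply Rmult_lt_0_compat; nra).
    lra. }
  split; auto.
  intros Eb t1 Ht1.
  assert (Hm : (v t1 - u t1) * exp (L * t1) <= (v b - u b) * exp (L * b)).
  { apply (derive_ge0_le (fun t => (v t - u t) * exp (L * t))
      (fun t => (dv t - du t) * exp (L * t) + (v t - u t) * (L * exp (L * t)))); try lra.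
    - intros t Ht; apply (is_derive_mult (fun t => v t - u t) (fun t => exp (L * t)) t).
      + apply (is_derive_minus v u); [apply Hv | apply Hu]; lra.
      + auto_derive; auto; ring.
      + intros; apply Rmult_comm.
    - intros t Ht.
      assert (He : 0 < exp (L * t)) by apply exp_pos.
      assert (Hl := Hlip t (v t) (u t) ltac:(lra)).
      specialize (Hdu t ltac:(lra)); specialize (Hdv t ltac:(lra)).
      specialize (Hle t ltac:(lra)).
      rewrite (Rabs_pos_eq (v t - u t)) in Hl by lra.
      apply Rabs_le_between in Hl.
      enough (0 <= (dv t - du t) + (v t - u t) * L) by nra. lra. }
  specialize (Hle t1 Ht1).
  assert (He : 0 < exp (L * t1)) by apply exp_pos.
  rewrite Eb, Rminus_diag, Rmult_0_l in Hm. nra.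
Qed.

(** The gap satisfies [(v - u)' <= L (v - u) + C], so [(v - u) exp (- L t) - C t] is nonincreasing;
    [0 <= a] bounds [exp (- L t)] by 1. The constant is crude but of first order in [C], which is
    what continuity in the frequency requires. *)
Lemma ode_gronwall (f : R -> R -> R) (L C a b : R) (u v du dv : R -> R) :
  0 <= a -> a <= b -> 0 <= L -> 0 <= C ->
  (forall t y z, a <= t <= b -> Rabs (f t y - f t z) <= L * Rabs (y - z)) ->
  (forall t, a <= t <= b -> is_derive u t (du t)) ->
  (forall t, a <= t <= b -> is_derive v t (dv t)) ->
  (forall t, a <= t <= b -> du t = f t (u t)) ->
  (forall t, a <= t <= b -> f t (v t) <= dv t <= f t (v t) + C) ->
  u a = v a ->
  v b - u b <= C * (b - a) * exp (L * b).
Proof.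
  intros Ha Hab HL HC Hlip Hu Hv Hdu Hdv H0.
  destruct (ode_compare f L a b u v du dv) as [Hle _]; auto; try lra.
  { intros t Ht; rewrite Hdu; auto; lra. }
  { intros t Ht; apply Hdv; auto. }
  assert (Hm : C * a - (v a - u a) * exp (- L * a) <= C * b - (v b - u b) * exp (- L * b)).
  { apply (derive_ge0_le (fun t => C * t - (v t - u t) * exp (- L * t))
      (fun t => C - ((dv t - du t) * exp (- L * t) + (v t - u t) * (- L * exp (- L * t))))); try lra.
    - intros t Ht. apply @is_derive_minus.
      + auto_derive; auto; ring.
      + apply (is_derive_mult (fun t => v t - u t) (fun t => exp (- L * t)) t).
        * apply (is_derive_minus v u); [apply Hv | apply Hu]; lra.
        * auto_derive; auto; ring.
        * intros; apply Rmult_comm.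
    - intros t Ht.
      assert (He : 0 < exp (- L * t)) by apply exp_pos.
      assert (He1 : exp (- L * t) <= 1).
      { rewrite <- exp_0; destruct (Req_dec (L * t) 0).
        - right; f_equal; lra.
        - left; apply exp_increasing; nra. }
      assert (Hl := Hlip t (v t) (u t) ltac:(lra)).
      specialize (Hdu t ltac:(lra)); specialize (Hdv t ltac:(lra)).
      specialize (Hle t ltac:(lra)).
      rewrite (Rabs_pos_eq (v t - u t)) in Hl by lra.
      apply Rabs_le_between in Hl.
      assert (dv t - du t - L * (v t - u t) <= C) by lra.
      nra. }
  rewrite H0, Rminus_diag, Rmult_0_l in Hm.
  assert (He : exp (- L * b) * exp (L * b) = 1).
  { rewrite <- exp_plus, <- exp_0; f_equal; ring. }
  assert (0 < exp (L * b)) by apply exp_pos.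
  replace (v b - u b) with ((v b - u b) * exp (- L * b) * exp (L * b)).
  - apply Rmult_le_compat_r; lra.
  - rewrite Rmult_assoc, He; ring.
Qed.

Definition prufer_rhs (q y : R) : R := cos y ^ 2 + q * sin y ^ 2.

Lemma sin_abs_le (x : R) : Rabs (sin x) <= Rabs x.
Proof.
  destruct (MVT_gen sin 0 x cos) as [c [_ E]].
  - intros; apply is_derive_Reals, derivable_pt_lim_sin.
  - intros; apply continuity_sin.
  - rewrite sin_0, !Rminus_0_r in E; rewrite E, Rabs_mult.
    assert (Rabs (cos c) <= 1) by (apply Rabs_le; generalize (COS_bound c); lra).
    generalize (Rabs_pos x) (Rabs_pos (cos c)); nra.
Qed.

Lemma prufer_rhs_lipschitz (q y z M : R) :
  Rabs q <= M -> Rabs (prufer_rhs q y - prufer_rhs q z) <= (1 + M) * Rabs (y - z).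
Proof.
  intros Hq.
  (* With [cos^2 = 1 - sin^2] only [(q - 1) (sin^2 y - sin^2 z)] remains, and the difference of
     squares factors. *)
  replace (prufer_rhs q y - prufer_rhs q z) with ((q - 1) * (sin (y + z) * sin (y - z))).
  - rewrite !Rabs_mult.
    assert (H1 : Rabs (q - 1) <= 1 + M).
    { unfold Rminus; eapply Rle_trans; [apply Rabs_triang|].
      rewrite Rabs_Ropp, Rabs_R1; lra. }
    assert (H2 : Rabs (sin (y + z)) <= 1) by (apply Rabs_le; generalize (SIN_bound (y + z)); lra).
    assert (H3 := sin_abs_le (y - z)).
    assert (0 <= M) by (generalize (Rabs_pos q); lra).
    apply Rmult_le_compat; auto using Rabs_pos.
    { apply Rmult_le_pos; apply Rabs_pos. }
    generalize (Rabs_pos (sin (y + z))) (Rabs_pos (sin (y - z))); nra.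
  - unfold prufer_rhs. rewrite sin_plus, sin_minus.
    assert (Hy := sin2_cos2 y); assert (Hz := sin2_cos2 z); unfold Rsqr in *.
    replace (cos y ^ 2) with (1 - sin y ^ 2) by (simpl; lra).
    replace (cos z ^ 2) with (1 - sin z ^ 2) by (simpl; lra).
    replace ((sin y * cos z + cos y * sin z) * (sin y * cos z - cos y * sin z))
      with (sin y * sin y * (cos z * cos z) - cos y * cos y * (sin z * sin z)) by ring.
    replace (cos z * cos z) with (1 - sin z * sin z) by lra.
    replace (cos y * cos y) with (1 - sin y * sin y) by lra.
    ring.
Qed.

(* The angle is the integral of the angular velocity of the curve [(Q, P)]. *)
Lemma polar_angle (P Q dP dQ : R -> R) (r th0 : R) :
  0 < r ->
  (forall t, 0 < t -> is_derive P t (dP t)) ->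
  (forall t, 0 < t -> is_derive Q t (dQ t)) ->
  (forall t, 0 < t -> continuous dP t) ->
  (forall t, 0 < t -> continuous dQ t) ->
  (forall t, 0 < t -> 0 < P t ^ 2 + Q t ^ 2) ->
  P r = sqrt (P r ^ 2 + Q r ^ 2) * sin th0 ->
  Q r = sqrt (P r ^ 2 + Q r ^ 2) * cos th0 ->
  exists th : R -> R, th r = th0 /\ forall t, 0 < t ->
    is_derive th t ((dP t * Q t - P t * dQ t) / (P t ^ 2 + Q t ^ 2)) /\
    P t = sqrt (P t ^ 2 + Q t ^ 2) * sin (th t) /\
    Q t = sqrt (P t ^ 2 + Q t ^ 2) * cos (th t).
Proof.
  intros Hr HP HQ CdP CdQ Hpos Pr Qr.
  pose (w := fun t => (dP t * Q t - P t * dQ t) / (P t ^ 2 + Q t ^ 2)).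
  assert (CP : forall t, 0 < t -> continuous P t).
  { intros t Ht; apply @ex_derive_continuous; exists (dP t); auto. }
  assert (CQ : forall t, 0 < t -> continuous Q t).
  { intros t Ht; apply @ex_derive_continuous; exists (dQ t); auto. }
  assert (Cw : forall t, 0 < t -> continuous w t).
  { intros t Ht; unfold w, Rdiv.
    apply (continuous_mult (fun t => dP t * Q t - P t * dQ t) (fun t => / (P t ^ 2 + Q t ^ 2))).
    - apply (continuous_minus (fun t => dP t * Q t) (fun t => P t * dQ t)).
      + apply (continuous_mult dP Q); auto.
      + apply (continuous_mult P dQ); auto.
    - apply continuous_Rinv_comp.
      + apply (continuous_plus (fun t => P t ^ 2) (fun t => Q t ^ 2)); simpl;
        apply @continuous_mult; auto; apply @continuous_mult; auto; apply continuous_const.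
      + specialize (Hpos t Ht); lra. }
  pose (th := fun t => th0 + RInt w r t).
  assert (Hth : forall t, 0 < t -> is_derive th t (w t)).
  { intros t Ht; unfold th.
    replace (w t) with (0 + w t) by ring.
    apply @is_derive_plus; [apply @is_derive_const|].
    apply (is_derive_RInt w (fun t => RInt w r t) r).
    - exists (mkposreal t Ht); intros y Hy.
      unfold ball in Hy; simpl in Hy; unfold AbsRing_ball, abs, minus, plus, opp in Hy; simpl in Hy.
      apply Rabs_def2 in Hy.
      apply @RInt_correct, (@ex_RInt_continuous R_CompleteNormedModule); intros z Hz; apply Cw.
      assert (0 < Rmin r y) by (apply Rmin_glb_lt; lra). lra.
    - apply Cw; auto. }
  assert (Er : th r = th0).
  { unfold th; rewrite RInt_point; unfold zero; simpl; ring. }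
  exists th; split; auto; intros t Ht; split; [apply Hth; auto|].
  pose (rho := fun t => sqrt (P t ^ 2 + Q t ^ 2)).
  assert (Hrho : forall t, 0 < t -> 0 < rho t) by (intros; apply sqrt_lt_R0; auto).
  assert (Hrho2 : forall t, 0 < t -> rho t * rho t = P t ^ 2 + Q t ^ 2).
  { intros; unfold rho; apply sqrt_sqrt; left; auto. }
  (* [Y] is the cosine of the difference between the true polar angle and [th]. It equals 1 at [r],
     and the choice of [w] makes its derivative vanish. *)
  pose (Y := fun t => (P t * sin (th t) + Q t * cos (th t)) / rho t).
  assert (HY : forall t, 0 < t -> is_derive Y t 0).
  { intros s Hs.
    assert (Hrd : is_derive rho s ((P s * dP s + Q s * dQ s) / rho s)).
    { unfold rho. specialize (Hrho s Hs); unfold rho in Hrho.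
      evar_last.
      - apply (is_derive_sqrt (fun t => P t ^ 2 + Q t ^ 2)); auto.
        apply @is_derive_plus; apply is_derive_pow; auto.
      - unfold plus; simpl; simpl in Hrho; field; lra. }
    evar_last.
    - apply (is_derive_div (fun t => P t * sin (th t) + Q t * cos (th t)) rho); [|exact Hrd|].
      + apply @is_derive_plus; apply @is_derive_mult; auto.
        * apply (is_derive_comp sin th); [|apply Hth; auto].
          apply is_derive_Reals, derivable_pt_lim_sin.
        * intros; apply Rmult_comm.
        * apply (is_derive_comp cos th); [|apply Hth; auto].
          apply is_derive_Reals, derivable_pt_lim_cos.
        * intros; apply Rmult_comm.
      + specialize (Hrho s Hs); lra.
    - unfold plus, mult, scal; simpl; unfold mult; simpl.
      specialize (Hrho s Hs); specialize (Hrho2 s Hs); specialize (Hpos s Hs).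
      unfold w. rewrite <- Hrho2.
      apply Rmult_eq_reg_r with (rho s * rho s * rho s); [|nra].
      rewrite Rmult_0_l.
      transitivity ((P s * sin (th s) + Q s * cos (th s)) * (P s * dP s + Q s * dQ s) * 0
        + ((dP s * sin (th s) + dQ s * cos (th s)) * (rho s * rho s)
         + (P s * cos (th s) - Q s * sin (th s)) * (dP s * Q s - P s * dQ s)
         - (P s * sin (th s) + Q s * cos (th s)) * (P s * dP s + Q s * dQ s))).
      + field. lra.
      + rewrite Hrho2. ring. }
  assert (HY1 : Y t = 1).
  { assert (Y r = 1).
    { unfold Y; fold (rho r) in Pr, Qr. specialize (Hrho r Hr).
      rewrite Er. rewrite Pr, Qr at 1.
      assert (H := sin2_cos2 th0); unfold Rsqr in H.
      replace (rho r * sin th0 * sin th0 + rho r * cos th0 * cos th0)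
        with (rho r * (sin th0 * sin th0 + cos th0 * cos th0)) by ring.
      rewrite H; field; lra. }
    rewrite <- H.
    destruct (Rle_dec t r).
    - apply derive_eq0_eq; auto; intros; apply HY; lra.
    - symmetry; apply derive_eq0_eq; [lra|]; intros; apply HY; lra. }
  fold (rho t). unfold Y in HY1.
  specialize (Hrho t Ht); specialize (Hrho2 t Ht).
  assert (E1 : P t * sin (th t) + Q t * cos (th t) = rho t).
  { apply Rmult_eq_reg_r with (/ rho t); [|apply Rinv_neq_0_compat; lra].
    rewrite Rinv_r by lra; exact HY1. }
  assert (H := sin2_cos2 (th t)); unfold Rsqr in H.
  (* The radial and transversal components have squares adding up to [rho^2]; the radial one is
     already [rho]. *)
  assert (E2 : P t * cos (th t) - Q t * sin (th t) = 0).
  { assert (Hs : (P t * cos (th t) - Q t * sin (th t)) ^ 2 + rho t ^ 2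
       = (P t ^ 2 + Q t ^ 2) * (sin (th t) * sin (th t) + cos (th t) * cos (th t))).
    { rewrite <- E1. ring. }
    rewrite H, <- Hrho2 in Hs. nra. }
  split.
  - transitivity (P t * (sin (th t) * sin (th t) + cos (th t) * cos (th t))).
    { rewrite H; ring. }
    rewrite <- E1; apply Rminus_diag_uniq.
    transitivity ((P t * cos (th t) - Q t * sin (th t)) * cos (th t)); [ring | rewrite E2; ring].
  - transitivity (Q t * (sin (th t) * sin (th t) + cos (th t) * cos (th t))).
    { rewrite H; ring. }
    rewrite <- E1; apply Rminus_diag_uniq.
    transitivity (- (P t * cos (th t) - Q t * sin (th t)) * sin (th t)); [ring | rewrite E2; ring].
Qed.

(** * Pruefer angles *)

Lemma derive_eq_of_eq_right (u v : R -> R) (a b du dv : R) :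
  a < b -> is_derive u a du -> is_derive v a dv ->
  (forall t, a <= t <= b -> u t = v t) -> du = dv.
Proof.
  intros Hab Hu Hv E.
  assert (HD : derivable_pt_lim (fun t => v t - u t) a (dv - du)).
  { apply is_derive_Reals, (is_derive_minus v u); auto. }
  destruct (Req_dec (dv - du) 0) as [H0|H0]; [lra|exfalso].
  destruct (HD (Rabs (dv - du)) (Rabs_pos_lt _ H0)) as [d Hd].
  assert (Hp := cond_pos d).
  set (h := Rmin (d / 2) (b - a)).
  assert (Hh : 0 < h) by (apply Rmin_glb_lt; lra).
  assert (h <= d / 2) by apply Rmin_l. assert (h <= b - a) by apply Rmin_r.
  specialize (Hd h ltac:(lra)).
  rewrite (Rabs_pos_eq h) in Hd by lra. specialize (Hd ltac:(lra)).
  rewrite (E a), (E (a + h)) in Hd by lra.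
  replace ((v (a + h) - v (a + h) - (v a - v a)) / h - (dv - du)) with (- (dv - du)) in Hd
    by (field; lra).
  rewrite Rabs_Ropp in Hd; lra.
Qed.

(** If the values met at [b], rigidity would make [u] and [v] coincide on the whole interval, hence
    also their derivatives at [a]. Strictness is therefore demanded only at the initial point. *)
Lemma ode_compare_strict (f : R -> R -> R) (L a b : R) (u v du dv : R -> R) :
  a < b -> 0 <= L ->
  (forall t y z, a <= t <= b -> Rabs (f t y - f t z) <= L * Rabs (y - z)) ->
  (forall t, a <= t <= b -> is_derive u t (du t)) ->
  (forall t, a <= t <= b -> is_derive v t (dv t)) ->
  (forall t, a <= t <= b -> du t <= f t (u t)) ->
  (forall t, a <= t <= b -> f t (v t) <= dv t) ->
  u a <= v a -> (u a = v a -> du a < dv a) -> u b < v b.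
Proof.
  intros Hab HL Hlip Hu Hv Hdu Hdv H0 Hs.
  destruct (ode_compare f L a b u v du dv) as [H1 H2]; auto; try lra.
  destruct (H1 b) as [H|H]; auto; try lra.
  exfalso; specialize (H2 H).
  assert (Ha : u a = v a) by (apply H2; lra).
  specialize (Hs Ha).
  assert (du a = dv a); [|lra].
  apply (derive_eq_of_eq_right u v a b); auto; [apply Hu | apply Hv]; lra.
Qed.

Definition potential (nu x t : R) : R := x ^ 2 - (nu ^ 2 - 1 / 4) / t ^ 2.

Lemma inv_sqr_le (r t : R) : 0 < r -> r <= t -> / t ^ 2 <= / r ^ 2.
Proof.
  intros Hr Ht; apply Rinv_le_contravar.
  - apply pow_lt; lra.
  - apply pow_incr; lra.
Qed.

Lemma potential_bound (nu x r t : R) :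
  0 < r -> r <= t -> Rabs (potential nu x t) <= x ^ 2 + Rabs (nu ^ 2 - 1 / 4) / r ^ 2.
Proof.
  intros Hr Ht; unfold potential, Rminus at 1.
  eapply Rle_trans; [apply Rabs_triang|].
  rewrite Rabs_Ropp; unfold Rdiv; rewrite Rabs_mult.
  rewrite (Rabs_pos_eq (x ^ 2)) by apply pow2_ge_0.
  rewrite (Rabs_pos_eq (/ t ^ 2)) by (left; apply Rinv_0_lt_compat, pow_lt; lra).
  apply Rplus_le_compat_l, Rmult_le_compat_l; [apply Rabs_pos|].
  now apply inv_sqr_le.
Qed.

Lemma sin_acot (p : R) : sin (PI / 2 - atan p) = / sqrt (1 + p ^ 2).
Proof.
  rewrite sin_shift, cos_atan; unfold Rdiv; rewrite Rmult_1_l.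
  do 2 f_equal; unfold Rsqr; ring.
Qed.

Lemma cos_acot (p : R) : cos (PI / 2 - atan p) = p / sqrt (1 + p ^ 2).
Proof.
  rewrite cos_shift, sin_atan.
  do 2 f_equal; unfold Rsqr; ring.
Qed.

Lemma acot_bound (p : R) : 0 < PI / 2 - atan p < PI.
Proof. generalize (atan_bound p); lra. Qed.

Lemma prufer_rhs_acot (q p : R) : prufer_rhs q (PI / 2 - atan p) = (p ^ 2 + q) / (1 + p ^ 2).
Proof.
  unfold prufer_rhs; rewrite sin_acot, cos_acot.
  assert (0 < 1 + p ^ 2) by nra.
  assert (Hs := sqrt_lt_R0 _ H); assert (Hq := sqrt_sqrt (1 + p ^ 2) ltac:(lra)).
  rewrite <- Hq at 3. field; lra.
Qed.

Lemma is_derive_acot (p : R -> R) (t dp : R) :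
  is_derive p t dp -> is_derive (fun t => PI / 2 - atan (p t)) t (- dp / (1 + p t ^ 2)).
Proof.
  intros H.
  assert (0 < 1 + p t ^ 2) by nra.
  evar_last.
  - apply @is_derive_minus; [apply @is_derive_const|].
    apply (is_derive_comp atan p); [|exact H].
    apply is_derive_Reals, derivable_pt_lim_atan.
  - unfold minus, plus, opp, zero, scal; simpl; unfold mult; simpl; unfold Rsqr. field; nra.
Qed.

(** The sign condition at [r] selects one of [W] and [- W], so that the initial angle can be taken
    in [(0, PI)]. It excludes nothing else: [W r = 0] together with the Robin condition would give
    [W' r = 0] as well. *)
Definition sl_solution (nu c r x : R) (W dW : R -> R) : Prop :=
  (forall t, 0 < t -> is_derive W t (dW t)) /\
  (forall t, 0 < t -> is_derive dW t (- (potential nu x t * W t))) /\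
  (forall t, 0 < t -> 0 < W t ^ 2 + dW t ^ 2) /\
  0 < W r /\ dW r = c / r * W r.

(** The free scale [b] is 1 for counting eigenvalues, [x] for asymptotics, and the square root of an
    upper bound of the potential for speed estimates. The radius [rho] ties the angle to [W], since
    the angular equation alone forgets the solution. *)
Definition prufer_angle (nu c r x b : R) (W dW th : R -> R) : Prop :=
  th r = PI / 2 - atan (c / r / b) /\
  forall t, 0 < t ->
    is_derive th t (b * cos (th t) ^ 2 + potential nu x t / b * sin (th t) ^ 2) /\
    exists rho, 0 < rho /\ b * W t = rho * sin (th t) /\ dW t = rho * cos (th t).

Lemma prufer_angle_exists (nu c r x b : R) (W dW : R -> R) :
  0 < r -> 0 < b -> sl_solution nu c r x W dW ->
  exists th, prufer_angle nu c r x b W dW th.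
Proof.
  intros Hr Hb [HW [HdW [Hpos [Wr dWr]]]].
  assert (Hpos' : forall t, 0 < t -> 0 < (b * W t) ^ 2 + dW t ^ 2).
  { intros t Ht; specialize (Hpos t Ht).
    destruct (Req_dec (W t) 0) as [E|E].
    - rewrite E in *; nra.
    - assert (0 < (b * W t) ^ 2); [|nra].
      rewrite Rpow_mult_distr; apply Rmult_lt_0_compat; apply pow2_gt_0; lra. }
  set (p := c / r / b).
  assert (Hp : 0 < 1 + p ^ 2) by nra.
  assert (Hsp := sqrt_lt_R0 _ Hp).
  assert (Er : sqrt ((b * W r) ^ 2 + dW r ^ 2) = b * W r * sqrt (1 + p ^ 2)).
  { replace ((b * W r) ^ 2 + dW r ^ 2) with ((b * W r) ^ 2 * (1 + p ^ 2)).
    - rewrite sqrt_mult_alt by apply pow2_ge_0.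
      rewrite sqrt_pow2; auto; nra.
    - rewrite dWr; unfold p; field; lra. }
  destruct (polar_angle (fun t => b * W t) dW (fun t => b * dW t)
     (fun t => - (potential nu x t * W t)) r (PI / 2 - atan p)) as [th [E0 H]]; auto.
  - intros t Ht; apply (is_derive_scal W t b); auto.
  - intros t Ht; apply (continuous_mult (fun _ => b) dW); [apply continuous_const|].
    apply @ex_derive_continuous; eexists; apply HdW; auto.
  - intros t Ht; apply (continuous_opp (fun t => potential nu x t * W t)).
    apply (continuous_mult (potential nu x) W).
    + apply @ex_derive_continuous; unfold potential.
      auto_derive; apply Rgt_not_eq; nra.
    + apply @ex_derive_continuous; eexists; apply HW; auto.
  - rewrite Er, sin_acot; field; lra.
  - rewrite Er, cos_acot, dWr; unfold p at 2; field; lra.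
  - exists th; split; auto; intros t Ht.
    destruct (H t Ht) as [Hd [HP HQ]].
    assert (Hrho := sqrt_lt_R0 _ (Hpos' t Ht)).
    split; [|exists (sqrt ((b * W t) ^ 2 + dW t ^ 2)); auto].
    evar_last; [exact Hd|].
    assert (Hq := sqrt_sqrt ((b * W t) ^ 2 + dW t ^ 2) ltac:(specialize (Hpos' t Ht); lra)).
    set (rho := sqrt ((b * W t) ^ 2 + dW t ^ 2)) in *.
    rewrite <- Hq.
    replace (W t) with (rho * sin (th t) / b) by (rewrite <- HP; field; lra).
    rewrite HQ; field; lra.
Qed.

Lemma sin_INR_PI (k : nat) : sin (INR k * PI) = 0.
Proof. apply sin_eq_0_1; exists (Z.of_nat k); now rewrite <- INR_IZR_INZ. Qed.

Lemma cos_INR_PI_sqr (k : nat) : cos (INR k * PI) * cos (INR k * PI) = 1.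
Proof.
  assert (H := sin2_cos2 (INR k * PI)); unfold Rsqr in H; rewrite sin_INR_PI in H; lra.
Qed.

(** Subtracting [k PI] multiplies both sines by the same sign. Two angles less than [PI / 2] apart
    on opposite sides of [k PI] would then have sines of opposite signs; the last hypothesis
    excludes that [b] lies on the multiple itself while [a] does not. *)
Lemma angle_side (k : nat) (a b : R) :
  Rabs (a - b) < PI / 2 -> 0 <= sin a * sin b -> (sin b = 0 -> sin a = 0) ->
  (a < INR k * PI -> b < INR k * PI) /\ (INR k * PI < a -> INR k * PI < b).
Proof.
  intros Hab Hs H0; apply Rabs_def2 in Hab.
  assert (Hk := sin_INR_PI k); assert (Hc := cos_INR_PI_sqr k).
  assert (HPI := PI_RGT_0).
  assert (Ea : sin (a - INR k * PI) = sin a * cos (INR k * PI)) by (rewrite sin_minus, Hk; ring).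
  assert (Eb : sin (b - INR k * PI) = sin b * cos (INR k * PI)) by (rewrite sin_minus, Hk; ring).
  assert (Hm : 0 <= sin (a - INR k * PI) * sin (b - INR k * PI)).
  { rewrite Ea, Eb.
    replace (sin a * cos (INR k * PI) * (sin b * cos (INR k * PI)))
      with (sin a * sin b * (cos (INR k * PI) * cos (INR k * PI))) by ring.
    rewrite Hc; lra. }
  assert (Hz : sin (b - INR k * PI) = 0 -> sin (a - INR k * PI) = 0).
  { rewrite Ea, Eb; intros E; rewrite H0; [ring|].
    apply Rmult_integral in E; destruct E as [E|E]; auto; rewrite E in Hc; lra. }
  split; intros H.
  - destruct (Rlt_le_dec b (INR k * PI)) as [|Hb]; auto; exfalso.
    assert (sin (a - INR k * PI) < 0) by (apply sin_lt_0_var; lra).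
    destruct Hb as [Hb|Hb].
    + assert (0 < sin (b - INR k * PI)) by (apply sin_gt_0; lra). nra.
    + rewrite <- Hb, Rminus_diag, sin_0 in Hz; lra.
  - destruct (Rlt_le_dec (INR k * PI) b) as [|Hb]; auto; exfalso.
    assert (0 < sin (a - INR k * PI)) by (apply sin_gt_0; lra).
    destruct Hb as [Hb|Hb].
    + assert (sin (b - INR k * PI) < 0) by (apply sin_lt_0_var; lra). nra.
    + rewrite Hb, Rminus_diag, sin_0 in Hz; lra.
Qed.

Lemma cos_pos_Rabs_lt (d : R) : Rabs d < PI -> 0 < cos d -> Rabs d < PI / 2.
Proof.
  intros Hd Hc.
  assert (Hc' : 0 < cos (Rabs d)).
  { unfold Rabs; destruct (Rcase_abs d); auto; now rewrite cos_neg. }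
  destruct (Rlt_le_dec (Rabs d) (PI / 2)) as [|H]; auto; exfalso.
  assert (cos (Rabs d) <= 0); [|lra].
  apply cos_le_0; lra.
Qed.

(** To leave the interval [(- PI / 2, PI / 2)] a continuous [D] would have to pass through a zero of
    the cosine. *)
Lemma cos_pos_stays (D : R -> R) (a b : R) :
  a <= b -> (forall t, a <= t <= b -> continuity_pt D t) ->
  (forall t, a <= t <= b -> 0 < cos (D t)) ->
  Rabs (D a) < PI / 2 -> Rabs (D b) < PI / 2.
Proof.
  intros Hab HD Hc Ha.
  destruct (Rlt_le_dec (Rabs (D b)) (PI / 2)) as [|Hb]; auto; exfalso.
  destruct Hab as [Hab|Hab]; [|subst; lra].
  destruct (IVT_interv (fun t => Rabs (D t) - PI / 2) a b) as [z [Hz E]]; auto; try lra.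
  - intros t Ht.
    apply continuity_pt_minus; [|apply continuity_pt_const; intros ? ?; auto].
    apply (continuity_pt_comp D Rabs); [apply HD; lra|apply Rcontinuity_abs].
  - destruct Hb as [Hb|Hb]; [lra|exfalso].
    specialize (Hc b ltac:(lra)).
    assert (cos (Rabs (D b)) = 0) by (rewrite <- Hb; apply cos_PI2).
    unfold Rabs in H; destruct (Rcase_abs (D b)); try rewrite cos_neg in H; lra.
  - specialize (Hc z Hz).
    assert (cos (Rabs (D z)) = 0) by (replace (Rabs (D z)) with (PI / 2) by lra; apply cos_PI2).
    unfold Rabs in H; destruct (Rcase_abs (D z)); try rewrite cos_neg in H; lra.
Qed.

(* The curves [(b1 W, W')] and [(b2 W, W')] cross the coordinate axes simultaneously. *)
Lemma prufer_angle_scale (nu c r x b1 b2 : R) (W dW th1 th2 : R -> R) (t : R) (k : nat) :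
  0 < r -> r <= t -> 0 < b1 -> 0 < b2 ->
  prufer_angle nu c r x b1 W dW th1 -> prufer_angle nu c r x b2 W dW th2 ->
  (th1 t < INR k * PI -> th2 t < INR k * PI) /\ (INR k * PI < th1 t -> INR k * PI < th2 t).
Proof.
  intros Hr Ht Hb1 Hb2 [E1 H1] [E2 H2].
  assert (Hcos : forall s, r <= s <= t -> 0 < cos (th1 s - th2 s)).
  { intros s Hs.
    destruct (H1 s ltac:(lra)) as [_ [p1 [Hp1 [S1 C1]]]].
    destruct (H2 s ltac:(lra)) as [_ [p2 [Hp2 [S2 C2]]]].
    rewrite cos_minus.
    (* This is the scalar product of the two curves. Its positivity keeps the angles within a
       quarter turn of each other. *)
    assert (E : p1 * p2 * (cos (th1 s) * cos (th2 s) + sin (th1 s) * sin (th2 s))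
                = dW s ^ 2 + b1 * b2 * W s ^ 2).
    { transitivity ((p1 * cos (th1 s)) * (p2 * cos (th2 s)) + (p1 * sin (th1 s)) * (p2 * sin (th2 s)));
        [ring|]. rewrite <- S1, <- C1, <- S2, <- C2; ring. }
    assert (0 < dW s ^ 2 + b1 * b2 * W s ^ 2).
    { assert (0 < b1 * b2) by nra.
      destruct (Req_dec (W s) 0) as [Z|Z].
      - assert (dW s <> 0).
        { intros Z'. rewrite Z, Rmult_0_r in S1; rewrite Z' in C1.
          assert (Q := sin2_cos2 (th1 s)); unfold Rsqr in Q.
          assert (sin (th1 s) = 0) by (apply Rmult_eq_reg_l with p1; lra).
          assert (cos (th1 s) = 0) by (apply Rmult_eq_reg_l with p1; lra).
          rewrite H0, H3 in Q; lra. }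
        rewrite Z. assert (0 < dW s ^ 2) by (apply pow2_gt_0; auto). nra.
      - assert (0 < W s ^ 2) by (apply pow2_gt_0; auto).
        assert (0 < b1 * b2 * W s ^ 2) by nra. nra. }
    assert (0 < p1 * p2) by nra.
    rewrite <- E in H. apply Rmult_lt_reg_l with (p1 * p2); lra. }
  apply angle_side.
  - apply (cos_pos_stays (fun s => th1 s - th2 s) r t); auto.
    + intros s Hs; apply continuity_pt_minus.
      * eapply derive_continuity_pt; apply H1; lra.
      * eapply derive_continuity_pt; apply H2; lra.
    + apply cos_pos_Rabs_lt; [|apply Hcos; lra].
      rewrite E1, E2; apply Rabs_def1;
        generalize (acot_bound (c / r / b1)) (acot_bound (c / r / b2)); lra.
  - destruct (H1 t ltac:(lra)) as [_ [p1 [Hp1 [S1 _]]]].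
    destruct (H2 t ltac:(lra)) as [_ [p2 [Hp2 [S2 _]]]].
    apply Rmult_le_reg_l with (p1 * p2); [nra|].
    replace (p1 * p2 * (sin (th1 t) * sin (th2 t)))
      with ((p1 * sin (th1 t)) * (p2 * sin (th2 t))) by ring.
    rewrite <- S1, <- S2.
    replace (b1 * W t * (b2 * W t)) with (b1 * b2 * (W t * W t)) by ring.
    rewrite Rmult_0_r; apply Rmult_le_pos; nra.
  - destruct (H1 t ltac:(lra)) as [_ [p1 [Hp1 [S1 _]]]].
    destruct (H2 t ltac:(lra)) as [_ [p2 [Hp2 [S2 _]]]].
    intros Z; rewrite Z, Rmult_0_r in S2.
    assert (W t = 0) by (apply Rmult_eq_reg_l with b2; lra).
    rewrite H, Rmult_0_r in S1. apply Rmult_eq_reg_l with p1; lra.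
Qed.

(** * Dependence of the phase on the frequency *)

(** Monotonicity and continuity in the frequency are properties of the scalar initial value problem,
    so the solutions [W] are dropped here. *)
Definition phase_family (nu c r : R) (th : R -> R -> R) : Prop :=
  forall x, 0 < x -> th x r = PI / 2 - atan (c / r) /\
    forall t, 0 < t -> is_derive (th x) t (prufer_rhs (potential nu x t) (th x t)).

Lemma prufer_angle_phase_family (nu c r : R) (W dW th : R -> R -> R) :
  (forall x, 0 < x -> prufer_angle nu c r x 1 (W x) (dW x) (th x)) ->
  phase_family nu c r th.
Proof.
  intros H x Hx; destruct (H x Hx) as [E Hd]; split.
  - rewrite E; now rewrite Rdiv_1_r.
  - intros t Ht; destruct (Hd t Ht) as [D _].
    evar_last; [exact D|]. unfold prufer_rhs; now rewrite Rdiv_1_r, Rmult_1_l.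
Qed.

Lemma potential_lipschitz (nu x r t y z : R) :
  0 < r -> r <= t ->
  Rabs (prufer_rhs (potential nu x t) y - prufer_rhs (potential nu x t) z)
    <= (1 + (x ^ 2 + Rabs (nu ^ 2 - 1 / 4) / r ^ 2)) * Rabs (y - z).
Proof. intros; apply prufer_rhs_lipschitz, potential_bound; auto. Qed.

Lemma lipschitz_const_pos (nu x r : R) :
  0 < r -> 0 <= 1 + (x ^ 2 + Rabs (nu ^ 2 - 1 / 4) / r ^ 2).
Proof.
  intros Hr.
  assert (0 <= Rabs (nu ^ 2 - 1 / 4) / r ^ 2).
  { apply Rmult_le_pos; [apply Rabs_pos|left; apply Rinv_0_lt_compat, pow_lt; auto]. }
  generalize (pow2_ge_0 x); lra.
Qed.

(** At angle 0 the right-hand side is 1 whatever the potential, so the constant 0 is a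
    subsolution. *)
Lemma phase_pos (nu c r Ro x : R) (th : R -> R -> R) :
  0 < r < Ro -> phase_family nu c r th -> 0 < x -> 0 < th x Ro.
Proof.
  intros Hr H Hx; destruct (H x Hx) as [E Hd].
  apply (ode_compare_strict (fun t y => prufer_rhs (potential nu x t) y)
    (1 + (x ^ 2 + Rabs (nu ^ 2 - 1 / 4) / r ^ 2)) r Ro
    (fun _ => 0) (th x) (fun _ => 0) (fun t => prufer_rhs (potential nu x t) (th x t)));
    try lra.
  - apply (lipschitz_const_pos nu x r); lra.
  - intros; apply potential_lipschitz; lra.
  - intros; apply @is_derive_const.
  - intros; apply Hd; lra.
  - intros; unfold prufer_rhs; rewrite cos_0, sin_0; lra.
  - intros; lra.
  - rewrite E; generalize (acot_bound (c / r)); lra.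
  - rewrite E; generalize (acot_bound (c / r)); lra.
Qed.

Lemma prufer_rhs_incr (q1 q2 y : R) : q1 <= q2 -> prufer_rhs q1 y <= prufer_rhs q2 y.
Proof. intros; unfold prufer_rhs; generalize (pow2_ge_0 (sin y)); nra. Qed.

Lemma prufer_rhs_incr_strict (q1 q2 y : R) :
  0 < y < PI -> q1 < q2 -> prufer_rhs q1 y < prufer_rhs q2 y.
Proof.
  intros Hy H; unfold prufer_rhs.
  assert (0 < sin y ^ 2) by (apply pow_lt, sin_gt_0; lra). nra.
Qed.

Lemma potential_incr (nu x1 x2 t : R) :
  0 <= x1 -> x1 < x2 -> potential nu x1 t < potential nu x2 t.
Proof. intros; unfold potential; nra. Qed.

(** Both angles start at the same point of [(0, PI)], where the sine is nonzero; the larger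
    potential thus gives a larger speed already at [r], which is what the strict comparison asks
    for. *)
Lemma phase_increasing (nu c r Ro x1 x2 : R) (th : R -> R -> R) :
  0 < r < Ro -> phase_family nu c r th -> 0 < x1 -> x1 < x2 -> th x1 Ro < th x2 Ro.
Proof.
  intros Hr H Hx1 Hx2.
  destruct (H x1 ltac:(lra)) as [E1 H1]; destruct (H x2 ltac:(lra)) as [E2 H2].
  apply (ode_compare_strict (fun t y => prufer_rhs (potential nu x1 t) y)
    (1 + (x1 ^ 2 + Rabs (nu ^ 2 - 1 / 4) / r ^ 2)) r Ro
    (th x1) (th x2) (fun t => prufer_rhs (potential nu x1 t) (th x1 t))
    (fun t => prufer_rhs (potential nu x2 t) (th x2 t))); try lra.
  - apply (lipschitz_const_pos nu x1 r); lra.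
  - intros; apply potential_lipschitz; lra.
  - intros; apply H1; lra.
  - intros; apply H2; lra.
  - intros; lra.
  - intros; apply prufer_rhs_incr; left; apply potential_incr; lra.
  - intros E; rewrite E, E2; apply prufer_rhs_incr_strict; [apply acot_bound|].
    apply potential_incr; lra.
Qed.

Lemma phase_increment_le (nu c r Ro x1 x2 : R) (th : R -> R -> R) :
  0 < r < Ro -> phase_family nu c r th -> 0 < x1 -> x1 <= x2 ->
  th x2 Ro - th x1 Ro <=
    (x2 ^ 2 - x1 ^ 2) * (Ro - r) * exp ((1 + (x1 ^ 2 + Rabs (nu ^ 2 - 1 / 4) / r ^ 2)) * Ro).
Proof.
  intros Hr H Hx1 Hx2.
  destruct (H x1 ltac:(lra)) as [E1 H1]; destruct (H x2 ltac:(lra)) as [E2 H2].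
  apply (ode_gronwall (fun t y => prufer_rhs (potential nu x1 t) y)
    (1 + (x1 ^ 2 + Rabs (nu ^ 2 - 1 / 4) / r ^ 2)) (x2 ^ 2 - x1 ^ 2) r Ro
    (th x1) (th x2) (fun t => prufer_rhs (potential nu x1 t) (th x1 t))
    (fun t => prufer_rhs (potential nu x2 t) (th x2 t))); try lra; auto.
  - apply (lipschitz_const_pos nu x1 r); lra.
  - nra.
  - intros; apply potential_lipschitz; lra.
  - intros; apply H1; lra.
  - intros; apply H2; lra.
  - intros t Ht; unfold prufer_rhs, potential.
    generalize (pow2_ge_0 (sin (th x2 t))) (pow2_ge_0 (cos (th x2 t))).
    assert (Q := sin2_cos2 (th x2 t)); rewrite !Rsqr_pow2 in Q.
    assert (0 <= x2 ^ 2 - x1 ^ 2) by nra.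
    intros; split; nra.
Qed.

Lemma exp_le_compat (x y : R) : x <= y -> exp x <= exp y.
Proof. intros [H|H]; [left; now apply exp_increasing | subst; lra]. Qed.

Lemma phase_continuity (nu c r Ro x : R) (th : R -> R -> R) :
  0 < r < Ro -> phase_family nu c r th -> 0 < x -> continuity_pt (fun x => th x Ro) x.
Proof.
  intros Hr H Hx.
  (* Taking [x + 1] in the Lipschitz constant makes one [K] serve all frequencies up to [x + 1]. *)
  set (K := (Ro - r) * exp ((1 + ((x + 1) ^ 2 + Rabs (nu ^ 2 - 1 / 4) / r ^ 2)) * Ro)).
  assert (HK : 0 < K) by (apply Rmult_lt_0_compat; [lra|apply exp_pos]).
  assert (Hinc : forall a b, 0 < a -> a <= b -> a <= x + 1 -> b <= x + 1 ->
     Rabs (th b Ro - th a Ro) <= (2 * (x + 1) * K) * (b - a)).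
  { intros a b Ha Hab Hax Hbx.
    rewrite Rabs_pos_eq.
    2:{ destruct Hab; [|subst; lra]. assert (th a Ro < th b Ro); [|lra].
        apply (phase_increasing nu c r); auto. }
    eapply Rle_trans; [apply (phase_increment_le nu c r Ro a b th); auto|].
    rewrite Rmult_assoc.
    assert (Hle : (Ro - r) * exp ((1 + (a ^ 2 + Rabs (nu ^ 2 - 1 / 4) / r ^ 2)) * Ro) <= K).
    { apply Rmult_le_compat_l; [lra|]. apply exp_le_compat.
      apply Rmult_le_compat_r; [lra|]. nra. }
    apply Rle_trans with ((b ^ 2 - a ^ 2) * K).
    - apply Rmult_le_compat_l; auto; nra.
    - replace (b ^ 2 - a ^ 2) with ((b + a) * (b - a)) by ring.
      assert (0 <= K * (b - a)) by nra.
      replace ((b + a) * (b - a) * K) with ((b + a) * (K * (b - a))) by ring.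
      replace (2 * (x + 1) * K * (b - a)) with (2 * (x + 1) * (K * (b - a))) by ring.
      apply Rmult_le_compat_r; lra. }
  intros eps He.
  assert (HC : 0 < 2 * (x + 1) * K) by nra.
  exists (Rmin (Rmin 1 x) (eps / (2 * (x + 1) * K))); split.
  { apply Rmin_glb_lt; [apply Rmin_glb_lt; lra|]. apply Rdiv_lt_0_compat; auto. }
  intros y [_ Hy]; simpl in Hy; unfold R_dist in Hy.
  assert (Hy1 : Rabs (y - x) < Rmin 1 x) by (eapply Rlt_le_trans; [apply Hy|apply Rmin_l]).
  assert (Hy2 : Rabs (y - x) < eps / (2 * (x + 1) * K)) by (eapply Rlt_le_trans; [apply Hy|apply Rmin_r]).
  assert (Rmin 1 x <= 1) by apply Rmin_l. assert (Rmin 1 x <= x) by apply Rmin_r.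
  assert (Hy0 := Rabs_def2 _ _ Hy1).
  assert (He2 : 2 * (x + 1) * K * Rabs (y - x) < eps).
  { apply Rmult_lt_reg_r with (/ (2 * (x + 1) * K)); [now apply Rinv_0_lt_compat|].
    eapply Rle_lt_trans; [|apply Hy2]. right; field. lra. }
  simpl; unfold R_dist.
  destruct (Rle_dec x y).
  - eapply Rle_lt_trans; [apply Hinc; lra|]. rewrite Rabs_pos_eq in He2; lra.
  - rewrite Rabs_minus_sym; eapply Rle_lt_trans; [apply Hinc; lra|].
    rewrite Rabs_left1 in He2; lra.
Qed.

(** This is the angle of [t^(delta + 1/2)], the solution at frequency 0 and order [delta] that
    corresponds to a constant [t^(-delta) C]. *)
Lemma is_derive_robin_angle (delta t : R) :
  0 < t -> is_derive (fun t => PI / 2 - atan ((delta + 1 / 2) / t)) t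
    (prufer_rhs (potential delta 0 t) (PI / 2 - atan ((delta + 1 / 2) / t))).
Proof.
  intros Ht.
  evar_last.
  - apply (is_derive_acot (fun t => (delta + 1 / 2) / t) t (- (delta + 1 / 2) / t ^ 2)).
    auto_derive; [lra|]. field; lra.
  - rewrite prufer_rhs_acot; unfold potential.
    replace (1 + ((delta + 1 / 2) / t) ^ 2) with ((t ^ 2 + (delta + 1 / 2) ^ 2) / t ^ 2) by (field; lra).
    field; split; [lra|]. assert (0 < t ^ 2) by (apply pow_lt; auto).
    generalize (pow2_ge_0 (delta * 2 + 1)); lra.
Qed.

(** The hypothesis is the comparison of potentials at its worst point [t = Ro]. It places small
    frequencies below level 0 when [nu > |delta|], so that a zero with index 0 exists. *)
Lemma phase_lt_robin_angle (nu delta r Ro x : R) (th : R -> R -> R) :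
  0 < r < Ro -> phase_family nu (delta + 1 / 2) r th -> 0 < x ->
  Ro ^ 2 * x ^ 2 < nu ^ 2 - delta ^ 2 -> th x Ro < PI / 2 - atan ((delta + 1 / 2) / Ro).
Proof.
  intros Hr H Hx Hs.
  destruct (H x Hx) as [E Hd].
  assert (Hq : forall t, r <= t <= Ro -> potential nu x t < potential delta 0 t).
  { intros t Ht; unfold potential.
    assert (0 < t ^ 2) by nra.
    apply Rmult_lt_reg_r with (t ^ 2); auto.
    replace ((x ^ 2 - (nu ^ 2 - 1 / 4) / t ^ 2) * t ^ 2) with (x ^ 2 * t ^ 2 - (nu ^ 2 - 1 / 4)) by (field; lra).
    replace ((0 ^ 2 - (delta ^ 2 - 1 / 4) / t ^ 2) * t ^ 2) with (- (delta ^ 2 - 1 / 4)) by (field; lra).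
    assert (t ^ 2 <= Ro ^ 2) by (apply pow_incr; lra).
    assert (0 < x ^ 2) by nra. nra. }
  apply (ode_compare_strict (fun t y => prufer_rhs (potential nu x t) y)
    (1 + (x ^ 2 + Rabs (nu ^ 2 - 1 / 4) / r ^ 2)) r Ro
    (th x) (fun t => PI / 2 - atan ((delta + 1 / 2) / t))
    (fun t => prufer_rhs (potential nu x t) (th x t))
    (fun t => prufer_rhs (potential delta 0 t) (PI / 2 - atan ((delta + 1 / 2) / t)))); try lra.
  - apply (lipschitz_const_pos nu x r); lra.
  - intros; apply potential_lipschitz; lra.
  - intros; apply Hd; lra.
  - intros; apply is_derive_robin_angle; lra.
  - intros; lra.
  - intros; apply prufer_rhs_incr; left; apply Hq; lra.
  - intros _; rewrite E; apply prufer_rhs_incr_strict; [apply acot_bound|apply Hq; lra].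
Qed.

Lemma potential_sqr_eq (nu mu x t : R) : nu ^ 2 = mu ^ 2 -> potential nu x t = potential mu x t.
Proof. intros E; unfold potential; now rewrite E. Qed.

(** For [nu = |delta|] level 0 belongs to the eigenvalue 0, so no positive frequency attains it and
    the index starts at 1. *)
Lemma phase_gt_robin_angle (nu delta r Ro x : R) (th : R -> R -> R) :
  0 < r < Ro -> phase_family nu (delta + 1 / 2) r th -> 0 < x ->
  nu ^ 2 = delta ^ 2 -> PI / 2 - atan ((delta + 1 / 2) / Ro) < th x Ro.
Proof.
  intros Hr H Hx Hs.
  destruct (H x Hx) as [E Hd].
  apply (ode_compare_strict (fun t y => prufer_rhs (potential delta 0 t) y)
    (1 + (0 ^ 2 + Rabs (delta ^ 2 - 1 / 4) / r ^ 2)) r Ro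
    (fun t => PI / 2 - atan ((delta + 1 / 2) / t)) (th x)
    (fun t => prufer_rhs (potential delta 0 t) (PI / 2 - atan ((delta + 1 / 2) / t)))
    (fun t => prufer_rhs (potential nu x t) (th x t))); try lra.
  - apply (lipschitz_const_pos delta 0 r); lra.
  - intros; apply potential_lipschitz; lra.
  - intros; apply is_derive_robin_angle; lra.
  - intros; apply Hd; lra.
  - intros; lra.
  - intros; rewrite (potential_sqr_eq nu delta) by auto.
    apply prufer_rhs_incr; left; apply potential_incr; lra.
  - intros _; rewrite E, (potential_sqr_eq nu delta) by auto.
    apply prufer_rhs_incr_strict; [apply acot_bound|]; apply potential_incr; lra.
Qed.

Lemma phase_near_robin_angle (nu delta r Ro : R) (th : R -> R -> R) :
  0 < r < Ro -> phase_family nu (delta + 1 / 2) r th -> nu ^ 2 = delta ^ 2 ->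
  exists x, 0 < x /\ th x Ro < PI / 2 - atan ((delta + 1 / 2) / Ro) + PI.
Proof.
  intros Hr H Hs.
  set (K := (Ro - r) * exp ((1 + (0 ^ 2 + Rabs (delta ^ 2 - 1 / 4) / r ^ 2)) * Ro)).
  assert (HK : 0 < K) by (apply Rmult_lt_0_compat; [lra|apply exp_pos]).
  (* Then [x^2 K <= x K <= 1], and the excess over the comparison angle stays below [PI]. *)
  set (x := Rmin 1 (/ K)).
  assert (HiK := Rinv_0_lt_compat _ HK).
  assert (Hx : 0 < x) by (apply Rmin_glb_lt; lra).
  assert (Hx1 : x <= 1) by apply Rmin_l.
  assert (HxK : x * K <= 1).
  { assert (x <= / K) by apply Rmin_r.
    apply Rle_trans with (/ K * K); [nra|]. right; field; lra. }
  exists x; split; auto.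
  destruct (H x Hx) as [E Hd].
  assert (Hg : th x Ro - (PI / 2 - atan ((delta + 1 / 2) / Ro)) <= x ^ 2 * (Ro - r)
     * exp ((1 + (0 ^ 2 + Rabs (delta ^ 2 - 1 / 4) / r ^ 2)) * Ro)).
  { apply (ode_gronwall (fun t y => prufer_rhs (potential delta 0 t) y)
    (1 + (0 ^ 2 + Rabs (delta ^ 2 - 1 / 4) / r ^ 2)) (x ^ 2) r Ro
    (fun t => PI / 2 - atan ((delta + 1 / 2) / t)) (th x)
    (fun t => prufer_rhs (potential delta 0 t) (PI / 2 - atan ((delta + 1 / 2) / t)))
    (fun t => prufer_rhs (potential nu x t) (th x t))); try lra; auto.
    - apply (lipschitz_const_pos delta 0 r); lra.
    - nra.
    - intros; apply potential_lipschitz; lra.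
    - intros; apply is_derive_robin_angle; lra.
    - intros; apply Hd; lra.
    - intros t Ht; rewrite (potential_sqr_eq nu delta) by auto.
      unfold prufer_rhs, potential.
      generalize (pow2_ge_0 (sin (th x t))) (pow2_ge_0 (cos (th x t))).
      assert (Q := sin2_cos2 (th x t)); rewrite !Rsqr_pow2 in Q.
      assert (0 <= x ^ 2) by nra.
      intros; split; nra. }
  rewrite Rmult_assoc in Hg; fold K in Hg.
  assert (x ^ 2 * K <= 1) by nra.
  generalize PI2_1; lra.
Qed.

(** * Enumeration of the zeros by the phase *)

Lemma increasing_listing_lt (P : R -> Prop) (k0 : nat) (x : nat -> R) (i j : nat) :
  increasing_listing P k0 x -> (k0 <= i)%nat -> (i < j)%nat -> x i < x j.
Proof.
  intros [_ [Hi _]] Hk Hij.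
  induction Hij as [|j Hij IH].
  - apply Hi; auto.
  - eapply Rlt_trans; [apply IH|]. apply Hi; lia.
Qed.

(** [xpp] is chosen by [epsilon] and known only as some listing; uniqueness identifies it with the
    one built from the phase. In the strong induction, [u k] occurs as some [v m], and [m < k] would
    repeat an earlier value of [u]. *)
Lemma increasing_listing_unique (P : R -> Prop) (k0 : nat) (x y : nat -> R) :
  increasing_listing P k0 x -> increasing_listing P k0 y ->
  forall k, (k0 <= k)%nat -> x k = y k.
Proof.
  intros Hx Hy k; induction k as [k IH] using (well_founded_induction Wf_nat.lt_wf); intros Hk.
  assert (Hle : forall u v, increasing_listing P k0 u -> increasing_listing P k0 v ->
     (forall j, (j < k)%nat -> (k0 <= j)%nat -> u j = v j) -> v k <= u k).
  { intros u v Hu Hv E.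
    assert (Hu1 := proj1 Hu k Hk).
    destruct (proj2 (proj2 Hv) _ Hu1) as [m [Hm Em]].
    destruct (Compare_dec.lt_eq_lt_dec m k) as [[Hlt|Heq]|Hgt].
    - exfalso. assert (u m < u k) by (apply (increasing_listing_lt P k0); auto).
      rewrite E in H; auto; lra.
    - subst; lra.
    - rewrite <- Em; left; apply (increasing_listing_lt P k0); auto. }
  apply Rle_antisym.
  - apply Hle; auto. intros; symmetry; auto.
  - apply Hle; auto.
Qed.

Lemma phase_listing (nu delta r Ro : R) (th : R -> R -> R) (h : R -> R) :
  0 < r < Ro -> Rabs delta <= nu -> phase_family nu (delta + 1 / 2) r th ->
  (forall M, exists x, 0 < x /\ M < th x Ro) ->
  (forall x, 0 < x -> (h x = 0 <-> sin (th x Ro - (PI / 2 - atan ((delta + 1 / 2) / Ro))) = 0)) ->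
  exists xs : nat -> R,
    increasing_listing (fun z => 0 < z /\ h z = 0) (first_index delta nu) xs /\
    forall k, (first_index delta nu <= k)%nat -> 0 < xs k /\
      th (xs k) Ro = PI / 2 - atan ((delta + 1 / 2) / Ro) + INR k * PI.
Proof.
  intros Hr Hnu H Hinf Hh.
  set (al := PI / 2 - atan ((delta + 1 / 2) / Ro)) in *.
  assert (Hal : 0 < al < PI) by apply acot_bound.
  set (k0 := first_index delta nu).
  assert (HPI := PI_RGT_0).
  assert (Hsq : nu ^ 2 - delta ^ 2 = (nu - Rabs delta) * (nu + Rabs delta)).
  { rewrite <- (pow2_abs delta); ring. }
  (* A frequency below the first level is the lower end for the intermediate value theorem; this is
     where the two cases of [first_index] separate. *)
  assert (Hlow : exists x, 0 < x /\ th x Ro < al + INR k0 * PI).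
  { unfold k0, first_index; destruct (Rlt_dec (Rabs delta) nu) as [Hlt|Hge].
    - assert (Hp : 0 < nu ^ 2 - delta ^ 2).
      { rewrite Hsq; generalize (Rabs_pos delta); nra. }
      exists (sqrt (nu ^ 2 - delta ^ 2) / (2 * Ro)).
      assert (Hsp := sqrt_lt_R0 _ Hp).
      assert (Hxp : 0 < sqrt (nu ^ 2 - delta ^ 2) / (2 * Ro)) by (apply Rdiv_lt_0_compat; lra).
      split; auto. change (INR 0) with 0; rewrite Rmult_0_l, Rplus_0_r.
      apply (phase_lt_robin_angle nu delta r); auto.
      assert (Q := pow2_sqrt _ (Rlt_le _ _ Hp)).
      replace (Ro ^ 2 * (sqrt (nu ^ 2 - delta ^ 2) / (2 * Ro)) ^ 2) with
        (sqrt (nu ^ 2 - delta ^ 2) ^ 2 / 4) by (field; lra).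
      rewrite Q; lra.
    - simpl; rewrite Rmult_1_l; apply (phase_near_robin_angle nu delta r); auto.
      replace nu with (Rabs delta) by lra; apply pow2_abs. }
  assert (Hex : forall k, (k0 <= k)%nat -> exists x, 0 < x /\ th x Ro = al + INR k * PI).
  { intros k Hk.
    destruct Hlow as [a [Ha Hta]]; destruct (Hinf (al + INR k * PI)) as [b [Hb Htb]].
    assert (Hk' : INR k0 <= INR k) by (apply le_INR; auto).
    assert (Hta' : th a Ro < al + INR k * PI) by nra.
    assert (Hab : a < b).
    { destruct (Rlt_le_dec a b) as [|[Hba|Hba]]; auto; exfalso.
      - assert (th b Ro < th a Ro) by (apply (phase_increasing nu (delta + 1 / 2) r); auto). lra.
      - subst; lra. }
    destruct (IVT_interv (fun x => th x Ro - (al + INR k * PI)) a b) as [z [Hz E]]; try lra.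
    - intros x Hx; apply continuity_pt_minus; [|apply continuity_pt_const; intros ? ?; auto].
      apply (phase_continuity nu (delta + 1 / 2) r); auto; lra.
    - exists z; split; lra. }
  set (xs := fun k => epsilon (inhabits 0) (fun x => 0 < x /\ th x Ro = al + INR k * PI)).
  assert (Hxs : forall k, (k0 <= k)%nat -> 0 < xs k /\ th (xs k) Ro = al + INR k * PI).
  { intros k Hk; apply (epsilon_spec (inhabits 0) (fun x => 0 < x /\ th x Ro = al + INR k * PI)); auto. }
  assert (Hinj : forall a b, 0 < a -> 0 < b -> th a Ro <= th b Ro -> a <= b).
  { intros a b Ha Hb Hab; destruct (Rle_lt_dec a b); auto; exfalso.
    assert (th b Ro < th a Ro) by (apply (phase_increasing nu (delta + 1 / 2) r); auto). lra. }
  exists xs; split; auto.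
  split; [|split].
  - intros k Hk; destruct (Hxs k Hk) as [Hp E]; split; auto.
    apply Hh; auto. rewrite E; replace (al + INR k * PI - al) with (INR k * PI) by ring.
    apply sin_INR_PI.
  - intros k Hk; destruct (Hxs k Hk) as [Hp E]; destruct (Hxs (S k) ltac:(lia)) as [Hp' E'].
    rewrite S_INR in E'.
    destruct (Rlt_le_dec (xs k) (xs (S k))) as [|[Hlt|Heq]]; auto; exfalso.
    + assert (th (xs (S k)) Ro < th (xs k) Ro) by (apply (phase_increasing nu (delta + 1 / 2) r); auto). nra.
    + rewrite Heq in E'; nra.
  - intros z [Hz Hhz]; apply Hh in Hhz; auto.
    apply sin_eq_0_0 in Hhz; destruct Hhz as [m Em].
    (* A zero gives an integer level [m] a priori of any sign. Positivity of the phase and [al < PI]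
       give [m > -1]; in the case [nu = |delta|] the phase exceeds [al], which gives [m > 0]. *)
    assert (Hm : (Z.of_nat k0 <= m)%Z).
    { unfold k0, first_index; destruct (Rlt_dec (Rabs delta) nu) as [Hlt|Hge].
      - assert (0 < th z Ro) by (apply (phase_pos nu (delta + 1 / 2) r); auto).
        assert (-1 < IZR m) by nra. apply (lt_IZR (-1)) in H1. lia.
      - assert (al < th z Ro).
        { apply (phase_gt_robin_angle nu delta r); auto.
          replace nu with (Rabs delta) by lra; apply pow2_abs. }
        assert (0 < IZR m) by nra. apply (lt_IZR 0) in H1. lia. }
    exists (Z.to_nat m); split; [lia|].
    destruct (Hxs (Z.to_nat m) ltac:(lia)) as [Hp E].
    rewrite INR_IZR_INZ, Z2Nat.id in E by lia.
    apply Rle_antisym; apply Hinj; auto; lra.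
Qed.

(** * Phase bounds *)

Lemma atan_incr_le (x y : R) : x <= y -> atan x <= atan y.
Proof. intros [H|H]; [left; now apply atan_increasing | subst; lra]. Qed.

Lemma atan_abs_le (x : R) : Rabs (atan x) <= Rabs x.
Proof.
  destruct (MVT_gen atan 0 x (fun y => / (1 + y ^ 2))) as [c [_ E]].
  - intros y _; apply is_derive_Reals.
    apply derivable_pt_lim_atan.
  - intros; apply derivable_continuous_pt, derivable_pt_atan.
  - rewrite atan_0, !Rminus_0_r in E; rewrite E, Rabs_mult.
    assert (0 <= c ^ 2) by apply pow2_ge_0.
    assert (H1 : 0 < / (1 + c ^ 2)) by (apply Rinv_0_lt_compat; lra).
    assert (/ (1 + c ^ 2) <= 1).
    { rewrite <- Rinv_1; apply Rinv_le_contravar; lra. }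
    rewrite (Rabs_pos_eq (/ _)) by lra.
    generalize (Rabs_pos x); nra.
Qed.

Lemma prufer_angle_growth (nu c r Ro x b : R) (W dW th : R -> R) :
  0 < r < Ro -> 0 < b -> prufer_angle nu c r x b W dW th ->
  (forall t, r <= t <= Ro -> potential nu x t <= b ^ 2) ->
  th Ro < PI + b * (Ro - r).
Proof.
  intros Hr Hb [E H] Hq.
  assert (Hm : b * r - th r <= b * Ro - th Ro).
  { apply (derive_ge0_le (fun t => b * t - th t)
      (fun t => b - (b * cos (th t) ^ 2 + potential nu x t / b * sin (th t) ^ 2))); try lra.
    - intros t Ht; apply @is_derive_minus; [auto_derive; auto; ring|apply H; lra].
    - intros t Ht; specialize (Hq t Ht).
      assert (Q := sin2_cos2 (th t)); rewrite !Rsqr_pow2 in Q.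
      assert (potential nu x t / b <= b).
      { apply Rmult_le_reg_r with b; auto. unfold Rdiv; rewrite Rmult_assoc, Rinv_l by lra. lra. }
      generalize (pow2_ge_0 (sin (th t))); nra. }
  rewrite E in Hm; generalize (acot_bound (c / r / b)); lra.
Qed.

(** With scale [b = x] the terms in [cos^2] and [sin^2] combine to the constant speed [x]; what is
    left is [(nu^2 - 1/4) sin^2 / (t^2 x)], integrated over an interval of length [Ro - r]. *)
Lemma wkb_angle_bound (nu c r Ro x : R) (W dW th : R -> R) :
  0 < r < Ro -> 0 < x -> prufer_angle nu c r x x W dW th ->
  Rabs (th Ro - th r - x * (Ro - r)) <= Rabs (nu ^ 2 - 1 / 4) * (Ro - r) / r ^ 2 / x.
Proof.
  intros Hr Hx [_ H].
  set (K := Rabs (nu ^ 2 - 1 / 4) / r ^ 2 / x).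
  replace (Rabs (nu ^ 2 - 1 / 4) * (Ro - r) / r ^ 2 / x) with (K * (Ro - r)) by (unfold K; field; lra).
  set (d := fun t => x * cos (th t) ^ 2 + potential nu x t / x * sin (th t) ^ 2).
  assert (Hd : forall t, r <= t <= Ro -> Rabs (d t - x) <= K).
  { intros t Ht; unfold d, potential.
    assert (Q := sin2_cos2 (th t)); rewrite !Rsqr_pow2 in Q.
    replace (cos (th t) ^ 2) with (1 - sin (th t) ^ 2) by lra.
    assert (0 < t ^ 2) by (apply pow_lt; lra).
    replace (x * (1 - sin (th t) ^ 2) + (x ^ 2 - (nu ^ 2 - 1 / 4) / t ^ 2) / x * sin (th t) ^ 2 - x)
      with (- ((nu ^ 2 - 1 / 4) * / t ^ 2 * / x * sin (th t) ^ 2)) by (field; lra).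
    rewrite Rabs_Ropp, !Rabs_mult; unfold K, Rdiv.
    assert (0 <= / x) by (left; now apply Rinv_0_lt_compat).
    assert (0 <= / t ^ 2) by (left; now apply Rinv_0_lt_compat).
    rewrite (Rabs_pos_eq (/ t ^ 2)), (Rabs_pos_eq (/ x)), (Rabs_pos_eq (sin _ ^ 2)) by
      (auto; apply pow2_ge_0).
    assert (Hi := inv_sqr_le r t ltac:(lra) ltac:(lra)).
    assert (0 <= Rabs (nu ^ 2 + - (1 * / 4))) by apply Rabs_pos.
    unfold Rminus, Rdiv in *.
    set (a := Rabs (nu ^ 2 + - (1 * / 4))) in *.
    apply Rle_trans with (a * / t ^ 2 * / x * 1).
    - apply Rmult_le_compat_l; [|generalize (pow2_ge_0 (cos (th t))); lra].
      repeat apply Rmult_le_pos; auto.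
    - rewrite Rmult_1_r; apply Rmult_le_compat_r; auto.
      apply Rmult_le_compat_l; auto. }
  assert (D : forall t, r <= t <= Ro -> is_derive th t (d t)) by (intros; apply H; lra).
  assert (H1 : th r - (x - K) * r <= th Ro - (x - K) * Ro).
  { apply (derive_ge0_le (fun t => th t - (x - K) * t) (fun t => d t - (x - K))); try lra.
    - intros t Ht; apply @is_derive_minus; [apply D; lra|auto_derive; auto; ring].
    - intros t Ht; specialize (Hd t Ht); apply Rabs_le_between in Hd; lra. }
  assert (H2 : (x + K) * r - th r <= (x + K) * Ro - th Ro).
  { apply (derive_ge0_le (fun t => (x + K) * t - th t) (fun t => (x + K) - d t)); try lra.
    - intros t Ht; apply @is_derive_minus; [auto_derive; auto; ring|apply D; lra].
    - intros t Ht; specialize (Hd t Ht); apply Rabs_le_between in Hd; lra. }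
  apply Rabs_le; lra.
Qed.

Lemma prufer_angle_robin (nu c r x b t : R) (W dW th : R -> R) :
  0 < t -> 0 < b -> prufer_angle nu c r x b W dW th ->
  (dW t = c / t * W t <-> sin (th t - (PI / 2 - atan (c / t / b))) = 0).
Proof.
  intros Ht Hb [_ H]; destruct (H t Ht) as [_ [rho [Hrho [HS HC]]]].
  rewrite sin_minus, sin_acot, cos_acot.
  set (p := c / t / b).
  assert (0 < sqrt (1 + p ^ 2)) by (apply sqrt_lt_R0; generalize (pow2_ge_0 p); lra).
  replace (W t) with (rho * sin (th t) / b) by (rewrite <- HS; field; lra).
  rewrite HC.
  replace (c / t * (rho * sin (th t) / b)) with (rho * (p * sin (th t))) by (unfold p; field; lra).
  replace (sin (th t) * (p / sqrt (1 + p ^ 2)) - cos (th t) * / sqrt (1 + p ^ 2))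
    with ((p * sin (th t) - cos (th t)) / sqrt (1 + p ^ 2)) by (field; lra).
  split; intros E.
  - apply Rmult_eq_reg_l in E; [|lra]. rewrite E; field; lra.
  - f_equal. apply Rmult_integral in E; destruct E as [E|E]; [lra|].
    exfalso; revert E; apply Rinv_neq_0_compat; lra.
Qed.

Lemma phase_unbounded (nu c r Ro : R) (W dW th : R -> R -> R) (M : R) :
  0 < r < Ro ->
  (forall x, 0 < x -> sl_solution nu c r x (W x) (dW x)) ->
  (forall x, 0 < x -> prufer_angle nu c r x 1 (W x) (dW x) (th x)) ->
  exists x, 0 < x /\ M < th x Ro.
Proof.
  intros Hr HW Hth.
  destruct (INR_unbounded (M / PI)) as [k Hk].
  set (C := Rabs (nu ^ 2 - 1 / 4) * (Ro - r) / r ^ 2).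
  assert (HPI := PI_RGT_0).
  assert (HC : 0 <= C).
  { unfold C, Rdiv; apply Rmult_le_pos; [|left; apply Rinv_0_lt_compat, pow_lt; lra].
    apply Rmult_le_pos; [apply Rabs_pos|lra]. }
  (* Since [x >= 1], the error [C / x] is at most [C], and [x (Ro - r)] exceeds [k PI + C]. *)
  set (x := 1 + (INR k * PI + C) / (Ro - r)).
  assert (Hx : 1 <= x).
  { unfold x; enough (0 <= (INR k * PI + C) / (Ro - r)) by lra.
    apply Rmult_le_pos; [|left; apply Rinv_0_lt_compat; lra].
    generalize (pos_INR k); nra. }
  exists x; split; [lra|].
  destruct (prufer_angle_exists nu c r x x (W x) (dW x)) as [phi Hphi]; auto; try lra.
  { apply HW; lra. }
  assert (Hb := wkb_angle_bound nu c r Ro x _ _ phi Hr ltac:(lra) Hphi); fold C in Hb.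
  assert (C / x <= C).
  { apply Rmult_le_reg_r with x; [lra|]. unfold Rdiv; rewrite Rmult_assoc, Rinv_l by lra. nra. }
  apply Rabs_le_between in Hb.
  assert (E : phi r = PI / 2 - atan (c / r / x)) by apply Hphi.
  assert (Ex : x * (Ro - r) = (Ro - r) + INR k * PI + C) by (unfold x; field; lra).
  assert (Hphik : INR k * PI < phi Ro) by (generalize (acot_bound (c / r / x)); lra).
  apply Rlt_trans with (INR k * PI).
  - apply Rmult_lt_reg_r with (/ PI); [now apply Rinv_0_lt_compat|].
    rewrite Rmult_assoc, Rinv_r by lra. unfold Rdiv in Hk; lra.
  - apply (prufer_angle_scale nu c r x x 1 (W x) (dW x) phi (th x) Ro k); auto; try lra.
    apply Hth; lra.
Qed.

(* The rescaling by [b = PI (k - 1) / Ro] turns the bound on the potential into angular speed at most [b]. *)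
Lemma phase_lt_of_potential (nu c r Ro x : R) (k : nat) (W dW th : R -> R) :
  0 < r < Ro -> 0 < x -> (2 <= k)%nat -> sl_solution nu c r x W dW ->
  prufer_angle nu c r x 1 W dW th ->
  (forall t, r <= t <= Ro -> potential nu x t <= (PI * (INR k - 1) / Ro) ^ 2) ->
  th Ro < INR k * PI.
Proof.
  intros Hr Hx Hk HW Hth Hq.
  assert (HPI := PI_RGT_0).
  assert (Hk2 : 2 <= INR k) by (apply (le_INR 2); auto).
  set (b := PI * (INR k - 1) / Ro) in *.
  assert (Hb : 0 < b) by (apply Rdiv_lt_0_compat; nra).
  destruct (prufer_angle_exists nu c r x b W dW) as [phi Hphi]; auto; try lra.
  apply (prufer_angle_scale nu c r x b 1 W dW phi th Ro k); auto; try lra.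
  assert (H := prufer_angle_growth nu c r Ro x b W dW phi Hr Hb Hphi Hq).
  (* The initial angle accounts for at most [PI], the turning for at most [b Ro = PI (k - 1)]; hence
     the [k - 1] in [b], which [2 <= k] keeps positive. *)
  assert (b * (Ro - r) <= PI * (INR k - 1)); [|lra].
  replace (PI * (INR k - 1)) with (b * Ro) by (unfold b; field; lra). nra.
Qed.

(** The eigenvalue condition is moved from scale 1 to scale [x], where the turning is known up to
    [O(1/x)]; at that scale both boundary angles differ from [PI / 2] by [O(1/x)] too. *)
Lemma phase_eigenvalue_bound (nu c r Ro x : R) (k : nat) (W dW th : R -> R) :
  0 < r < Ro -> 0 < x -> sl_solution nu c r x W dW ->
  prufer_angle nu c r x 1 W dW th ->
  th Ro = PI / 2 - atan (c / Ro) + INR k * PI ->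
  Rabs (x * (Ro - r) - INR k * PI)
    <= (Rabs (c / Ro) + Rabs (c / r) + Rabs (nu ^ 2 - 1 / 4) * (Ro - r) / r ^ 2) / x.
Proof.
  intros Hr Hx HW Hth E.
  assert (HPI := PI_RGT_0).
  destruct (prufer_angle_exists nu c r x x W dW) as [phi Hphi]; auto; try lra.
  assert (HdW : dW Ro = c / Ro * W Ro).
  { apply (prufer_angle_robin nu c r x 1 Ro W dW th); auto; try lra.
    rewrite E, Rdiv_1_r.
    replace (PI / 2 - atan (c / Ro) + INR k * PI - (PI / 2 - atan (c / Ro))) with (INR k * PI) by ring.
    apply sin_INR_PI. }
  apply (prufer_angle_robin nu c r x x Ro W dW phi) in HdW; auto; try lra.
  assert (H1 : INR k * PI < phi Ro).
  { apply (prufer_angle_scale nu c r x 1 x W dW th phi Ro k); auto; try lra.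
    generalize (acot_bound (c / Ro)); lra. }
  assert (H2 : phi Ro < INR (S k) * PI).
  { apply (prufer_angle_scale nu c r x 1 x W dW th phi Ro (S k)); auto; try lra.
    rewrite S_INR; generalize (acot_bound (c / Ro)); lra. }
  rewrite S_INR in H2.
  assert (Hb := acot_bound (c / Ro / x)).
  (* The Robin condition fixes [phi Ro] modulo [PI], and its position between [k PI] and
     [(k + 1) PI] fixes the integer. *)
  assert (Ephi : phi Ro = PI / 2 - atan (c / Ro / x) + INR k * PI).
  { apply sin_eq_0_0 in HdW; destruct HdW as [m Em].
    assert (Hm : (m = Z.of_nat k)%Z).
    { assert (IZR m - INR k < 1) by nra. assert (-1 < IZR m - INR k) by nra.
      rewrite INR_IZR_INZ, <- minus_IZR in *.
      apply (lt_IZR _ 1) in H. apply (lt_IZR (-1)) in H0. lia. }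
    subst m; rewrite <- INR_IZR_INZ in Em; lra. }
  assert (Er : phi r = PI / 2 - atan (c / r / x)) by apply Hphi.
  assert (Hw := wkb_angle_bound nu c r Ro x _ _ phi Hr ltac:(lra) Hphi).
  assert (Ha1 := atan_abs_le (c / Ro / x)); assert (Ha2 := atan_abs_le (c / r / x)).
  assert (Rabs (c / Ro / x) = Rabs (c / Ro) / x).
  { unfold Rdiv at 1; rewrite Rabs_mult, (Rabs_pos_eq (/ x)); auto. left; now apply Rinv_0_lt_compat. }
  assert (Rabs (c / r / x) = Rabs (c / r) / x).
  { unfold Rdiv at 1; rewrite Rabs_mult, (Rabs_pos_eq (/ x)); auto. left; now apply Rinv_0_lt_compat. }
  rewrite Ephi, Er in Hw.
  apply Rabs_le_between in Hw, Ha1, Ha2.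
  unfold Rdiv in *; rewrite !Rmult_plus_distr_r.
  apply Rabs_le; lra.
Qed.

(* The supersolution is the angle of a curve with [t W'/W = 1/2 + q], where [q] is a concave
   parabola with [q r <= delta < q Ro]; then [t q' + q^2 <= nu^2 (1 - t^2 / Ro^2)] is what has to hold. *)
Lemma phase_at_nu_lt (r Ro delta : R) :
  0 < r < Ro -> exists N, forall nu th, N <= nu ->
    phase_family nu (delta + 1 / 2) r th -> 0 < nu /\
    th (nu / Ro) Ro < PI / 2 - atan ((delta + 1 / 2) / Ro).
Proof.
  intros Hr.
  set (d := Ro - r).
  assert (Hd : 0 < d) by (unfold d; lra).
  (* The vertex is nearer to [Ro] than to [r], so that [q] gains [A d^2 / 2] across the interval,
     yet left of [Ro], so that [q] decreases there with slope [- A d / 2]. *)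
  set (m := r + 3 / 4 * d).
  assert (Hm : r <= m <= Ro) by (unfold m, d in *; lra).
  (* The first summand makes the gain at least 1, hence [q r <= delta]; the second gives
     [Ro q' + q^2 <= 0] at [Ro], where [q = delta + 1]. *)
  set (A := 2 / d ^ 2 + 2 * (delta + 1) ^ 2 / (Ro * d)).
  assert (HA0 : 0 <= 2 * (delta + 1) ^ 2 / (Ro * d)).
  { apply Rmult_le_pos; [generalize (pow2_ge_0 (delta + 1)); lra|].
    left; apply Rinv_0_lt_compat; nra. }
  assert (HA1 : 2 <= A * d ^ 2).
  { unfold A; rewrite Rmult_plus_distr_r.
    replace (2 / d ^ 2 * d ^ 2) with 2 by (field; lra).
    generalize (pow2_ge_0 d); nra. }
  assert (HA2 : (delta + 1) ^ 2 <= A * Ro * d / 2).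
  { unfold A. replace ((2 / d ^ 2 + 2 * (delta + 1) ^ 2 / (Ro * d)) * Ro * d / 2)
      with (Ro / d + (delta + 1) ^ 2) by (field; lra).
    assert (0 < Ro / d) by (apply Rdiv_lt_0_compat; lra). lra. }
  assert (HA : 0 < A).
  { assert (0 < 2 / d ^ 2) by (apply Rdiv_lt_0_compat; [lra|apply pow_lt; auto]). unfold A; lra. }
  set (M := delta + 1 + A * d ^ 2 / 16).
  set (q := fun t => M - A * (t - m) ^ 2).
  assert (Hq0 : q r <= delta).
  { unfold q, M, m. replace (r - (r + 3 / 4 * d)) with (- (3 / 4 * d)) by ring.
    replace (delta + 1 + A * d ^ 2 / 16 - A * (- (3 / 4 * d)) ^ 2) with (delta + 1 - A * d ^ 2 / 2) by field.
    lra. }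
  assert (Hq1 : q Ro = delta + 1) by (unfold q, M, m, d; field).
  set (B := Rabs M + A * Ro ^ 2).
  assert (HqB : forall t, r <= t <= Ro -> Rabs (q t) <= B).
  { intros t Ht; unfold q, B, Rminus at 1.
    eapply Rle_trans; [apply Rabs_triang|]. apply Rplus_le_compat_l.
    rewrite Rabs_Ropp, Rabs_pos_eq by (generalize (pow2_ge_0 (t - m)); nra).
    apply Rmult_le_compat_l; [lra|]. nra. }
  assert (HB : 0 <= B) by (generalize (Rabs_pos M) (pow2_ge_0 Ro); unfold B; nra).
  set (C := 4 * A * Ro + 4 * A * Ro * B).
  assert (HC : 0 <= C) by (unfold C; assert (0 < A * Ro) by nra; nra).
  (* At [t = Ro] the term [nu^2 (1 - t^2 / Ro^2)] vanishes for every [nu], so the inequality must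
     hold there by itself; away from [Ro] a Lipschitz bound independent of [nu] is beaten once [nu]
     is large. *)
  assert (HE : forall t, r <= t <= Ro -> - 2 * A * t * (t - m) + q t ^ 2 <= C * (Ro - t)).
  { intros t Ht.
    assert (E1 : - 2 * A * Ro * (Ro - m) + q Ro ^ 2 <= 0).
    { rewrite Hq1. replace (Ro - m) with (d / 4) by (unfold m, d; field). lra. }
    assert (E2 : q t ^ 2 - q Ro ^ 2 = (Ro - t) * (A * (Ro + t - 2 * m) * (q t + q Ro))).
    { unfold q; ring. }
    assert (E3 : A * (Ro + t - 2 * m) * (q t + q Ro) <= 4 * A * Ro * B).
    { eapply Rle_trans; [apply Rle_abs|]. rewrite !Rabs_mult, (Rabs_pos_eq A) by lra.
      assert (Rabs (Ro + t - 2 * m) <= 2 * Ro) by (apply Rabs_le; lra).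
      assert (Rabs (q t + q Ro) <= 2 * B).
      { eapply Rle_trans; [apply Rabs_triang|].
        generalize (HqB t Ht) (HqB Ro ltac:(lra)); lra. }
      replace (4 * A * Ro * B) with (A * (2 * Ro) * (2 * B)) by ring.
      apply Rmult_le_compat; auto using Rabs_pos.
      - apply Rmult_le_pos; [lra|apply Rabs_pos].
      - apply Rmult_le_compat_l; lra. }
    assert (E4 : (Ro - t) * (A * (Ro + t - 2 * m) * (q t + q Ro)) <= (Ro - t) * (4 * A * Ro * B)).
    { apply Rmult_le_compat_l; lra. }
    assert (E5 : - 2 * A * t * (t - m) - - 2 * A * Ro * (Ro - m) <= (Ro - t) * (4 * A * Ro)).
    { replace (- 2 * A * t * (t - m) - - 2 * A * Ro * (Ro - m)) with ((Ro - t) * (2 * A * (t + Ro - m))) by ring.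
      apply Rmult_le_compat_l; [lra|]. nra. }
    unfold C; lra. }
  exists (Rmax 1 (C * Ro)); intros nu th HN H.
  assert (Hn1 : 1 <= nu) by (eapply Rle_trans; [apply Rmax_l|apply HN]).
  assert (Hn2 : C * Ro <= nu) by (eapply Rle_trans; [apply Rmax_r|apply HN]).
  split; [lra|].
  set (x := nu / Ro).
  assert (Hx : 0 < x) by (apply Rdiv_lt_0_compat; lra).
  destruct (H x Hx) as [E0 Hth].
  set (p := fun t => (1 / 2 + q t) / t).
  set (dp := fun t => - 2 * A * (t - m) / t - (1 / 2 + q t) / t ^ 2).
  apply Rle_lt_trans with (PI / 2 - atan (p Ro)).
  - apply (ode_compare (fun t y => prufer_rhs (potential nu x t) y)
      (1 + (x ^ 2 + Rabs (nu ^ 2 - 1 / 4) / r ^ 2)) r Ro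
      (th x) (fun t => PI / 2 - atan (p t))
      (fun t => prufer_rhs (potential nu x t) (th x t))
      (fun t => - dp t / (1 + p t ^ 2))); try lra.
    + apply (lipschitz_const_pos nu x r); lra.
    + intros; apply potential_lipschitz; lra.
    + intros; apply Hth; lra.
    + intros t Ht; apply is_derive_acot; unfold p, dp, q.
      auto_derive; [lra|]. field; lra.
    + intros; lra.
    + intros t Ht; rewrite prufer_rhs_acot.
      unfold Rdiv at 1 2; apply Rmult_le_compat_r.
      { left; apply Rinv_0_lt_compat; generalize (pow2_ge_0 (p t)); lra. }
      assert (Ht2 : 0 < t ^ 2) by (apply pow_lt; lra).
      apply Rmult_le_reg_r with (t ^ 2); auto.
      unfold p, dp, potential, x.
      replace ((((1 / 2 + q t) / t) ^ 2 + ((nu / Ro) ^ 2 - (nu ^ 2 - 1 / 4) / t ^ 2)) * t ^ 2)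
        with ((1 / 2 + q t) ^ 2 + (nu / Ro) ^ 2 * t ^ 2 - nu ^ 2 + 1 / 4) by (field; lra).
      replace (- (-2 * A * (t - m) / t - (1 / 2 + q t) / t ^ 2) * t ^ 2)
        with (2 * A * t * (t - m) + (1 / 2 + q t)) by (field; lra).
      specialize (HE t Ht).
      assert (Hl : C * (Ro - t) <= nu ^ 2 - (nu / Ro) ^ 2 * t ^ 2).
      { replace (nu ^ 2 - (nu / Ro) ^ 2 * t ^ 2) with (nu ^ 2 * (Ro + t) / Ro ^ 2 * (Ro - t)) by (field; lra).
        apply Rmult_le_compat_r; [lra|].
        apply Rmult_le_reg_r with (Ro ^ 2); [apply pow_lt; lra|].
        replace (nu ^ 2 * (Ro + t) / Ro ^ 2 * Ro ^ 2) with (nu ^ 2 * (Ro + t)) by (field; lra).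
        assert (C * Ro <= nu ^ 2) by nra.
        replace (C * Ro ^ 2) with (C * Ro * Ro) by ring. nra. }
      lra.
    + rewrite E0; unfold p.
      assert (atan ((1 / 2 + q r) / r) <= atan ((delta + 1 / 2) / r)); [|lra].
      apply atan_incr_le, Rmult_le_compat_r; [left; apply Rinv_0_lt_compat; lra|lra].
  - assert (atan ((delta + 1 / 2) / Ro) < atan (p Ro)); [|lra].
    apply atan_increasing; unfold p; rewrite Hq1.
    apply Rmult_lt_compat_r; [apply Rinv_0_lt_compat; lra|lra].
Qed.

(** * The reciprocal Gamma function *)

Definition gauss_prod (z : R) (n : nat) : R :=
  prod_f_R0 (fun k => z + INR k) n / (INR (fact n) * Rpower (INR n) z).

Lemma prod_shift (z : R) (n : nat) :
  prod_f_R0 (fun k => z + INR k) n * (z + 1 + INR n) = z * prod_f_R0 (fun k => z + 1 + INR k) n.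
Proof.
  induction n as [|n IH].
  - simpl; ring.
  - simpl prod_f_R0; rewrite <- Rmult_assoc, <- IH.
    change (match n with 0%nat => 1 | S _ => INR n + 1 end) with (INR (S n)).
    rewrite S_INR; ring.
Qed.

Lemma gauss_prod_shift (z : R) (n : nat) : (1 <= n)%nat -> z + 1 + INR n <> 0 ->
  gauss_prod z n = z * gauss_prod (z + 1) n * (INR n / (z + 1 + INR n)).
Proof.
  intros Hn Hz.
  assert (Hn' : 0 < INR n) by (apply lt_0_INR; lia).
  unfold gauss_prod.
  replace (prod_f_R0 (fun k => z + INR k) n)
    with (z * prod_f_R0 (fun k => z + 1 + INR k) n / (z + 1 + INR n))
    by (rewrite <- prod_shift; field; auto).
  rewrite Rpower_plus, Rpower_1 by auto.
  assert (0 < Rpower (INR n) z) by apply exp_pos.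
  assert (Hf := INR_fact_neq_0 n).
  field; repeat split; auto; lra.
Qed.

(** The products at [z] and [z + 1] differ by the factor [z n / (z + 1 + n)]. This carries
    convergence from [z + 1] down to [z] and yields the functional equation. *)
Lemma gauss_prod_lim_shift (z l : R) :
  is_lim_seq (gauss_prod (z + 1)) l -> is_lim_seq (gauss_prod z) (z * l).
Proof.
  intros H.
  apply (is_lim_seq_ext_loc (fun n => z * gauss_prod (z + 1) n * (INR n / (z + 1 + INR n)))).
  - destruct (INR_unbounded (Rabs z)) as [N HN].
    exists (S N); intros n Hn; symmetry; apply gauss_prod_shift; [lia|].
    assert (INR (S N) <= INR n) by (apply le_INR; auto).
    rewrite S_INR in H0. generalize (Rle_abs (- z)); rewrite Rabs_Ropp; lra.
  - replace (Finite (z * l)) with (Rbar_mult (Finite (z * l)) (Finite 1)) by (simpl; f_equal; ring).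
    apply is_lim_seq_mult'.
    + apply (is_lim_seq_scal_l (gauss_prod (z + 1)) z l H).
    + apply (is_lim_seq_ext_loc (fun n => / (1 + (z + 1) * / INR n))).
      * destruct (INR_unbounded (Rabs z)) as [N HN].
        exists (S N); intros n Hn.
        assert (INR (S N) <= INR n) by (apply le_INR; auto).
        rewrite S_INR in H0. generalize (Rle_abs (- z)) (Rabs_pos z); rewrite Rabs_Ropp; intros.
        field; lra.
      * replace (Finite 1) with (Rbar_inv (Finite (1 + (z + 1) * 0))).
        2:{ simpl; f_equal; field. }
        apply is_lim_seq_inv.
        -- apply is_lim_seq_plus'; [apply is_lim_seq_const|].
           apply is_lim_seq_mult'; [apply is_lim_seq_const|].
           replace (Finite 0) with (Rbar_inv p_infty) by reflexivity.
           apply is_lim_seq_inv; [apply is_lim_seq_INR|discriminate].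
        -- intros E; injection E; lra.
Qed.

Lemma ln_1p_le (u : R) : -1 < u -> ln (1 + u) <= u.
Proof.
  intros Hu; destruct (Req_dec u 0) as [->|H].
  - rewrite Rplus_0_r, ln_1; lra.
  - rewrite <- (ln_exp u) at 2. left; apply ln_increasing; [lra|]. now apply exp_ineq1.
Qed.

Lemma ln_ge (y : R) : 0 < y -> 1 - / y <= ln y.
Proof.
  intros Hy.
  assert (Hi := Rinv_0_lt_compat _ Hy).
  assert (H := ln_1p_le (/ y - 1) ltac:(lra)).
  replace (1 + (/ y - 1)) with (/ y) in H by ring.
  rewrite ln_Rinv in H by auto; lra.
Qed.

Lemma ln_succ_bound (n : R) : 0 < n -> / (n + 1) <= ln (n + 1) - ln n <= / n.
Proof.
  intros Hn; rewrite <- ln_div by lra; split.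
  - assert (H : 0 < (n + 1) / n) by (apply Rdiv_lt_0_compat; lra).
    apply Rle_trans with (2 := ln_ge _ H). right; field; lra.
  - replace ((n + 1) / n) with (1 + / n) by (field; lra).
    apply ln_1p_le. generalize (Rinv_0_lt_compat _ Hn); lra.
Qed.

(** The logarithm of [gauss_prod z (S n)]; the shifted index keeps [ln 0] out. *)
Definition log_gauss (n : nat) (z : R) : R :=
  sum_f_R0 (fun k => ln (z + INR k)) (S n) - ln (INR (fact (S n))) - z * ln (INR (S n)).

Definition dlog_gauss (n : nat) (z : R) : R :=
  sum_f_R0 (fun k => / (z + INR k)) (S n) - ln (INR (S n)).

Lemma gauss_prod_exp (n : nat) (z : R) : 0 < z -> gauss_prod z (S n) = exp (log_gauss n z).
Proof.
  intros Hz; unfold gauss_prod, log_gauss.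
  assert (E : forall m, prod_f_R0 (fun k => z + INR k) m
                        = exp (sum_f_R0 (fun k => ln (z + INR k)) m)).
  { induction m as [|m IH].
    - simpl; rewrite exp_ln; auto; lra.
    - rewrite tech5, exp_plus, <- IH, exp_ln; [reflexivity|].
      generalize (pos_INR (S m)); lra. }
  assert (Hf : 0 < INR (fact (S n))) by (apply lt_0_INR, lt_O_fact).
  unfold Rminus; rewrite !exp_plus, <- E, !exp_Ropp, exp_ln by auto.
  unfold Rpower. field; split; [apply Rgt_not_eq, exp_pos|lra].
Qed.

Lemma is_derive_log_gauss (n : nat) (z : R) :
  0 < z -> is_derive (log_gauss n) z (dlog_gauss n z).
Proof.
  intros Hz; unfold log_gauss, dlog_gauss.
  assert (E : forall m, is_derive (fun z => sum_f_R0 (fun k => ln (z + INR k)) m) z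
     (sum_f_R0 (fun k => / (z + INR k)) m)).
  { induction m as [|m IH].
    - simpl; auto_derive; [lra|field; lra].
    - rewrite tech5.
      apply (is_derive_plus (fun z => sum_f_R0 (fun k => ln (z + INR k)) m)
        (fun z => ln (z + INR (S m)))); auto.
      generalize (INR (S m)) (pos_INR (S m)); intros; auto_derive; [lra|field; lra]. }
  apply @is_derive_minus.
  - replace (sum_f_R0 (fun k : nat => / (z + INR k)) (S n)) with
      (minus (sum_f_R0 (fun k : nat => / (z + INR k)) (S n)) 0) by (unfold minus, plus, opp; simpl; ring).
    apply @is_derive_minus; [apply E|apply @is_derive_const].
  - generalize (ln (INR (S n))); intros; auto_derive; auto; ring.
Qed.

(** The first-order parts of [ln (1 + z / (N + 1))] and [z (ln (N + 1) - ln N)] cancel. The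
    remainder of order [1 / N^2] is bounded by a telescoping difference, ready for summation. *)
Lemma log_gauss_step (n : nat) (z M : R) : 0 < z < M ->
  Rabs (log_gauss (S n) z - log_gauss n z) <= (M ^ 2 + M) * (/ (INR n + 1) - / (INR n + 2)).
Proof.
  intros Hz; unfold log_gauss.
  rewrite (tech5 _ (S n)).
  change (fact (S (S n))) with (S (S n) * fact (S n))%nat.
  assert (Hf : 0 < INR (fact (S n))) by (apply lt_0_INR, lt_O_fact).
  assert (Hn := pos_INR n).
  rewrite mult_INR, ln_mult by (auto; rewrite !S_INR; lra).
  rewrite !S_INR. set (N := INR n + 1).
  assert (HN : 0 < N) by (unfold N; lra).
  replace (INR n + 2) with (N + 1) by (unfold N; ring).
  assert (H1 := ln_succ_bound N HN).
  assert (H2 : z / (N + 1) - z ^ 2 / (N + 1) ^ 2 <= ln (z + (N + 1)) - ln (N + 1) <= z / (N + 1)).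
  { rewrite <- ln_div by lra.
    replace ((z + (N + 1)) / (N + 1)) with (1 + z / (N + 1)) by (field; lra).
    assert (Hu : 0 < z / (N + 1)) by (apply Rdiv_lt_0_compat; lra).
    split; [|apply ln_1p_le; lra].
    apply Rle_trans with (2 := ln_ge _ (Rplus_lt_0_compat _ _ Rlt_0_1 Hu)).
    replace (z ^ 2 / (N + 1) ^ 2) with ((z / (N + 1)) ^ 2) by (field; lra).
    set (u := z / (N + 1)) in *.
    apply Rmult_le_reg_r with (1 + u); [lra|].
    replace ((1 - / (1 + u)) * (1 + u)) with u by (field; lra). nra. }
  assert (H3 : / (N + 1) ^ 2 <= / N - / (N + 1)).
  { replace (/ N - / (N + 1)) with (/ (N * (N + 1))) by (field; lra).
    apply Rinv_le_contravar; nra. }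
  assert (H4 : 0 < / (N + 1) ^ 2) by (apply Rinv_0_lt_compat; nra).
  set (l1 := ln (N + 1)) in *; set (l0 := ln N) in *.
  set (d := / N - / (N + 1)) in *.
  unfold Rdiv in H2.
  assert (z * / (N + 1) <= z * (l1 - l0) <= z * / (N + 1) + z * d).
  { split; unfold d; nra. }
  assert (z ^ 2 * / (N + 1) ^ 2 <= M ^ 2 * d).
  { apply Rmult_le_compat; try lra; nra. }
  assert (z * d <= M * d) by nra.
  apply Rabs_le; lra.
Qed.

Lemma dlog_gauss_step (n : nat) (z M : R) : 0 < z < M ->
  Rabs (dlog_gauss (S n) z - dlog_gauss n z) <= (M + 1) * (/ (INR n + 1) - / (INR n + 2)).
Proof.
  intros Hz; unfold dlog_gauss.
  rewrite (tech5 _ (S n)).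
  assert (Hn := pos_INR n).
  rewrite !S_INR. set (N := INR n + 1).
  assert (HN : 0 < N) by (unfold N; lra).
  replace (INR n + 2) with (N + 1) by (unfold N; ring).
  assert (H1 := ln_succ_bound N HN).
  assert (H2 : / (z + (N + 1)) <= / (N + 1)) by (apply Rinv_le_contravar; lra).
  assert (H3 : / N - / (z + (N + 1)) <= (M + 1) * (/ N - / (N + 1))).
  { replace (/ N - / (z + (N + 1))) with ((z + 1) * / (N * (z + (N + 1)))) by (field; lra).
    replace (/ N - / (N + 1)) with (/ (N * (N + 1))) by (field; lra).
    apply Rmult_le_compat; try lra.
    - left; apply Rinv_0_lt_compat; nra.
    - apply Rinv_le_contravar; nra. }
  apply Rabs_le; split; [lra|].
  assert (0 <= (M + 1) * (/ N - / (N + 1))); [|lra].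
  apply Rmult_le_pos; [lra|]. assert (/ (N + 1) <= / N) by (apply Rinv_le_contravar; lra). lra.
Qed.

Lemma CVU_cauchy_telescope (f : nat -> R -> R) (D : R -> Prop) (C : R) : 0 <= C ->
  (forall n x, D x -> Rabs (f (S n) x - f n x) <= C * (/ (INR n + 1) - / (INR n + 2))) ->
  CVU_cauchy f D.
Proof.
  intros HC H.
  assert (Hs : forall n k x, D x -> Rabs (f (n + k)%nat x - f n x)
            <= C * (/ (INR n + 1) - / (INR (n + k) + 1))).
  { intros n k x Hx; induction k as [|k IH].
    - rewrite Nat.add_0_r, !Rminus_diag, Rabs_R0; lra.
    - rewrite Nat.add_succ_r.
      specialize (H (n + k)%nat x Hx).
      replace (f (S (n + k)) x - f n x)
        with ((f (S (n + k)) x - f (n + k)%nat x) + (f (n + k)%nat x - f n x)) by ring.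
      eapply Rle_trans; [apply Rabs_triang|].
      rewrite S_INR. replace (INR (n + k) + 1 + 1) with (INR (n + k) + 2) by ring. lra. }
  intros eps.
  destruct (INR_unbounded (C / eps)) as [N HN].
  assert (He := cond_pos eps).
  exists N.
  assert (Hw : forall n m x, D x -> (N <= n)%nat -> (n <= m)%nat -> Rabs (f m x - f n x) < eps).
  { intros n m x Hx Hn Hm.
    replace m with (n + (m - n))%nat by lia.
    eapply Rle_lt_trans; [apply Hs; auto|].
    assert (INR N <= INR n) by (apply le_INR; auto).
    assert (0 < / (INR (n + (m - n)) + 1)).
    { apply Rinv_0_lt_compat; generalize (pos_INR (n + (m - n))); lra. }
    assert (Hp : 0 < INR n + 1) by (generalize (pos_INR n); lra).
    assert (C * / (INR n + 1) < eps).
    { apply Rmult_lt_reg_r with (INR n + 1); auto.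
      rewrite Rmult_assoc, Rinv_l by lra.
      assert (C < eps * INR N).
      { apply Rmult_lt_reg_r with (/ eps); [now apply Rinv_0_lt_compat|].
        replace (eps * INR N * / eps) with (INR N) by (field; lra). apply HN. }
      nra. }
    nra. }
  intros n m x Hx Hn Hm.
  destruct (Nat.le_ge_cases n m).
  - rewrite Rabs_minus_sym; apply Hw; auto.
  - apply Hw; auto.
Qed.

Lemma log_gauss_lim (z : R) : 0 < z ->
  is_lim_seq (fun n => log_gauss n z) (real (Lim_seq (fun n => log_gauss n z))).
Proof.
  intros Hz; apply Lim_seq_correct', ex_lim_seq_cauchy_corr.
  intros eps.
  destruct (CVU_cauchy_telescope log_gauss (fun y => 0 < y < z + 1) ((z + 1) ^ 2 + (z + 1)))
    with (eps := eps) as [N HN].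
  - nra.
  - intros; apply log_gauss_step; auto.
  - exists N; intros n m Hn Hm; apply HN; auto; lra.
Qed.

(** Functions and derivatives both converge uniformly on [(0, z + 1)]; the terms singular at 0 are
    common to all indices and cancel in the increments. *)
Lemma is_derive_lim_log_gauss (z : R) : 0 < z ->
  ex_derive (fun z => real (Lim_seq (fun n => log_gauss n z))) z.
Proof.
  intros Hz.
  set (D := fun y => 0 < y < z + 1).
  assert (HD : forall n y, D y -> Derive (log_gauss n) y = dlog_gauss n y).
  { intros n y Hy; apply is_derive_unique, is_derive_log_gauss; apply Hy. }
  assert (Ho : open D).
  { apply (open_and (fun y => 0 < y) (fun y => y < z + 1)); [apply open_gt|apply open_lt]. }
  eexists; apply (CVU_Derive log_gauss D); auto.
  - intros a b x [Ha _] [_ Hb] Hx; split; lra.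
  - apply CVU_dom_cauchy, (CVU_cauchy_telescope _ _ ((z + 1) ^ 2 + (z + 1))); [nra|].
    intros; apply log_gauss_step; auto.
  - intros n x [Hx _]; eexists; apply is_derive_log_gauss; auto.
  - intros n x Hx.
    apply (continuity_pt_ext_loc (dlog_gauss n)).
    + apply (filter_imp D); [intros; symmetry; auto|]. apply Ho; auto.
    + apply continuity_pt_minus; [|apply continuity_pt_const; intros ? ?; auto].
      destruct Hx as [Hx _].
      assert (E : forall m, continuity_pt (fun z => sum_f_R0 (fun k => / (z + INR k)) m) x).
      { assert (Ek : forall k, continuity_pt (fun z => / (z + INR k)) x).
        { intros k; apply continuity_pt_filterlim, (ex_derive_continuous (fun z => / (z + INR k)) x).
          generalize (INR k) (pos_INR k); intros; auto_derive; lra. }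
        induction m as [|m IH]; [apply Ek|].
        apply (continuity_pt_plus (fun z => sum_f_R0 (fun k => / (z + INR k)) m)
          (fun z => / (z + INR (S m)))); auto. }
      apply E.
  - apply CVU_dom_cauchy.
    assert (Hc : CVU_cauchy dlog_gauss D).
    { apply (CVU_cauchy_telescope _ _ (z + 1 + 1)); [lra|].
      intros; apply dlog_gauss_step; auto. }
    intros eps; destruct (Hc eps) as [N HN]; exists N; intros n m x Hx Hn Hm.
    rewrite !HD; auto.
  - unfold D; lra.
Qed.

Lemma gauss_prod_lim_pos (z : R) : 0 < z ->
  is_lim_seq (gauss_prod z) (exp (real (Lim_seq (fun n => log_gauss n z)))).
Proof.
  intros Hz; apply is_lim_seq_incr_1.
  apply (is_lim_seq_ext (fun n => exp (log_gauss n z))).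
  - intros; symmetry; apply gauss_prod_exp; auto.
  - apply (is_lim_seq_continuous exp); [|apply log_gauss_lim; auto].
    apply derivable_continuous_pt, derivable_pt_exp.
Qed.

Lemma rGamma_eq_exp (z : R) : 0 < z -> rGamma z = exp (real (Lim_seq (fun n => log_gauss n z))).
Proof.
  intros Hz. change (rGamma z) with (real (Lim_seq (gauss_prod z))).
  now rewrite (is_lim_seq_unique _ _ (gauss_prod_lim_pos z Hz)).
Qed.

Lemma rGamma_pos (z : R) : 0 < z -> 0 < rGamma z.
Proof. intros; rewrite rGamma_eq_exp by auto; apply exp_pos. Qed.

(** This plays the part of analytic continuation: facts on the positive axis descend by unit steps
    through the functional equation. *)
Lemma real_shift_ind (P : R -> Prop) :
  (forall z, 0 < z -> P z) -> (forall z, P (z + 1) -> P z) -> forall z, P z.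
Proof.
  intros H0 HS.
  assert (H : forall N z, - INR N < z -> P z).
  { induction N as [|N IH]; intros z Hz.
    - apply H0; simpl in Hz; lra.
    - apply HS, IH; rewrite S_INR in Hz; lra. }
  intros z; destruct (INR_unbounded (- z)) as [N HN]; apply (H N); lra.
Qed.

Lemma gauss_prod_lim (z : R) : is_lim_seq (gauss_prod z) (rGamma z).
Proof.
  assert (H : exists l : R, is_lim_seq (gauss_prod z) l).
  { revert z; apply real_shift_ind.
    - intros z Hz; eexists; apply gauss_prod_lim_pos; auto.
    - intros z [l Hl]; exists (z * l); apply gauss_prod_lim_shift; auto. }
  destruct H as [l Hl].
  change (rGamma z) with (real (Lim_seq (gauss_prod z))).
  now rewrite (is_lim_seq_unique _ _ Hl).
Qed.

Lemma rGamma_shift (z : R) : rGamma z = z * rGamma (z + 1).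
Proof.
  assert (H := gauss_prod_lim_shift z _ (gauss_prod_lim (z + 1))).
  apply is_lim_seq_unique in H.
  change (rGamma z) with (real (Lim_seq (gauss_prod z))); now rewrite H.
Qed.

Lemma ex_derive_rGamma (z : R) : ex_derive rGamma z.
Proof.
  revert z; apply real_shift_ind.
  - intros z Hz.
    apply (ex_derive_ext_loc (fun z => exp (real (Lim_seq (fun n => log_gauss n z))))).
    + apply (filter_imp (fun y => 0 < y)); [intros; symmetry; apply rGamma_eq_exp; auto|].
      apply open_gt; auto.
    + destruct (is_derive_lim_log_gauss z Hz) as [l Hl].
      eexists; apply (is_derive_comp exp); [|exact Hl].
      apply is_derive_Reals, derivable_pt_lim_exp.
  - intros z H.
    apply (ex_derive_ext (fun z => z * rGamma (z + 1))).
    + intros; symmetry; apply rGamma_shift.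
    + apply (ex_derive_mult (fun z => z) (fun z => rGamma (z + 1))); [apply @ex_derive_id|].
      apply (ex_derive_comp rGamma (fun z => z + 1)); auto.
      auto_derive; auto.
Qed.

Lemma Derive_rGamma_shift (z : R) :
  Derive rGamma z = rGamma (z + 1) + z * Derive rGamma (z + 1).
Proof.
  rewrite (Derive_ext rGamma (fun z => z * rGamma (z + 1))) by apply rGamma_shift.
  apply is_derive_unique.
  evar_last.
  - apply (is_derive_mult (fun z => z) (fun z => rGamma (z + 1)) z); [apply @is_derive_id| |].
    + apply (is_derive_comp rGamma (fun z => z + 1)).
      * apply Derive_correct, ex_derive_rGamma.
      * auto_derive; auto.
    + intros; apply Rmult_comm.
  - unfold plus, mult, one, scal; simpl; unfold mult; simpl. ring.
Qed.

Lemma rGamma_neq_0 (z : R) : (forall n : nat, z <> - INR n) -> rGamma z <> 0.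
Proof.
  revert z; apply (real_shift_ind (fun z => (forall n : nat, z <> - INR n) -> rGamma z <> 0)).
  - intros z Hz _; generalize (rGamma_pos z Hz); lra.
  - intros z IH Hn; rewrite rGamma_shift.
    apply Rmult_integral_contrapositive_currified.
    + generalize (Hn 0%nat); simpl; lra.
    + apply IH; intros n E; apply (Hn (S n)); rewrite S_INR; lra.
Qed.

Lemma rGamma_opp_INR (n : nat) : rGamma (- INR n) = 0.
Proof.
  induction n as [|n IH].
  - rewrite rGamma_shift; simpl; ring.
  - rewrite rGamma_shift, S_INR.
    replace (- (INR n + 1) + 1) with (- INR n) by ring. rewrite IH; ring.
Qed.

(** The zeros of [1/Gamma] at these points are simple: differentiating the functional equation at
    such a zero leaves one factor times the derivative one step to the right. For positive integer
    orders this decides that the Wronskian of [J] and [Y] is nonzero. *)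
Lemma Derive_rGamma_opp_INR_neq_0 (n : nat) : Derive rGamma (- INR n) <> 0.
Proof.
  induction n as [|n IH].
  - rewrite Derive_rGamma_shift; simpl.
    replace (-0 + 1) with 1 by ring.
    generalize (rGamma_pos 1 Rlt_0_1); lra.
  - rewrite Derive_rGamma_shift, S_INR.
    replace (- (INR n + 1) + 1) with (- INR n) by ring.
    rewrite rGamma_opp_INR, Rplus_0_l.
    apply Rmult_integral_contrapositive_currified; auto.
    generalize (pos_INR n); lra.
Qed.

(** * Bessel series *)

Lemma Series_abs_le (u b : nat -> R) :
  (forall n, Rabs (u n) <= b n) -> ex_series b -> Rabs (Series u) <= Series b.
Proof.
  intros Hub Hb.
  assert (Hu : ex_series (fun n => Rabs (u n))).
  { apply (ex_series_le (fun n => Rabs (u n)) b); auto.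
    intros n; unfold norm; simpl; unfold abs; simpl; rewrite Rabs_Rabsolu; auto. }
  eapply Rle_trans; [apply Series_Rabs; auto|].
  apply Series_le; auto. intros n; split; [apply Rabs_pos|auto].
Qed.

Lemma is_lim_seq_sum_f_R0 (a : nat -> nat -> R) (l : nat -> R) (N : nat) :
  (forall m, is_lim_seq (a m) (l m)) ->
  is_lim_seq (fun k => sum_f_R0 (fun m => a m k) N) (sum_f_R0 l N).
Proof.
  intros H; induction N as [|N IH]; simpl; auto.
  apply is_lim_seq_plus'; auto.
Qed.

(** Tannery's theorem: a common majorant controls the two tails, and the finite head converges term
    by term. *)
Lemma series_dominated_lim (a : nat -> nat -> R) (l b : nat -> R) :
  ex_series b -> (forall m k, Rabs (a m k) <= b m) ->
  (forall m, is_lim_seq (a m) (l m)) ->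
  is_lim_seq (fun k => Series (fun m => a m k)) (Series l).
Proof.
  intros Hb Hab Hl.
  assert (Hlb : forall m, Rabs (l m) <= b m).
  { intros m.
    apply (is_lim_seq_le (fun k => Rabs (a m k)) (fun _ => b m) (Rabs (l m)) (b m)); auto.
    - apply (is_lim_seq_abs (a m) (l m)); auto.
    - apply is_lim_seq_const. }
  assert (Hex : forall u, (forall n, Rabs (u n) <= b n) -> ex_series u).
  { intros u Hu; apply (ex_series_le u b); auto. }
  apply is_lim_seq_spec; intros eps.
  assert (He := cond_pos eps).
  assert (Hbs := Series_correct b Hb).
  apply is_series_Reals in Hbs.
  destruct (Hbs (eps / 4) ltac:(lra)) as [N HN].
  specialize (HN N ltac:(lia)); unfold R_dist in HN.
  assert (Etail : forall u, ex_series u ->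
    Series u = sum_f_R0 u N + Series (fun k => u (S N + k)%nat)).
  { intros u Hu; rewrite (Series_incr_n u (S N)); auto; lia. }
  rewrite (Etail b Hb) in HN.
  assert (Hbt : ex_series (fun k => b (S N + k)%nat)) by (apply ex_series_incr_n; auto).
  assert (Ht : Series (fun k => b (S N + k)%nat) < eps / 4).
  { apply Rabs_def2 in HN; lra. }
  assert (Hf := is_lim_seq_sum_f_R0 a l N Hl).
  apply is_lim_seq_spec in Hf.
  destruct (Hf (mkposreal (eps / 4) ltac:(lra))) as [K HK].
  exists K; intros k Hk; specialize (HK k Hk); simpl in HK.
  rewrite (Etail (fun m => a m k)) by (apply Hex; auto).
  rewrite (Etail l) by (apply Hex; auto).
  assert (H1 := Series_abs_le (fun j => a (S N + j)%nat k) _ ltac:(intros; apply Hab) Hbt).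
  assert (H2 := Series_abs_le (fun j => l (S N + j)%nat) _ ltac:(intros; apply Hlb) Hbt).
  apply Rabs_def2 in HK. apply Rabs_le_between in H1, H2.
  apply Rabs_def1; lra.
Qed.

(** The linear numerator is there for the coefficients differentiated in the order; it is absorbed
    by [2^m], and [(2 r)^m / m!] is bounded. *)
Lemma CV_radius_infinite_fact (a : nat -> R) (C B : R) :
  0 <= C -> 0 <= B -> (forall m, Rabs (a m) <= (C + B * INR m) / INR (fact m)) ->
  CV_radius a = p_infty.
Proof.
  intros HC HB Ha.
  assert (H2 : forall m, C + B * INR m <= (C + B) * 2 ^ m).
  { intros m. assert (1 + INR m <= 2 ^ m /\ 1 <= 2 ^ m).
    { induction m as [|m IH]; [simpl; lra|]. rewrite S_INR; simpl pow.
      generalize (pos_INR m); lra. }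
    generalize (pos_INR m); nra. }
  assert (Hr : forall r : R, Rbar_le r (CV_radius a)).
  { intros r; apply (proj1 (CV_radius_bounded a)).
    destruct (filterlim_bounded (fun n => (2 * Rabs r) ^ n / INR (fact n))) as [M HM].
    { exists 0. apply (proj2 (is_lim_seq_Reals _ 0)), cv_speed_pow_fact. }
    exists ((C + B) * M); intros n.
    assert (Hf : 0 < INR (fact n)) by (apply lt_0_INR, lt_O_fact).
    rewrite Rabs_mult, <- RPow_abs.
    apply Rle_trans with ((C + B) * 2 ^ n / INR (fact n) * Rabs r ^ n).
    - apply Rmult_le_compat_r; [apply pow_le, Rabs_pos|].
      eapply Rle_trans; [apply Ha|].
      apply Rmult_le_compat_r; auto. left; now apply Rinv_0_lt_compat.
    - replace ((C + B) * 2 ^ n / INR (fact n) * Rabs r ^ n)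
        with ((C + B) * ((2 * Rabs r) ^ n / INR (fact n))).
      + apply Rmult_le_compat_l; [lra|].
        eapply Rle_trans; [apply Rle_abs|]. apply HM.
      + rewrite Rpow_mult_distr; field; lra. }
  destruct (CV_radius a) as [c| |]; auto.
  - specialize (Hr (c + 1)); simpl in Hr; lra.
  - specialize (Hr 0); simpl in Hr; tauto.
Qed.

(** The bound has to be uniform in [k] to serve as a majorant. It is used with [B = 0] for values of
    [rGamma] and with a general [B] for its difference quotients. *)
Lemma uniform_growth (u : nat -> nat -> R) (B : R) (m0 : nat) :
  0 <= B -> (forall m, exists M, forall k, Rabs (u m k) <= M) ->
  (forall m k, (m0 <= m)%nat -> Rabs (u (S m) k) <= Rabs (u m k) + B) ->
  exists C, 0 <= C /\ forall m k, Rabs (u m k) <= C + B * INR m.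
Proof.
  intros HB Hbd Hs.
  assert (H0 : forall N, exists C, 0 <= C /\ forall m k, (m <= N)%nat -> Rabs (u m k) <= C).
  { induction N as [|N [C [HC IH]]].
    - destruct (Hbd 0%nat) as [M HM]. exists M; split.
      + eapply Rle_trans; [apply Rabs_pos|apply (HM 0%nat)].
      + intros m k Hm; replace m with 0%nat by lia; auto.
    - destruct (Hbd (S N)) as [M HM]. exists (Rmax C M); split.
      + eapply Rle_trans; [apply HC|apply Rmax_l].
      + intros m k Hm; destruct (Nat.eq_dec m (S N)) as [->|Hne].
        * eapply Rle_trans; [apply HM|apply Rmax_r].
        * eapply Rle_trans; [apply IH; lia|apply Rmax_l]. }
  destruct (H0 m0) as [C [HC HC']].
  exists C; split; auto; intros m k.
  destruct (Nat.le_ge_cases m m0) as [Hm|Hm].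
  - specialize (HC' m k Hm). generalize (pos_INR m); nra.
  - induction Hm as [|m Hm IH].
    + specialize (HC' m0 k ltac:(lia)). generalize (pos_INR m0); nra.
    + specialize (Hs m k Hm); rewrite S_INR; lra.
Qed.

Lemma is_lim_seq_bounded (u : nat -> R) (l : R) :
  is_lim_seq u l -> exists M, forall n, Rabs (u n) <= M.
Proof.
  intros H; destruct (filterlim_bounded u) as [M HM]; [exists l; exact H|].
  exists M; exact HM.
Qed.

Lemma derive_seq_lim (f : R -> R) (x l : R) (h : nat -> R) :
  is_derive f x l -> is_lim_seq h 0 -> (forall k, h k <> 0) ->
  is_lim_seq (fun k => (f (x + h k) - f x) / h k) l.
Proof.
  intros Hd Hh H0.
  apply is_lim_seq_spec; intros eps.
  apply is_derive_Reals in Hd.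
  destruct (Hd eps (cond_pos eps)) as [d Hd'].
  apply is_lim_seq_spec in Hh; destruct (Hh d) as [N HN].
  exists N; intros n Hn; apply Hd'; auto.
  specialize (HN n Hn); now rewrite Rminus_0_r in HN.
Qed.

Lemma rGamma_inv_shift (z : R) : z <> 0 -> rGamma (z + 1) = rGamma z / z.
Proof. intros Hz; rewrite (rGamma_shift z); field; auto. Qed.

Lemma Rabs_div_le (a z : R) : 1 <= z -> Rabs (a / z) <= Rabs a.
Proof.
  intros Hz; unfold Rdiv; rewrite Rabs_mult, Rabs_inv, (Rabs_pos_eq z) by lra.
  assert (/ z <= 1) by (rewrite <- Rinv_1; apply Rinv_le_contravar; lra).
  generalize (Rabs_pos a); nra.
Qed.

Lemma rGamma_seq_bound (z : R) (h : nat -> R) : is_lim_seq h 0 ->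
  exists C, 0 <= C /\ forall m k, Rabs (rGamma (INR m + z + h k)) <= C.
Proof.
  intros Hh.
  destruct (is_lim_seq_bounded h 0 Hh) as [H HH].
  (* Beyond [m0] the arguments exceed 1, so the division in [rGamma (w + 1) = rGamma w / w] cannot
     increase the absolute value. *)
  destruct (INR_unbounded (1 - z + H)) as [m0 Hm0].
  destruct (uniform_growth (fun m k => rGamma (INR m + z + h k)) 0 m0) as [C [HC HC']]; [lra| | |].
  - intros m; apply (is_lim_seq_bounded _ (rGamma (INR m + z + 0))).
    apply (is_lim_seq_continuous rGamma).
    + destruct (ex_derive_rGamma (INR m + z + 0)) as [l Hl]; eapply derive_continuity_pt; eauto.
    + apply is_lim_seq_plus'; auto. apply is_lim_seq_const.
  - intros m k Hm.
    assert (INR m0 <= INR m) by (apply le_INR; auto).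
    specialize (HH k); apply Rabs_le_between in HH.
    rewrite S_INR; replace (INR m + 1 + z + h k) with (INR m + z + h k + 1) by ring.
    rewrite rGamma_inv_shift, Rplus_0_r by lra. apply Rabs_div_le; lra.
  - exists C; split; auto; intros m k; specialize (HC' m k); lra.
Qed.

Lemma rGamma_bound (z : R) : exists C, 0 <= C /\ forall m, Rabs (rGamma (INR m + z)) <= C.
Proof.
  destruct (rGamma_seq_bound z (fun _ => 0)) as [C [HC H]]; [apply is_lim_seq_const|].
  exists C; split; auto; intros m; specialize (H m 0%nat); now rewrite Rplus_0_r in H.
Qed.

(** Taking the difference quotient of the functional equation expresses the quotient at [m + 1] as
    the quotient at [m] minus a bounded value of [rGamma], all divided by a number that is at least
    1 for large [m]. Hence growth is at most linear, uniformly in the increment. *)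
Lemma rGamma_quotient_bound (z : R) (h : nat -> R) :
  is_lim_seq h 0 -> (forall k, h k <> 0) ->
  exists C B, 0 <= C /\ 0 <= B /\ forall m k,
    Rabs ((rGamma (INR m + z + h k) - rGamma (INR m + z)) / h k) <= C + B * INR m.
Proof.
  intros Hh Hh0.
  destruct (rGamma_seq_bound z h Hh) as [B [HB HB']].
  destruct (INR_unbounded (1 - z)) as [m0 Hm0].
  destruct (uniform_growth (fun m k => (rGamma (INR m + z + h k) - rGamma (INR m + z)) / h k) B m0)
    as [C [HC HC']]; auto.
  - intros m; eapply is_lim_seq_bounded.
    apply (derive_seq_lim rGamma (INR m + z) (Derive rGamma (INR m + z)) h); auto.
    apply Derive_correct, ex_derive_rGamma.
  - intros m k Hm.
    assert (INR m0 <= INR m) by (apply le_INR; auto).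
    set (w := INR m + z).
    assert (E : (rGamma (INR (S m) + z + h k) - rGamma (INR (S m) + z)) / h k
      = ((rGamma (w + h k) - rGamma w) / h k - rGamma (INR (S m) + z + h k)) / w).
    { rewrite S_INR; replace (INR m + 1 + z + h k) with (w + h k + 1) by (unfold w; ring).
      replace (INR m + 1 + z) with (w + 1) by (unfold w; ring).
      rewrite (rGamma_shift (w + h k)), (rGamma_shift w).
      field; split; auto. unfold w; lra. }
    rewrite E. eapply Rle_trans; [apply Rabs_div_le; unfold w; lra|].
    unfold Rminus at 1; eapply Rle_trans; [apply Rabs_triang|].
    rewrite Rabs_Ropp. apply Rplus_le_compat_l, HB'.
  - exists C, B; auto.
Qed.

Lemma Derive_rGamma_bound (z : R) :
  exists C B, 0 <= C /\ 0 <= B /\ forall m, Rabs (Derive rGamma (INR m + z)) <= C + B * INR m.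
Proof.
  assert (Hh : is_lim_seq (fun k => / (INR k + 1)) 0).
  { apply (is_lim_seq_ext (fun n => / INR (S n))); [intros; now rewrite S_INR|].
    apply (is_lim_seq_incr_1 (fun n => / INR n)).
    replace (Finite 0) with (Rbar_inv p_infty) by reflexivity.
    apply is_lim_seq_inv; [apply is_lim_seq_INR|discriminate]. }
  assert (Hh0 : forall k, / (INR k + 1) <> 0).
  { intros k; apply Rinv_neq_0_compat; generalize (pos_INR k); lra. }
  destruct (rGamma_quotient_bound z _ Hh Hh0) as [C [B [HC [HB H]]]].
  exists C, B; repeat split; auto; intros m.
  apply (is_lim_seq_le (fun k => Rabs ((rGamma (INR m + z + / (INR k + 1)) - rGamma (INR m + z)) / (/ (INR k + 1))))
    (fun _ => C + B * INR m) (Rabs (Derive rGamma (INR m + z))) (C + B * INR m)); auto.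
  - apply (is_lim_seq_abs _ (Derive rGamma (INR m + z))).
    apply (derive_seq_lim rGamma _ _ (fun k => / (INR k + 1))); auto.
    apply Derive_correct, ex_derive_rGamma.
  - apply is_lim_seq_const.
Qed.

(** Coefficients in the variable [(x / 2)^2]: splitting off the power [(x / 2)^nu] leaves an entire
    function, so the behaviour at 0 can be read off. *)
Definition bcoef (nu : R) (m : nat) : R :=
  (-1) ^ m / INR (fact m) * rGamma (INR m + nu + 1).

Definition dbcoef (nu : R) (m : nat) : R :=
  (-1) ^ m / INR (fact m) * Derive rGamma (INR m + nu + 1).

Lemma Rabs_sign_fact (m : nat) (a : R) :
  Rabs ((-1) ^ m / INR (fact m) * a) = Rabs a / INR (fact m).
Proof.
  assert (Hf : 0 < INR (fact m)) by (apply lt_0_INR, lt_O_fact).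
  unfold Rdiv; rewrite !Rabs_mult, Rabs_inv, pow_1_abs, (Rabs_pos_eq (INR _)) by lra. ring.
Qed.

Lemma CV_radius_bcoef (nu : R) : CV_radius (bcoef nu) = p_infty.
Proof.
  destruct (rGamma_bound (nu + 1)) as [C [HC H]].
  apply (CV_radius_infinite_fact _ C 0); auto; [lra|].
  intros m; unfold bcoef; rewrite Rabs_sign_fact, Rmult_0_l, Rplus_0_r.
  apply Rmult_le_compat_r; [left; apply Rinv_0_lt_compat, lt_0_INR, lt_O_fact|].
  rewrite Rplus_assoc; auto.
Qed.

Lemma CV_radius_dbcoef (nu : R) : CV_radius (dbcoef nu) = p_infty.
Proof.
  destruct (Derive_rGamma_bound (nu + 1)) as [C [B [HC [HB H]]]].
  apply (CV_radius_infinite_fact _ C B); auto.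
  intros m; unfold dbcoef; rewrite Rabs_sign_fact.
  apply Rmult_le_compat_r; [left; apply Rinv_0_lt_compat, lt_0_INR, lt_O_fact|].
  rewrite Rplus_assoc; auto.
Qed.

Lemma sign_fact_S (m : nat) :
  (-1) ^ S m / INR (fact (S m)) * INR (S m) = - ((-1) ^ m / INR (fact m)).
Proof.
  change (fact (S m)) with (S m * fact m)%nat; rewrite mult_INR.
  change ((-1) ^ S m) with (-1 * (-1) ^ m).
  assert (Hf := INR_fact_neq_0 m); assert (Hs := not_0_INR (S m) ltac:(lia)).
  field; auto.
Qed.

Lemma bcoef_rec (nu : R) (m : nat) :
  INR (S m) * (INR (S m) + nu) * bcoef nu (S m) + bcoef nu m = 0.
Proof.
  unfold bcoef.
  replace (INR (S m) * (INR (S m) + nu) * ((-1) ^ S m / INR (fact (S m)) * rGamma (INR (S m) + nu + 1)))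
    with ((-1) ^ S m / INR (fact (S m)) * INR (S m) * ((INR (S m) + nu) * rGamma (INR (S m) + nu + 1)))
    by ring.
  rewrite sign_fact_S, <- rGamma_shift, S_INR.
  replace (INR m + 1 + nu) with (INR m + nu + 1) by ring. ring.
Qed.

Lemma dbcoef_rec (nu : R) (m : nat) :
  INR (S m) * (INR (S m) + nu) * dbcoef nu (S m) + INR (S m) * bcoef nu (S m) + dbcoef nu m = 0.
Proof.
  unfold bcoef, dbcoef.
  transitivity ((-1) ^ S m / INR (fact (S m)) * INR (S m) *
    (rGamma (INR (S m) + nu + 1) + (INR (S m) + nu) * Derive rGamma (INR (S m) + nu + 1))
    + (-1) ^ m / INR (fact m) * Derive rGamma (INR m + nu + 1)); [ring|].
  rewrite sign_fact_S, <- Derive_rGamma_shift, S_INR.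
  replace (INR m + 1 + nu) with (INR m + nu + 1) by ring. ring.
Qed.

Lemma is_derive_PSeries_entire (a : nat -> R) (y : R) :
  CV_radius a = p_infty -> is_derive (PSeries a) y (PSeries (PS_derive a) y).
Proof. intros H; apply is_derive_PSeries; rewrite H; exact I. Qed.

Lemma ex_pseries_entire (a : nat -> R) (y : R) : CV_radius a = p_infty -> ex_pseries a y.
Proof. intros H; apply CV_radius_inside; rewrite H; exact I. Qed.

Definition bser (nu : R) := PSeries (bcoef nu).
Definition bser1 (nu : R) := PSeries (PS_derive (bcoef nu)).
Definition bser2 (nu : R) := PSeries (PS_derive (PS_derive (bcoef nu))).
Definition dbser (nu : R) := PSeries (dbcoef nu).
Definition dbser1 (nu : R) := PSeries (PS_derive (dbcoef nu)).
Definition dbser2 (nu : R) := PSeries (PS_derive (PS_derive (dbcoef nu))).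

Lemma is_derive_bser (nu y : R) : is_derive (bser nu) y (bser1 nu y).
Proof. apply is_derive_PSeries_entire, CV_radius_bcoef. Qed.
Lemma is_derive_bser1 (nu y : R) : is_derive (bser1 nu) y (bser2 nu y).
Proof. apply is_derive_PSeries_entire; rewrite CV_radius_derive; apply CV_radius_bcoef. Qed.
Lemma is_derive_dbser (nu y : R) : is_derive (dbser nu) y (dbser1 nu y).
Proof. apply is_derive_PSeries_entire, CV_radius_dbcoef. Qed.
Lemma is_derive_dbser1 (nu y : R) : is_derive (dbser1 nu) y (dbser2 nu y).
Proof. apply is_derive_PSeries_entire; rewrite CV_radius_derive; apply CV_radius_dbcoef. Qed.

(** In [y = (x / 2)^2], with the power [(x / 2)^nu] split off, Bessel's equation reads
    [y F'' + (nu + 1) F' + F = 0]. Its effect on coefficients is stated once for the series and for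
    its derivative in the order. *)
Lemma PSeries_bessel_op (a : nat -> R) (nu y : R) : CV_radius a = p_infty ->
  y * PSeries (PS_derive (PS_derive a)) y + (nu + 1) * PSeries (PS_derive a) y + PSeries a y
  = PSeries (fun m => INR (S m) * (INR (S m) + nu) * a (S m) + a m) y.
Proof.
  intros Ha.
  assert (Ha1 : CV_radius (PS_derive a) = p_infty) by now rewrite CV_radius_derive.
  assert (Ha2 : CV_radius (PS_derive (PS_derive a)) = p_infty) by now rewrite CV_radius_derive.
  rewrite <- PSeries_incr_1, <- PSeries_scal.
  assert (E1 : ex_pseries (PS_incr_1 (PS_derive (PS_derive a))) y).
  { apply @ex_pseries_incr_1, ex_pseries_entire; auto. }
  assert (E2 : ex_pseries (PS_scal (nu + 1) (PS_derive a)) y).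
  { apply @ex_pseries_scal; [apply Rmult_comm|]. apply ex_pseries_entire; auto. }
  rewrite <- PSeries_plus, <- PSeries_plus; auto.
  - apply PSeries_ext; intros [|m]; unfold PS_plus, PS_scal, PS_incr_1, PS_derive, plus, scal, zero; simpl;
      unfold mult; simpl; ring.
  - apply @ex_pseries_plus; auto.
  - apply ex_pseries_entire; auto.
Qed.

Lemma bser_ode (nu y : R) : y * bser2 nu y + (nu + 1) * bser1 nu y + bser nu y = 0.
Proof.
  unfold bser, bser1, bser2; rewrite PSeries_bessel_op by apply CV_radius_bcoef.
  rewrite (PSeries_ext _ (fun _ => 0)); [apply PSeries_const_0|apply bcoef_rec].
Qed.

(** This is [bser_ode] differentiated in [nu]; the coefficient [nu + 1] contributes the extra
    [bser1]. *)
Lemma dbser_ode (nu y : R) :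
  y * dbser2 nu y + (nu + 1) * dbser1 nu y + dbser nu y + bser1 nu y = 0.
Proof.
  unfold dbser, dbser1, dbser2, bser1; rewrite PSeries_bessel_op by apply CV_radius_dbcoef.
  rewrite (PSeries_ext _ (PS_scal (-1) (PS_derive (bcoef nu)))).
  - rewrite PSeries_scal; ring.
  - intros m; unfold PS_scal, PS_derive, scal; simpl; unfold mult; simpl.
    generalize (dbcoef_rec nu m); simpl; lra.
Qed.

Lemma besselJ_eq (nu x : R) : besselJ nu x = Rpower (x / 2) nu * bser nu ((x / 2) ^ 2).
Proof.
  unfold besselJ, bser, PSeries; f_equal; apply Series_ext; intros m.
  unfold bcoef; now rewrite pow_mult.
Qed.

Lemma is_derive_half_power (nu x : R) : 0 < x ->
  is_derive (fun x => Rpower (x / 2) nu) x (nu / x * Rpower (x / 2) nu).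
Proof.
  intros Hx; unfold Rpower, Rdiv; auto_derive; [lra|]. field; lra.
Qed.

Lemma is_derive_half_sqr_comp (F : R -> R) (x dF : R) :
  is_derive F ((x / 2) ^ 2) dF -> is_derive (fun x => F ((x / 2) ^ 2)) x (x / 2 * dF).
Proof.
  intros H; apply (is_derive_comp F (fun x => (x / 2) ^ 2)); auto.
  auto_derive; auto; field.
Qed.

Lemma is_derive_power_comp (nu x : R) (F F1 : R -> R) : 0 < x ->
  (forall y, is_derive F y (F1 y)) ->
  is_derive (fun x => Rpower (x / 2) nu * F ((x / 2) ^ 2)) x
    (Rpower (x / 2) nu * (nu / x * F ((x / 2) ^ 2) + x / 2 * F1 ((x / 2) ^ 2))).
Proof.
  intros Hx HF.
  evar_last.
  - apply @is_derive_mult; [apply is_derive_half_power; auto| |intros; apply Rmult_comm].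
    apply is_derive_half_sqr_comp, HF.
  - unfold plus, mult; simpl; ring.
Qed.

Lemma is_derive_power_comp2 (nu x : R) (F F1 F2 : R -> R) : 0 < x ->
  (forall y, is_derive F y (F1 y)) -> (forall y, is_derive F1 y (F2 y)) ->
  is_derive (fun x => Rpower (x / 2) nu * (nu / x * F ((x / 2) ^ 2) + x / 2 * F1 ((x / 2) ^ 2))) x
    (Rpower (x / 2) nu * ((nu ^ 2 - nu) / x ^ 2 * F ((x / 2) ^ 2)
       + (nu + 1 / 2) * F1 ((x / 2) ^ 2) + (x / 2) ^ 2 * F2 ((x / 2) ^ 2))).
Proof.
  intros Hx HF HF1.
  evar_last.
  - apply (is_derive_mult (fun x => Rpower (x / 2) nu)
      (fun x => nu / x * F ((x / 2) ^ 2) + x / 2 * F1 ((x / 2) ^ 2)));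
      [apply is_derive_half_power; auto| |intros; apply Rmult_comm].
    apply @is_derive_plus.
    + apply (is_derive_mult (fun x => nu / x) (fun x => F ((x / 2) ^ 2)) x (- nu / x ^ 2));
        [|apply is_derive_half_sqr_comp, HF|intros; apply Rmult_comm].
      auto_derive; [lra|field; lra].
    + apply (is_derive_mult (fun x => x / 2) (fun x => F1 ((x / 2) ^ 2)) x (1 / 2));
        [|apply is_derive_half_sqr_comp, HF1|intros; apply Rmult_comm].
      auto_derive; auto; field.
  - unfold plus, mult; simpl. field; lra.
Qed.

Definition bessel_rhs (nu x f df : R) : R := - df / x - (1 - nu ^ 2 / x ^ 2) * f.

Definition dJ (nu x : R) : R :=
  Rpower (x / 2) nu * (nu / x * bser nu ((x / 2) ^ 2) + x / 2 * bser1 nu ((x / 2) ^ 2)).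

Lemma is_derive_besselJ (nu x : R) : 0 < x -> is_derive (besselJ nu) x (dJ nu x).
Proof.
  intros Hx.
  apply (is_derive_ext (fun x => Rpower (x / 2) nu * bser nu ((x / 2) ^ 2))).
  - intros; symmetry; apply besselJ_eq.
  - apply is_derive_power_comp; auto; apply is_derive_bser.
Qed.

Lemma is_derive_dJ (nu x : R) : 0 < x ->
  is_derive (dJ nu) x (bessel_rhs nu x (besselJ nu x) (dJ nu x)).
Proof.
  intros Hx.
  evar_last.
  - apply is_derive_power_comp2; auto; [apply is_derive_bser|apply is_derive_bser1].
  - unfold bessel_rhs; rewrite besselJ_eq; unfold dJ.
    assert (H := bser_ode nu ((x / 2) ^ 2)).
    replace ((x / 2) ^ 2 * bser2 nu ((x / 2) ^ 2))
      with (- (nu + 1) * bser1 nu ((x / 2) ^ 2) - bser nu ((x / 2) ^ 2)) by lra.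
    field; lra.
Qed.

(* The derivative of [besselJ] with respect to the order, and its derivative in [x]. *)
Definition dordJ (nu x : R) : R :=
  ln (x / 2) * besselJ nu x + Rpower (x / 2) nu * dbser nu ((x / 2) ^ 2).

Definition dxdordJ (nu x : R) : R :=
  besselJ nu x / x + ln (x / 2) * dJ nu x +
  Rpower (x / 2) nu * (nu / x * dbser nu ((x / 2) ^ 2) + x / 2 * dbser1 nu ((x / 2) ^ 2)).

Lemma is_derive_ln_half (x : R) : 0 < x -> is_derive (fun x => ln (x / 2)) x (/ x).
Proof. intros; auto_derive; [lra|field; lra]. Qed.

Lemma is_derive_dordJ (nu x : R) : 0 < x -> is_derive (dordJ nu) x (dxdordJ nu x).
Proof.
  intros Hx.
  evar_last.
  - apply @is_derive_plus; [|apply is_derive_power_comp; auto; apply is_derive_dbser].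
    apply (is_derive_mult (fun x => ln (x / 2)) (besselJ nu));
      [apply is_derive_ln_half; auto|apply is_derive_besselJ; auto|intros; apply Rmult_comm].
  - unfold plus, mult, dxdordJ; simpl. field; lra.
Qed.

(** The source term is the derivative in [nu] of the coefficient [nu^2 / x^2] in Bessel's
    equation. *)
Lemma is_derive_dxdordJ (nu x : R) : 0 < x ->
  is_derive (dxdordJ nu) x
    (bessel_rhs nu x (dordJ nu x) (dxdordJ nu x) + 2 * nu / x ^ 2 * besselJ nu x).
Proof.
  intros Hx.
  evar_last.
  - apply @is_derive_plus;
      [|apply is_derive_power_comp2; auto; [apply is_derive_dbser|apply is_derive_dbser1]].
    apply @is_derive_plus.
    + apply is_derive_div; [apply is_derive_besselJ; auto|apply @is_derive_id|lra].
    + apply (is_derive_mult (fun x => ln (x / 2)) (dJ nu));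
      [apply is_derive_ln_half; auto|apply is_derive_dJ; auto|intros; apply Rmult_comm].
  - unfold plus, mult, one, bessel_rhs, dxdordJ, dordJ; simpl.
    change (x / 2 * (x / 2 * 1)) with ((x / 2) ^ 2).
    assert (H := dbser_ode nu ((x / 2) ^ 2)).
    replace ((x / 2) ^ 2 * dbser2 nu ((x / 2) ^ 2)) with
      (- (nu + 1) * dbser1 nu ((x / 2) ^ 2) - dbser nu ((x / 2) ^ 2) - bser1 nu ((x / 2) ^ 2)) by lra.
    unfold bessel_rhs, dJ; rewrite besselJ_eq.
    set (F := bser nu ((x / 2) ^ 2)); set (F1 := bser1 nu ((x / 2) ^ 2)).
    set (G := dbser nu ((x / 2) ^ 2)); set (G1 := dbser1 nu ((x / 2) ^ 2)).
    field; lra.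
Qed.

(** * Differentiation in the order and integer orders *)

(** The difference quotients of the coefficients are at most [(C + B m) / m!] for all increments of
    the sequence, which supplies the majorant for passing to the limit under the sum. *)
Lemma order_derivative_lim (nu x : R) (h : nat -> R) : 0 < x ->
  is_lim_seq h 0 -> (forall k, h k <> 0) ->
  is_lim_seq (fun k => (besselJ (nu + h k) x - besselJ nu x) / h k) (dordJ nu x).
Proof.
  intros Hx Hh Hh0.
  set (y := (x / 2) ^ 2).
  assert (Hy : 0 <= y) by apply pow2_ge_0.
  assert (HS : is_lim_seq (fun k => (bser (nu + h k) y - bser nu y) / h k) (dbser nu y)).
  { set (u := fun m k => (rGamma (INR m + (nu + 1) + h k) - rGamma (INR m + (nu + 1))) / h k).
    destruct (rGamma_quotient_bound (nu + 1) h Hh Hh0) as [C [B [HC [HB Hu]]]].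
    apply (is_lim_seq_ext (fun k => Series (fun m => (-1) ^ m / INR (fact m) * u m k * y ^ m))).
    - intros k; unfold bser, PSeries.
      assert (Hex : forall mu, ex_series (fun m => bcoef mu m * y ^ m)).
      { intros mu. apply (ex_series_ext (fun m => scal (pow_n y m) (bcoef mu m))).
        - intros m; rewrite pow_n_pow; unfold scal; simpl; unfold mult; simpl; ring.
        - apply (ex_pseries_entire (bcoef mu) y), CV_radius_bcoef. }
      rewrite <- Series_minus by auto.
      unfold Rdiv at 2; rewrite Rmult_comm, <- Series_scal_l.
      apply Series_ext; intros m; unfold bcoef, u.
      rewrite <- !Rplus_assoc.
      replace (INR m + nu + h k + 1) with (INR m + nu + 1 + h k) by ring.
      field; split; auto; apply INR_fact_neq_0.
    - apply (series_dominated_lim _ (fun m => dbcoef nu m * y ^ m)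
        (fun m => Rabs ((C + B * INR m) / INR (fact m) * y ^ m))).
      + apply (CV_disk_inside (fun m => (C + B * INR m) / INR (fact m))).
        rewrite (CV_radius_infinite_fact _ C B); auto; [exact I|].
        intros m; rewrite Rabs_pos_eq; [lra|].
        apply Rmult_le_pos; [generalize (pos_INR m); nra|].
        left; apply Rinv_0_lt_compat, lt_0_INR, lt_O_fact.
      + intros m k. rewrite !Rabs_mult. apply Rmult_le_compat_r; [apply Rabs_pos|].
        rewrite <- Rabs_mult, Rabs_sign_fact.
        assert (Hf : 0 < INR (fact m)) by (apply lt_0_INR, lt_O_fact).
        eapply Rle_trans; [|apply Rle_abs].
        apply Rmult_le_compat_r; [left; now apply Rinv_0_lt_compat|]. apply Hu.
      + intros m. apply (is_lim_seq_mult' _ (fun _ => y ^ m)); [|apply is_lim_seq_const].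
        unfold dbcoef; apply (is_lim_seq_scal_l (u m) _ (Derive rGamma (INR m + nu + 1))).
        rewrite Rplus_assoc.
        apply (derive_seq_lim rGamma _ _ h); auto.
        apply Derive_correct, ex_derive_rGamma. }
  assert (HE : is_lim_seq (fun k => (Rpower (x / 2) (nu + h k) - Rpower (x / 2) nu) / h k)
     (ln (x / 2) * Rpower (x / 2) nu)).
  { apply (derive_seq_lim (Rpower (x / 2)) nu _ h); auto.
    unfold Rpower; auto_derive; auto. ring. }
  assert (HE0 : is_lim_seq (fun k => Rpower (x / 2) (nu + h k)) (Rpower (x / 2) nu)).
  { replace (Rpower (x / 2) nu) with (Rpower (x / 2) (nu + 0)) by (f_equal; ring).
    apply (is_lim_seq_continuous (Rpower (x / 2))).
    - apply (derive_continuity_pt _ _ (ln (x / 2) * Rpower (x / 2) (nu + 0))).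
      unfold Rpower; auto_derive; auto. ring.
    - apply is_lim_seq_plus'; auto; apply is_lim_seq_const. }
  apply (is_lim_seq_ext (fun k =>
     (Rpower (x / 2) (nu + h k) - Rpower (x / 2) nu) / h k * bser nu y +
     Rpower (x / 2) (nu + h k) * ((bser (nu + h k) y - bser nu y) / h k))).
  - intros k; rewrite !besselJ_eq; fold y; field; auto.
  - unfold dordJ; rewrite besselJ_eq; fold y; rewrite <- Rmult_assoc.
    apply is_lim_seq_plus'; apply is_lim_seq_mult'; auto; apply is_lim_seq_const.
Qed.

Lemma rGamma_INR (k : nat) : rGamma (INR k + 1) = rGamma 1 / INR (fact k).
Proof.
  induction k as [|k IH].
  - simpl; rewrite Rplus_0_l; field.
  - rewrite S_INR, rGamma_inv_shift by (generalize (pos_INR k); lra).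
    rewrite IH; change (fact (S k)) with (S k * fact k)%nat; rewrite mult_INR, S_INR.
    field; split; [apply INR_fact_neq_0|generalize (pos_INR k); lra].
Qed.

Lemma half_power_opp (n : nat) (x : R) : 0 < x ->
  Rpower (x / 2) (- INR n) * ((x / 2) ^ 2) ^ n = Rpower (x / 2) (INR n).
Proof.
  intros Hx; rewrite Rpower_Ropp, Rpower_pow by lra.
  rewrite <- pow_mult, Nat.mul_comm, pow_mult.
  assert ((x / 2) ^ n <> 0) by (apply pow_nonzero; lra).
  field; auto.
Qed.

(** The first [n] coefficients of order [- n] contain [1/Gamma] at 0, -1, ... and vanish; shifting
    the index by [n] turns the rest into the series of order [n]. *)
Lemma besselJ_opp_INR (n : nat) (x : R) : 0 < x ->
  besselJ (- INR n) x = (-1) ^ n * besselJ (INR n) x.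
Proof.
  intros Hx; rewrite !besselJ_eq, <- (half_power_opp n x) by auto.
  unfold bser at 1; rewrite (PSeries_decr_n_aux _ n).
  - assert (E : PSeries (PS_decr_n (bcoef (- INR n)) n) ((x / 2) ^ 2)
        = (-1) ^ n * bser (INR n) ((x / 2) ^ 2)).
    { unfold bser; rewrite <- PSeries_scal; apply PSeries_ext; intros k.
      unfold PS_decr_n, PS_scal, bcoef, scal; simpl; unfold mult; simpl.
      rewrite plus_INR.
      replace (INR n + INR k + - INR n + 1) with (INR k + 1) by ring.
      rewrite <- plus_INR, rGamma_INR, rGamma_INR, pow_add.
      rewrite (Nat.add_comm k n).
      field; split; apply INR_fact_neq_0. }
    rewrite E; ring.
  - intros k Hk; unfold bcoef.
    replace (INR k + - INR n + 1) with (- INR (n - 1 - k)).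
    + rewrite rGamma_opp_INR; ring.
    + rewrite !minus_INR by lia; simpl; ring.
Qed.

Lemma dJ_opp_INR (n : nat) (x : R) : 0 < x -> dJ (- INR n) x = (-1) ^ n * dJ (INR n) x.
Proof.
  intros Hx.
  rewrite <- (is_derive_unique _ _ _ (is_derive_besselJ (- INR n) x Hx)).
  apply is_derive_unique.
  apply (is_derive_ext_loc (fun x => (-1) ^ n * besselJ (INR n) x)).
  - apply (filter_imp (fun y => 0 < y)); [intros; symmetry; apply besselJ_opp_INR; auto|].
    apply open_gt; auto.
  - apply (is_derive_scal (besselJ (INR n)) x ((-1) ^ n)), is_derive_besselJ; auto.
Qed.

Lemma cos_INR_PI (n : nat) : cos (INR n * PI) = (-1) ^ n.
Proof.
  induction n as [|n IH].
  - simpl; rewrite Rmult_0_l, cos_0; auto.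
  - rewrite S_INR, Rmult_plus_distr_r, Rmult_1_l, neg_cos, IH; simpl; ring.
Qed.

Lemma pow_m1_sqr (n : nat) : (-1) ^ n * (-1) ^ n = 1.
Proof. rewrite <- Rpow_mult_distr; replace (-1 * -1) with 1 by ring; apply pow1. Qed.

Lemma besselY_INR (n : nat) (x : R) : 0 < x ->
  besselY (INR n) x = (dordJ (INR n) x + (-1) ^ n * dordJ (- INR n) x) / PI.
Proof.
  intros Hx.
  assert (HPI := PI_RGT_0).
  unfold besselY; destruct (Req_EM_T (sin (INR n * PI)) 0) as [_|H].
  2:{ exfalso; apply H, sin_INR_PI. }
  (* [Lim] is by definition the limit along the sequence [INR n + / (k + 1)], so a single sequential
     limit has to be computed. *)
  unfold Lim; simpl Rbar_loc_seq.
  set (h := fun k => / (INR k + 1)).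
  assert (Hhp : forall k, 0 < h k) by (intros k; apply Rinv_0_lt_compat; generalize (pos_INR k); lra).
  assert (Hh : is_lim_seq h 0).
  { apply (is_lim_seq_ext (fun n => / INR (S n))); [intros; unfold h; now rewrite S_INR|].
    apply (is_lim_seq_incr_1 (fun n => / INR n)).
    replace (Finite 0) with (Rbar_inv p_infty) by reflexivity.
    apply is_lim_seq_inv; [apply is_lim_seq_INR|discriminate]. }
  assert (Hh0 : forall k, h k <> 0) by (intros k; generalize (Hhp k); lra).
  assert (Hm : is_lim_seq (fun k => - h k) 0).
  { replace (Finite 0) with (Rbar_opp 0) by (simpl; f_equal; ring).
    apply -> is_lim_seq_opp; exact Hh. }
  assert (H1 := order_derivative_lim (INR n) x h Hx Hh Hh0).
  assert (H2 := order_derivative_lim (- INR n) x (fun k => - h k) Hx Hm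
                  ltac:(intros k; generalize (Hhp k); lra)).
  assert (H3 : is_lim_seq (fun k => (cos ((0 + h k) * PI) - cos (0 * PI)) / h k) 0).
  { apply (derive_seq_lim (fun t => cos (t * PI)) 0 0 h); auto.
    auto_derive; auto. rewrite Rmult_0_l, sin_0; ring. }
  assert (H4 : is_lim_seq (fun k => (sin ((0 + h k) * PI) - sin (0 * PI)) / h k) PI).
  { apply (derive_seq_lim (fun t => sin (t * PI)) 0 PI h); auto.
    auto_derive; auto. rewrite Rmult_0_l, cos_0; ring. }
  assert (H5 : is_lim_seq (fun k => cos ((0 + h k) * PI)) 1).
  { replace 1 with (cos ((0 + 0) * PI)) by (rewrite Rplus_0_l, Rmult_0_l; apply cos_0).
    apply (is_lim_seq_continuous (fun t => cos ((0 + t) * PI))); auto.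
    apply (derive_continuity_pt _ _ (- sin ((0 + 0) * PI) * PI)).
    auto_derive; auto; ring. }
  set (s := (-1) ^ n).
  assert (Hs : s * s = 1) by apply pow_m1_sqr.
  assert (Hs0 : s <> 0) by (intros E; rewrite E in Hs; lra).
  (* The value of the numerator at [h = 0] vanishes because [J_(-n) = (-1)^n J_n]; dividing
     numerator and denominator by [h k] turns [0 / 0] into difference quotients with known
     limits. *)
  assert (HL : is_lim_seq (fun k => besselY_quot (INR n + / (INR k + 1)) x)
     ((dordJ (INR n) x + s * dordJ (- INR n) x) / PI)).
  { apply (is_lim_seq_ext_loc (fun k =>
      ((besselJ (INR n + h k) x - besselJ (INR n) x) / h k * s * cos ((0 + h k) * PI)
       + s * besselJ (INR n) x * ((cos ((0 + h k) * PI) - cos (0 * PI)) / h k)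
       + (besselJ (- INR n + - h k) x - besselJ (- INR n) x) / - h k)
      * / (s * ((sin ((0 + h k) * PI) - sin (0 * PI)) / h k)))).
    (* At [k = 0] the increment is 1 and [sin (h k PI)] vanishes; from [k = 1] on it lies strictly
       between 0 and 1. *)
    - exists 1%nat; intros k Hk; unfold besselY_quot; fold (h k).
      rewrite (Rmult_plus_distr_r (INR n) (h k)), cos_plus, sin_plus, sin_INR_PI, cos_INR_PI; fold s.
      rewrite (besselJ_opp_INR n x Hx); fold s.
      rewrite !Rplus_0_l, Rmult_0_l, cos_0, sin_0, Rminus_0_r.
      rewrite Ropp_plus_distr.
      destruct (Req_dec (sin (h k * PI)) 0) as [E|E].
      + exfalso.
        assert (Hk1 : h k < 1).
        { apply le_INR in Hk; simpl in Hk.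
          unfold h; rewrite <- Rinv_1; apply Rinv_lt_contravar; lra. }
        assert (0 < sin (h k * PI)); [|lra].
        apply sin_gt_0; generalize (Hhp k); nra.
      + field. auto.
    - replace ((dordJ (INR n) x + s * dordJ (- INR n) x) / PI)
        with ((dordJ (INR n) x * s * 1 + s * besselJ (INR n) x * 0 + dordJ (- INR n) x) * / (s * PI)).
      + apply is_lim_seq_mult'.
        * repeat apply is_lim_seq_plus'; auto; repeat apply is_lim_seq_mult'; auto; apply is_lim_seq_const.
        * apply (is_lim_seq_inv _ (s * PI)).
          -- apply is_lim_seq_mult'; auto; apply is_lim_seq_const.
          -- intros E; injection E; intros E'; apply Rmult_integral in E'; lra.
      + transitivity ((s * s * dordJ (INR n) x + s * dordJ (- INR n) x) / (s * s * PI)); [field; lra|].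
        rewrite Hs; field; lra. }
  apply is_lim_seq_unique in HL. unfold h in *. now rewrite HL.
Qed.

(** * Bessel's equation and Wronskians *)

Definition bessel_solution (nu : R) (f df : R -> R) : Prop :=
  forall x, 0 < x -> is_derive f x (df x) /\ is_derive df x (bessel_rhs nu x (f x) (df x)).

Lemma bessel_solution_lin (nu a b : R) (f df g dg : R -> R) :
  bessel_solution nu f df -> bessel_solution nu g dg ->
  bessel_solution nu (fun x => a * f x + b * g x) (fun x => a * df x + b * dg x).
Proof.
  intros Hf Hg x Hx; destruct (Hf x Hx) as [F1 F2]; destruct (Hg x Hx) as [G1 G2]; split.
  - apply @is_derive_plus; apply is_derive_scal; auto.
  - evar_last.
    + apply @is_derive_plus; apply is_derive_scal; [apply F2|apply G2].
    + unfold plus, bessel_rhs; simpl; field; lra.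
Qed.

Lemma bessel_solution_ext (nu : R) (f g df : R -> R) :
  (forall x, 0 < x -> g x = f x) -> bessel_solution nu f df -> bessel_solution nu g df.
Proof.
  intros E H x Hx; destruct (H x Hx) as [H1 H2]; rewrite E by auto; split; auto.
  apply (is_derive_ext_loc f); auto.
  apply (filter_imp (fun y => 0 < y)); [intros; symmetry; auto|]. apply open_gt; auto.
Qed.

(** Abel's identity: the factor [x] compensates the term [- f' / x] of Bessel's equation. *)
Lemma bessel_wronskian_const (nu : R) (f df g dg : R -> R) (x y : R) :
  bessel_solution nu f df -> bessel_solution nu g dg -> 0 < x -> 0 < y ->
  x * (f x * dg x - df x * g x) = y * (f y * dg y - df y * g y).
Proof.
  intros Hf Hg.
  set (w := fun x => x * (f x * dg x - df x * g x)).
  assert (Hw : forall x, 0 < x -> is_derive w x 0).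
  { intros t Ht; destruct (Hf t Ht) as [F1 F2]; destruct (Hg t Ht) as [G1 G2].
    evar_last.
    - apply (is_derive_mult (fun x => x) (fun x => f x * dg x - df x * g x));
        [apply @is_derive_id| |intros; apply Rmult_comm].
      apply @is_derive_minus; apply @is_derive_mult; eauto; intros; apply Rmult_comm.
    - unfold minus, plus, opp, mult, one, bessel_rhs; simpl; field; lra. }
  intros Hx Hy; change (w x = w y).
  destruct (Rle_dec x y).
  - apply derive_eq0_eq; auto; intros; apply Hw; lra.
  - symmetry; apply derive_eq0_eq; [lra|]; intros; apply Hw; lra.
Qed.

(** Serves to evaluate [x] times a Wronskian: on [x > 0] this constant is rewritten as an expression
    continuous at 0, where its value is explicit. *)
Lemma continuity_extend_0 (Q : R -> R) (w : R) :
  continuity_pt Q 0 -> (forall x, 0 < x -> Q x = w) -> Q 0 = w.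
Proof.
  intros HQ Hw.
  destruct (Req_dec (Q 0) w) as [|Hne]; auto; exfalso.
  destruct (HQ (Rabs (Q 0 - w))) as [d [Hd H]]; [apply Rabs_pos_lt; lra|].
  specialize (H (d / 2)).
  simpl in H; unfold R_dist in H.
  rewrite Hw in H by lra.
  rewrite (Rabs_minus_sym w) in H.
  enough (Rabs (Q 0 - w) < Rabs (Q 0 - w)) by lra.
  apply H; split.
  - split; [exact I|lra].
  - rewrite Rminus_0_r, Rabs_pos_eq; lra.
Qed.

Lemma bessel_solution_J (nu : R) : bessel_solution nu (besselJ nu) (dJ nu).
Proof. intros x Hx; split; [apply is_derive_besselJ|apply is_derive_dJ]; auto. Qed.

Lemma bessel_solution_Jopp (nu : R) : bessel_solution nu (besselJ (- nu)) (dJ (- nu)).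
Proof.
  intros x Hx; split; [apply is_derive_besselJ; auto|].
  replace (bessel_rhs nu x (besselJ (- nu) x) (dJ (- nu) x))
    with (bessel_rhs (- nu) x (besselJ (- nu) x) (dJ (- nu) x)).
  - apply is_derive_dJ; auto.
  - unfold bessel_rhs; now replace ((- nu) ^ 2) with (nu ^ 2) by ring.
Qed.

Lemma continuity_half_sqr_comp (F : R -> R) (x : R) :
  (forall y, ex_derive F y) -> continuity_pt (fun x => F ((x / 2) ^ 2)) x.
Proof.
  intros HF; destruct (HF ((x / 2) ^ 2)) as [l Hl].
  eapply derive_continuity_pt, is_derive_half_sqr_comp, Hl.
Qed.

Lemma continuity_bser (nu x : R) : continuity_pt (fun x => bser nu ((x / 2) ^ 2)) x.
Proof. apply continuity_half_sqr_comp; intros y; eexists; apply is_derive_bser. Qed.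
Lemma continuity_bser1 (nu x : R) : continuity_pt (fun x => bser1 nu ((x / 2) ^ 2)) x.
Proof. apply continuity_half_sqr_comp; intros y; eexists; apply is_derive_bser1. Qed.
Lemma continuity_dbser (nu x : R) : continuity_pt (fun x => dbser nu ((x / 2) ^ 2)) x.
Proof. apply continuity_half_sqr_comp; intros y; eexists; apply is_derive_dbser. Qed.
Lemma continuity_dbser1 (nu x : R) : continuity_pt (fun x => dbser1 nu ((x / 2) ^ 2)) x.
Proof. apply continuity_half_sqr_comp; intros y; eexists; apply is_derive_dbser1. Qed.

Lemma continuity_pt_cst (a x : R) : continuity_pt (fun _ => a) x.
Proof. apply continuity_pt_const; intros ? ?; auto. Qed.

Lemma continuity_pt_sqr_half (x : R) : continuity_pt (fun x => x ^ 2 / 2) x.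
Proof. apply (derive_continuity_pt _ _ x); auto_derive; auto; field. Qed.

Lemma continuity_half_sqr_pow (n : nat) (x : R) : continuity_pt (fun x => ((x / 2) ^ 2) ^ n) x.
Proof.
  apply (continuity_half_sqr_comp (fun y => y ^ n)); intros y.
  eexists; apply is_derive_pow, @is_derive_id.
Qed.

Ltac solve_continuity :=
  repeat lazymatch goal with
  | |- continuity_pt (fun _ => ?a) _ => apply (continuity_pt_cst a)
  | |- continuity_pt (fun x => bser _ _) _ => apply continuity_bser
  | |- continuity_pt (fun x => bser1 _ _) _ => apply continuity_bser1
  | |- continuity_pt (fun x => dbser _ _) _ => apply continuity_dbser
  | |- continuity_pt (fun x => dbser1 _ _) _ => apply continuity_dbser1
  | |- continuity_pt (fun x => _ ^ _) _ => apply continuity_half_sqr_pow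
  | |- continuity_pt (fun x => _ / _) _ => apply continuity_pt_sqr_half
  | |- continuity_pt (fun x => @?f x - @?g x) _ => apply (continuity_pt_minus f g)
  | |- continuity_pt (fun x => @?f x + @?g x) _ => apply (continuity_pt_plus f g)
  | |- continuity_pt (fun x => @?f x * @?g x) _ => apply (continuity_pt_mult f g)
  end.

Lemma zero_half_sqr : (0 / 2) ^ 2 = 0.
Proof. field. Qed.

Lemma wronskian_J_Jopp (nu x : R) : 0 < x ->
  x * (besselJ nu x * dJ (- nu) x - dJ nu x * besselJ (- nu) x)
  = - 2 * nu * rGamma (nu + 1) * rGamma (- nu + 1).
Proof.
  intros Hx.
  (* Here the powers [(x / 2)^nu] and [(x / 2)^(-nu)] have been cancelled, so that only entire
     functions remain. *)
  set (Q := fun x =>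
    bser nu ((x / 2) ^ 2) * (- nu * bser (- nu) ((x / 2) ^ 2) + x ^ 2 / 2 * bser1 (- nu) ((x / 2) ^ 2))
    - bser (- nu) ((x / 2) ^ 2) * (nu * bser nu ((x / 2) ^ 2) + x ^ 2 / 2 * bser1 nu ((x / 2) ^ 2))).
  assert (HQ : forall t, 0 < t -> Q t = t * (besselJ nu t * dJ (- nu) t - dJ nu t * besselJ (- nu) t)).
  { intros t Ht; rewrite !besselJ_eq; unfold dJ, Q.
    rewrite Rpower_Ropp.
    assert (0 < Rpower (t / 2) nu) by apply exp_pos.
    field; lra. }
  transitivity (Q 0).
  - symmetry; apply (continuity_extend_0 Q).
    + unfold Q; solve_continuity.
    + intros t Ht; rewrite HQ by auto.
      apply (bessel_wronskian_const nu); auto; [apply bessel_solution_J|apply bessel_solution_Jopp].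
  - unfold Q; rewrite zero_half_sqr.
    unfold bser; rewrite !PSeries_0; unfold bcoef; simpl; rewrite !Rplus_0_l; field.
Qed.

(** [Y] is a combination of [J_nu] and [J_(-nu)] with a nonzero coefficient at the latter; neither
    [nu + 1] nor [1 - nu] is a zero of [1/Gamma]. *)
Lemma bessel_pair_nonint (nu : R) : 0 <= nu -> sin (nu * PI) <> 0 ->
  exists dY, bessel_solution nu (besselY nu) dY /\
    forall x, 0 < x -> besselJ nu x * dY x - dJ nu x * besselY nu x <> 0.
Proof.
  intros Hnu Hs.
  set (a := cos (nu * PI) / sin (nu * PI)); set (b := - / sin (nu * PI)).
  assert (E : forall x, besselY nu x = a * besselJ nu x + b * besselJ (- nu) x).
  { intros x; unfold besselY; destruct (Req_EM_T (sin (nu * PI)) 0); [tauto|].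
    unfold besselY_quot, a, b; field; auto. }
  exists (fun x => a * dJ nu x + b * dJ (- nu) x); split.
  - apply (bessel_solution_ext nu (fun x => a * besselJ nu x + b * besselJ (- nu) x)); auto.
    apply bessel_solution_lin; [apply bessel_solution_J|apply bessel_solution_Jopp].
  - intros x Hx; rewrite E.
    replace (besselJ nu x * (a * dJ nu x + b * dJ (- nu) x) - dJ nu x * (a * besselJ nu x + b * besselJ (- nu) x))
      with (b * (besselJ nu x * dJ (- nu) x - dJ nu x * besselJ (- nu) x)) by ring.
    assert (Hint : forall k : Z, nu <> IZR k).
    { intros k Ek; apply Hs, sin_eq_0_1; exists k; now rewrite Ek. }
    assert (Hw := wronskian_J_Jopp nu x Hx).
    assert (H1 : rGamma (nu + 1) <> 0) by (generalize (rGamma_pos (nu + 1)); lra).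
    assert (H2 : rGamma (- nu + 1) <> 0).
    { apply rGamma_neq_0; intros n En; apply (Hint (Z.of_nat (S n))).
      rewrite <- INR_IZR_INZ, S_INR; lra. }
    assert (H3 := Hint 0%Z).
    apply Rmult_integral_contrapositive_currified.
    + unfold b; apply Ropp_neq_0_compat, Rinv_neq_0_compat; auto.
    + intros Z; rewrite Z, Rmult_0_r in Hw; symmetry in Hw; revert Hw.
      repeat apply Rmult_integral_contrapositive_currified; auto; lra.
Qed.

(* The logarithmic terms of the Wronskian combine to [2 J^2], so it extends continuously to 0. *)
Lemma bessel_pair_int (n : nat) :
  exists dY, bessel_solution (INR n) (besselY (INR n)) dY /\
    forall x, 0 < x -> besselJ (INR n) x * dY x - dJ (INR n) x * besselY (INR n) x <> 0.
Proof.
  assert (HPI := PI_RGT_0).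
  set (s := (-1) ^ n).
  assert (Hs : s * s = 1) by apply pow_m1_sqr.
  set (nu := INR n).
  set (f := fun x => dordJ nu x + s * dordJ (- nu) x).
  set (df := fun x => dxdordJ nu x + s * dxdordJ (- nu) x).
  assert (Hf : bessel_solution nu f df).
  { intros x Hx; split.
    - apply @is_derive_plus; [|apply is_derive_scal]; apply is_derive_dordJ; auto.
    - evar_last.
      + apply @is_derive_plus; [|apply is_derive_scal]; apply is_derive_dxdordJ; auto.
      + unfold plus, bessel_rhs, f, df; simpl.
        (* The source terms at orders [nu] and [- nu] have opposite signs and, by the reflection of
           [J], cancel through [s * s = 1]. *)
        unfold nu; rewrite besselJ_opp_INR by auto; fold s; fold nu.
        apply Rminus_diag_uniq.
        transitivity (2 * nu / x ^ 2 * besselJ nu x * (1 - s * s)); [field; lra|].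
        rewrite Hs; ring. }
  assert (HJ := bessel_solution_J nu).
  set (Q := fun x =>
    2 * ((x / 2) ^ 2) ^ n * (bser nu ((x / 2) ^ 2) * bser nu ((x / 2) ^ 2))
    + ((x / 2) ^ 2) ^ n * (x ^ 2 / 2 * (bser nu ((x / 2) ^ 2) * dbser1 nu ((x / 2) ^ 2)
                                      - bser1 nu ((x / 2) ^ 2) * dbser nu ((x / 2) ^ 2)))
    + s * (- 2 * nu * (bser nu ((x / 2) ^ 2) * dbser (- nu) ((x / 2) ^ 2))
           + x ^ 2 / 2 * (bser nu ((x / 2) ^ 2) * dbser1 (- nu) ((x / 2) ^ 2)
                          - bser1 nu ((x / 2) ^ 2) * dbser (- nu) ((x / 2) ^ 2)))).
  assert (HQ : forall t, 0 < t -> Q t = t * (besselJ nu t * df t - dJ nu t * f t)).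
  { intros t Ht; unfold df, f, dordJ, dxdordJ.
    assert (EJ : besselJ (- nu) t = s * besselJ nu t) by (apply besselJ_opp_INR; auto).
    assert (EdJ : dJ (- nu) t = s * dJ nu t) by (apply dJ_opp_INR; auto).
    assert (EE : ((t / 2) ^ 2) ^ n = Rpower (t / 2) nu * Rpower (t / 2) nu).
    { assert (H := half_power_opp n t Ht); fold nu in H; rewrite Rpower_Ropp in H.
      assert (0 < Rpower (t / 2) nu) by apply exp_pos.
      rewrite <- H at 2; field; lra. }
    rewrite EJ, EdJ; unfold Q; rewrite EE; unfold dJ; rewrite besselJ_eq, Rpower_Ropp.
    assert (0 < Rpower (t / 2) nu) by apply exp_pos.
    set (F := bser nu ((t / 2) ^ 2)); set (F1 := bser1 nu ((t / 2) ^ 2)).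
    set (G := dbser nu ((t / 2) ^ 2)); set (G1 := dbser1 nu ((t / 2) ^ 2)).
    set (H' := dbser (- nu) ((t / 2) ^ 2)); set (H1 := dbser1 (- nu) ((t / 2) ^ 2)).
    set (E := Rpower (t / 2) nu) in *; set (L := ln (t / 2)).
    apply Rminus_diag_uniq; transitivity ((E * F) ^ 2 * (1 - s * s)); [field; lra|].
    rewrite Hs; ring. }
  (* For [n = 0] the logarithmic contribution [2 F^2] survives. For [n >= 1] it carries the factor
     [0^n], and what survives is a nonzero multiple of the derivative of [1/Gamma] at its zero
     [1 - n]. *)
  assert (HQ0 : Q 0 <> 0).
  { unfold Q; rewrite zero_half_sqr.
    assert (HF : 0 < bser nu 0).
    { unfold bser; rewrite PSeries_0; unfold bcoef; simpl.
      replace (1 / 1 * rGamma (0 + nu + 1)) with (rGamma (nu + 1)) by (rewrite Rplus_0_l; field).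
      apply rGamma_pos; unfold nu; generalize (pos_INR n); lra. }
    set (F := bser nu 0) in *; set (F1 := bser1 nu 0); set (G := dbser nu 0); set (G1 := dbser1 nu 0).
    set (H1 := dbser1 (- nu) 0).
    destruct (Nat.eq_dec n 0) as [E|E].
    - assert (Enu : nu = 0) by (unfold nu; rewrite E; reflexivity).
      rewrite E, Enu.
      replace (2 * 0 ^ 0 * (F * F) + 0 ^ 0 * (0 ^ 2 / 2 * (F * G1 - F1 * G)) +
        s * (-2 * 0 * (F * dbser (- 0) 0) + 0 ^ 2 / 2 * (F * H1 - F1 * dbser (- 0) 0)))
        with (2 * (F * F)) by (simpl; field).
      assert (0 < F * F) by nra. lra.
    - assert (HH : dbser (- nu) 0 <> 0).
      { unfold dbser; rewrite PSeries_0; unfold dbcoef; simpl.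
        replace (1 / 1 * Derive rGamma (0 + - nu + 1)) with (Derive rGamma (- INR (n - 1))).
        - apply Derive_rGamma_opp_INR_neq_0.
        - rewrite minus_INR by lia; unfold nu; simpl.
          replace (- (INR n - 1)) with (0 + - INR n + 1) by ring. field. }
      rewrite pow_i by lia.
      replace (2 * 0 * (F * F) + 0 * (0 ^ 2 / 2 * (F * G1 - F1 * G)) +
        s * (-2 * nu * (F * dbser (- nu) 0) + 0 ^ 2 / 2 * (F * H1 - F1 * dbser (- nu) 0)))
        with (s * (-2 * nu * (F * dbser (- nu) 0))) by field.
      repeat apply Rmult_integral_contrapositive_currified; auto; try lra.
      + intros Z; rewrite Z in Hs; lra.
      + unfold nu; apply not_0_INR; auto. }
  exists (fun x => df x / PI); split.
  - apply (bessel_solution_ext nu (fun x => / PI * f x + 0 * f x)).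
    + intros x Hx; unfold nu; rewrite besselY_INR by auto; unfold f, nu, s; field; lra.
    + intros x Hx.
      destruct (bessel_solution_lin nu (/ PI) 0 f df f df Hf Hf x Hx) as [H1 H2].
      replace (df x / PI) with (/ PI * df x + 0 * df x) by (field; lra); split; auto.
      apply (is_derive_ext (fun x => / PI * df x + 0 * df x)); auto.
      intros; simpl; field; lra.
  - intros x Hx Z; apply HQ0.
    apply (continuity_extend_0 Q).
    + unfold Q; solve_continuity.
    + intros t Ht; rewrite HQ by auto.
      rewrite (bessel_wronskian_const nu _ _ _ _ t x HJ Hf Ht Hx).
      unfold nu in Z; rewrite besselY_INR in Z by auto; fold nu s in Z.
      replace (besselJ nu x * df x - dJ nu x * f x)
        with (PI * (besselJ nu x * (df x / PI) - dJ nu x * ((dordJ nu x + s * dordJ (- nu) x) / PI)))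
        by (unfold f; field; lra).
      rewrite Z; ring.
Qed.

Lemma bessel_pair (nu : R) : 0 <= nu ->
  exists dY, bessel_solution nu (besselY nu) dY /\
    forall x, 0 < x -> besselJ nu x * dY x - dJ nu x * besselY nu x <> 0.
Proof.
  intros Hnu; assert (HPI := PI_RGT_0).
  destruct (Req_dec (sin (nu * PI)) 0) as [E|E]; [|apply bessel_pair_nonint; auto].
  apply sin_eq_0_0 in E; destruct E as [k Ek].
  assert (Ek' : nu = IZR k) by (apply Rmult_eq_reg_r with PI; lra).
  rewrite Ek' in Hnu; apply le_IZR in Hnu.
  replace nu with (INR (Z.to_nat k)); [apply bessel_pair_int|].
  now rewrite INR_IZR_INZ, Z2Nat.id.
Qed.

(** * From the cross product to the Sturm-Liouville problem *)

Lemma is_derive_Rpower_mult (delta t : R) (f : R -> R) (df : R) : 0 < t -> is_derive f t df ->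
  is_derive (fun x => Rpower x (- delta) * f x) t (Rpower t (- delta) * (df - delta / t * f t)).
Proof.
  intros Ht Hf; evar_last.
  - apply (is_derive_mult (fun x => Rpower x (- delta)) f t
      (- delta / t * Rpower t (- delta)) df); auto; [|intros; apply Rmult_comm].
    unfold Rpower; auto_derive; auto. field; lra.
  - unfold plus, mult; simpl; field; lra.
Qed.

Lemma liouville_derive (C dC : R -> R) (x t : R) : 0 < x -> 0 < t ->
  is_derive C (t * x) (dC (t * x)) ->
  is_derive (fun t => sqrt t * C (t * x)) t (C (t * x) / (2 * sqrt t) + sqrt t * x * dC (t * x)).
Proof.
  intros Hx Ht H.
  assert (Hs := sqrt_lt_R0 t Ht).
  evar_last.
  - apply (is_derive_mult sqrt (fun t => C (t * x)) t (/ (2 * sqrt t)) (x * dC (t * x)));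
      [| |intros; apply Rmult_comm].
    + auto_derive; auto. field; lra.
    + apply (is_derive_comp C (fun t => t * x)); auto. auto_derive; auto; ring.
  - unfold plus, mult; simpl; field; lra.
Qed.

(** The factor [sqrt t] removes the first-order term of Bessel's equation at the price of the
    [1 / 4] in [potential]. *)
Lemma liouville_derive2 (nu : R) (C dC : R -> R) (x t : R) : 0 < x -> 0 < t ->
  bessel_solution nu C dC ->
  is_derive (fun t => C (t * x) / (2 * sqrt t) + sqrt t * x * dC (t * x)) t
    (- (potential nu x t * (sqrt t * C (t * x)))).
Proof.
  intros Hx Ht H.
  destruct (H (t * x) ltac:(nra)) as [H1 H2].
  assert (Hs := sqrt_lt_R0 t Ht).
  assert (HC : is_derive (fun t => C (t * x)) t (x * dC (t * x))).
  { apply (is_derive_comp C (fun t => t * x)); auto. auto_derive; auto; ring. }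
  assert (HdC : is_derive (fun t => dC (t * x)) t
                  (x * bessel_rhs nu (t * x) (C (t * x)) (dC (t * x)))).
  { apply (is_derive_comp dC (fun t => t * x)); auto. auto_derive; auto; ring. }
  evar_last.
  - apply @is_derive_plus.
    + apply (is_derive_div (fun t => C (t * x)) (fun t => 2 * sqrt t) t (x * dC (t * x)) (/ sqrt t)); eauto; [|lra].
      auto_derive; auto. field; lra.
    + apply (is_derive_mult (fun t => sqrt t * x) (fun t => dC (t * x)) t (x / (2 * sqrt t))); eauto;
        [|intros; apply Rmult_comm].
      auto_derive; auto. field; lra.
  - unfold plus, mult, bessel_rhs, potential; simpl.
    set (c := C (t * x)); set (d := dC (t * x)).
    assert (E := sqrt_sqrt t ltac:(lra)).
    set (w := sqrt t) in *.
    rewrite <- E. field; lra.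
Qed.

Lemma neumann_sl_solution (r Ro delta nu x : R) :
  0 < r < Ro -> 0 <= nu -> 0 < x ->
  exists W dW, sl_solution nu (delta + 1 / 2) r x W dW /\
    (hfun r Ro delta nu x = 0 <-> dW Ro = (delta + 1 / 2) / Ro * W Ro).
Proof.
  intros Hr Hnu Hx.
  destruct (bessel_pair nu Hnu) as [dY [HY HW]].
  assert (HJ := bessel_solution_J nu).
  set (J := besselJ nu) in *; set (J' := dJ nu) in *; set (Y := besselY nu) in *.
  set (dj := fun t => Rpower t (- delta) * (J' t - delta / t * J t)).
  set (dy := fun t => Rpower t (- delta) * (dY t - delta / t * Y t)).
  assert (Hdj : forall t, 0 < t -> Derive (jfun delta nu) t = dj t).
  { intros t Ht; apply is_derive_unique, is_derive_Rpower_mult; auto. apply HJ; auto. }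
  assert (Hdy : forall t, 0 < t -> Derive (yfun delta nu) t = dy t).
  { intros t Ht; apply is_derive_unique, is_derive_Rpower_mult; auto. apply HY; auto. }
  assert (Hrx : 0 < r * x) by nra.
  assert (HRx : 0 < Ro * x) by nra.
  (* With these coefficients the boundary condition at [r] holds identically, and the same
     combination evaluated at [Ro] is [hfun]. *)
  set (A0 := dy (r * x)); set (B0 := - dj (r * x)).
  set (C := fun t => A0 * J t + B0 * Y t); set (dC := fun t => A0 * J' t + B0 * dY t).
  assert (HC : bessel_solution nu C dC) by (apply bessel_solution_lin; auto).
  (* If both vanished, [J] and [Y] would satisfy the same first-order condition at [r x], and their
     Wronskian would be 0 there. *)
  assert (HAB : ~ (A0 = 0 /\ B0 = 0)).
  { intros [EA EB]; unfold A0, B0, dj, dy in EA, EB.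
    assert (Hp : 0 < Rpower (r * x) (- delta)) by apply exp_pos.
    apply Rmult_integral in EA; destruct EA as [EA|EA]; [lra|].
    apply Ropp_eq_0_compat in EB; rewrite Ropp_involutive in EB.
    apply Rmult_integral in EB; destruct EB as [EB|EB]; [lra|].
    apply (HW (r * x) Hrx).
    replace (dY (r * x)) with (delta / (r * x) * Y (r * x)) by lra.
    replace (J' (r * x)) with (delta / (r * x) * J (r * x)) by lra. ring. }
  assert (HCC : forall t, 0 < t -> ~ (C t = 0 /\ dC t = 0)).
  { intros t Ht [E1 E2]; apply HAB; specialize (HW t Ht); split.
    - assert (E : A0 * (J t * dY t - J' t * Y t) = dY t * C t - Y t * dC t) by (unfold C, dC; ring).
      rewrite E1, E2, !Rmult_0_r, Rminus_diag in E. apply Rmult_integral in E; tauto.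
    - assert (E : B0 * (J t * dY t - J' t * Y t) = J t * dC t - J' t * C t) by (unfold C, dC; ring).
      rewrite E1, E2, !Rmult_0_r, Rminus_diag in E. apply Rmult_integral in E; tauto. }
  (* Both sides are nonzero multiples of [C' - delta / (t x) C] at [t x]; the extra [1 / 2] is the
     logarithmic derivative of [sqrt t]. *)
  assert (Hrob : forall t, 0 < t ->
    (A0 * dj (t * x) + B0 * dy (t * x) = 0 <->
     C (t * x) / (2 * sqrt t) + sqrt t * x * dC (t * x)
       = (delta + 1 / 2) / t * (sqrt t * C (t * x)))).
  { intros t Ht. assert (0 < t * x) by nra.
    assert (Hs := sqrt_lt_R0 t Ht); assert (E := sqrt_sqrt t ltac:(lra)).
    assert (Hp : 0 < Rpower (t * x) (- delta)) by apply exp_pos.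
    replace (A0 * dj (t * x) + B0 * dy (t * x))
      with (Rpower (t * x) (- delta) * (dC (t * x) - delta / (t * x) * C (t * x)))
      by (unfold dj, dy, C, dC; ring).
    assert (E2 : C (t * x) / (2 * sqrt t) + sqrt t * x * dC (t * x)
       - (delta + 1 / 2) / t * (sqrt t * C (t * x))
       = sqrt t * x * (dC (t * x) - delta / (t * x) * C (t * x))).
    { set (c := C (t * x)); set (d := dC (t * x)); set (w := sqrt t) in *.
      rewrite <- E. field; lra. }
    split; intros Z.
    - apply Rmult_integral in Z; destruct Z as [Z|Z]; [lra|].
      rewrite Z, Rmult_0_r in E2; lra.
    - assert (Z2 : sqrt t * x * (dC (t * x) - delta / (t * x) * C (t * x)) = 0) by lra.
      apply Rmult_integral in Z2; destruct Z2 as [Z2|Z2]; [exfalso; nra|].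
      rewrite Z2; ring. }
  set (W0 := fun t => sqrt t * C (t * x)).
  set (dW0 := fun t => C (t * x) / (2 * sqrt t) + sqrt t * x * dC (t * x)).
  assert (Hr0 : dW0 r = (delta + 1 / 2) / r * W0 r).
  { apply Hrob; [lra|]. unfold A0, B0; ring. }
  assert (Hne : forall t, 0 < t -> 0 < W0 t ^ 2 + dW0 t ^ 2).
  { intros t Ht; assert (Hs := sqrt_lt_R0 t Ht).
    destruct (Req_dec (W0 t) 0) as [E1|E1].
    - destruct (Req_dec (dW0 t) 0) as [E2|E2].
      + exfalso; apply (HCC (t * x)); [nra|].
        unfold W0 in E1; apply Rmult_integral in E1; destruct E1 as [E1|E1]; [lra|].
        split; auto. unfold dW0 in E2; rewrite E1 in E2.
        assert (E3 : sqrt t * x * dC (t * x) = 0) by (unfold Rdiv in E2; lra).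
        apply Rmult_integral in E3; destruct E3 as [E3|E3]; auto; exfalso; nra.
      + assert (0 < dW0 t ^ 2) by (apply pow2_gt_0; auto). generalize (pow2_ge_0 (W0 t)); lra.
    - assert (0 < W0 t ^ 2) by (apply pow2_gt_0; auto). generalize (pow2_ge_0 (dW0 t)); lra. }
  assert (HWr : W0 r <> 0).
  { intros E; specialize (Hne r ltac:(lra)); rewrite Hr0, E in Hne; lra. }
  (* The overall sign is adjusted to make the solution positive at [r]. *)
  assert (Hsg : exists sg, sg ^ 2 = 1 /\ 0 < sg * W0 r).
  { destruct (Rlt_le_dec 0 (W0 r)); [exists 1|exists (-1)]; split; lra. }
  destruct Hsg as [sg [Hsg1 Hsg2]].
  assert (Hsg0 : sg <> 0) by (intros E; rewrite E in Hsg1; lra).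
  exists (fun t => sg * W0 t), (fun t => sg * dW0 t); split.
  - split; [|split; [|split; [|split]]]; auto.
    + intros t Ht; apply is_derive_scal, liouville_derive; auto. apply HC; nra.
    + intros t Ht; evar_last.
      * apply is_derive_scal, (liouville_derive2 nu); auto.
      * unfold W0; ring.
    + intros t Ht; specialize (Hne t Ht).
      replace ((sg * W0 t) ^ 2 + (sg * dW0 t) ^ 2) with (sg ^ 2 * (W0 t ^ 2 + dW0 t ^ 2)) by ring.
      rewrite Hsg1; lra.
    + rewrite Hr0; ring.
  - unfold hfun; rewrite !Hdj, !Hdy by auto.
    replace (dj (Ro * x) * dy (r * x) - dj (r * x) * dy (Ro * x))
      with (A0 * dj (Ro * x) + B0 * dy (Ro * x)) by (unfold A0, B0; ring).
    rewrite (Hrob Ro) by lra. fold (W0 Ro) (dW0 Ro).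
    split; intros E.
    + rewrite E; ring.
    + apply Rmult_eq_reg_l with sg; auto. rewrite E; ring.
Qed.

(** * Asymptotics of [calG] and its inverse *)

Lemma calG_inner (r Ro nu x : R) : 0 < r < Ro -> 0 < x -> nu <= r * x ->
  calG r Ro nu x = (x * Ro * sqrt (1 - (nu / x / Ro) ^ 2) - x * r * sqrt (1 - (nu / x / r) ^ 2)
                    + nu * (acos (nu / x / r) - acos (nu / x / Ro))) / PI.
Proof.
  intros Hr Hx Hnu; unfold calG, Gfun.
  assert (HPI := PI_RGT_0).
  destruct (Rle_dec (nu / x) r) as [_|H].
  - unfold gfun; field; lra.
  - exfalso; apply H; apply Rmult_le_reg_r with x; auto.
    unfold Rdiv; rewrite Rmult_assoc, Rinv_l; lra.
Qed.

Lemma gfun_le (u : R) : 0 <= u -> gfun u <= / PI.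
Proof.
  intros Hu; unfold gfun, Rdiv.
  assert (HPI := PI_RGT_0).
  rewrite <- (Rmult_1_l (/ PI)) at 2.
  apply Rmult_le_compat_r; [left; now apply Rinv_0_lt_compat|].
  assert (sqrt (1 - u ^ 2) <= 1).
  { rewrite <- sqrt_1 at 2; apply sqrt_le_1_alt; generalize (pow2_ge_0 u); lra. }
  assert (0 <= acos u) by apply acos_bound. nra.
Qed.

Lemma gfun_ge (u : R) : 0 <= u -> - u <= gfun u.
Proof.
  intros Hu; unfold gfun.
  assert (HPI := PI_RGT_0).
  apply Rmult_le_reg_r with PI; auto.
  unfold Rdiv; rewrite Rmult_assoc, Rinv_l, Rmult_1_r by lra.
  assert (acos u <= PI) by apply acos_bound.
  assert (0 <= sqrt (1 - u ^ 2)) by apply sqrt_pos. nra.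
Qed.

(** A crude linear bound valid for all [x >= 0]: a large value of [calG] forces a large argument.
    Thus every solution that [epsilon] may pick in [calGinv] lies in the asymptotic range. *)
Lemma calG_le (r Ro nu x : R) : 0 < r < Ro -> 0 <= nu -> 0 <= x ->
  calG r Ro nu x <= x * (Ro / PI + r).
Proof.
  intros Hr Hnu [Hx|<-]; [|unfold calG; lra].
  unfold calG; apply Rmult_le_compat_l; [lra|].
  assert (Hs : 0 <= nu / x) by (apply Rmult_le_pos; [lra|left; now apply Rinv_0_lt_compat]).
  assert (H1 : gfun (nu / x / Ro) <= / PI).
  { apply gfun_le, Rmult_le_pos; auto; left; apply Rinv_0_lt_compat; lra. }
  unfold Gfun, Rdiv at 3; destruct (Rle_dec (nu / x) r) as [H|H].
  - assert (H2 : - (nu / x / r) <= gfun (nu / x / r)).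
    { apply gfun_ge, Rmult_le_pos; auto; left; apply Rinv_0_lt_compat; lra. }
    assert (nu / x / r <= 1).
    { apply Rmult_le_reg_r with r; [lra|]. unfold Rdiv at 1; rewrite Rmult_assoc, Rinv_l; lra. }
    nra.
  - nra.
Qed.

(** From [1 - u^2 <= sqrt (1 - u^2) <= 1] the square roots contribute errors of order [nu^2 / x],
    and the two arccosines tend to the same limit, so their difference disappears. *)
Lemma calG_asymp (r Ro nu eps : R) : 0 < r < Ro -> 0 <= nu -> 0 < eps ->
  exists X, 0 < X /\ nu / r < X /\
    forall x, X <= x -> Rabs (calG r Ro nu x - x * (Ro - r) / PI) < eps.
Proof.
  intros Hr Hnu He.
  assert (HPI := PI_RGT_0).
  assert (Hac : continuity_pt acos 0).
  { apply derivable_continuous_pt, derivable_pt_acos; lra. }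
  assert (He' : 0 < eps / (4 * (nu + 1))) by (apply Rdiv_lt_0_compat; lra).
  destruct (Hac (eps / (4 * (nu + 1))) He') as [d [Hd Hacd]].
  simpl in Hacd; unfold R_dist in Hacd.
  assert (Hac0 : forall v, 0 <= v < d -> Rabs (acos v - acos 0) < eps / (4 * (nu + 1))).
  { intros v Hv; destruct (Req_dec v 0) as [->|Hne].
    - rewrite Rminus_diag, Rabs_R0; auto.
    - apply Hacd; split; [split; [exact I|auto]|]. rewrite Rminus_0_r, Rabs_pos_eq; lra. }
  (* The summands place [nu / x] below [r], make the ratios smaller than [d], and bring
     [nu^2 / (r x)] below [eps / 4]. *)
  set (X := 1 + nu / r + nu / r / d + 4 * (nu ^ 2 / r) / eps).
  assert (Hq : 0 <= nu / r) by (apply Rmult_le_pos; [lra|left; apply Rinv_0_lt_compat; lra]).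
  assert (Hq2 : 0 <= nu / r / d) by (apply Rmult_le_pos; [lra|left; apply Rinv_0_lt_compat; lra]).
  assert (Hq3 : 0 <= 4 * (nu ^ 2 / r) / eps).
  { apply Rmult_le_pos; [|left; apply Rinv_0_lt_compat; lra].
    apply Rmult_le_pos; [lra|]. apply Rmult_le_pos; [apply pow2_ge_0|left; apply Rinv_0_lt_compat; lra]. }
  exists X; split; [unfold X; lra|]; split; [unfold X; lra|].
  intros x Hx. assert (Hx0 : 0 < x) by (unfold X in Hx; lra).
  assert (Hnx : nu <= r * x).
  { apply Rmult_le_reg_r with (/ r); [apply Rinv_0_lt_compat; lra|].
    replace (r * x * / r) with x by (field; lra). unfold X in Hx; unfold Rdiv in *; lra. }
  rewrite calG_inner by (auto; lra).
  assert (Hs : forall a, r <= a -> 0 <= nu / x / a <= 1 /\ nu / x / a < d /\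
     0 <= x * a - x * a * sqrt (1 - (nu / x / a) ^ 2) <= eps / 4).
  { intros a Ha.
    assert (H0 : 0 <= nu / x / a).
    { apply Rmult_le_pos; [apply Rmult_le_pos|]; auto; left; apply Rinv_0_lt_compat; lra. }
    assert (Hle : nu / x / a <= nu / r / x).
    { replace (nu / x / a) with (nu / x * / a) by reflexivity.
      replace (nu / r / x) with (nu / x * / r) by (field; lra).
      apply Rmult_le_compat_l; [|apply Rinv_le_contravar; lra].
      apply Rmult_le_pos; auto; left; apply Rinv_0_lt_compat; lra. }
    assert (H1 : nu / r / x <= 1).
    { apply Rmult_le_reg_r with x; auto. unfold Rdiv at 1; rewrite Rmult_assoc, Rinv_l by lra.
      unfold X in Hx; lra. }
    assert (H2 : nu / r / x < d).
    { apply Rmult_lt_reg_r with (x / d); [apply Rdiv_lt_0_compat; lra|].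
      replace (nu / r / x * (x / d)) with (nu / r / d) by (field; lra).
      replace (d * (x / d)) with x by (field; lra). unfold X in Hx; lra. }
    split; [lra|split; [lra|]].
    set (u := nu / x / a) in *.
    assert (Hu : 1 - u ^ 2 <= sqrt (1 - u ^ 2) <= 1).
    { assert (0 <= 1 - u ^ 2 <= 1) by nra.
      split.
      - rewrite <- (sqrt_pow2 (1 - u ^ 2)) at 1 by lra. apply sqrt_le_1_alt; nra.
      - rewrite <- sqrt_1 at 2; apply sqrt_le_1_alt; lra. }
    assert (Hxa : 0 < x * a) by nra.
    assert (Hu2 : x * a * u ^ 2 <= eps / 4).
    { replace (x * a * u ^ 2) with (nu ^ 2 / a / x) by (unfold u; field; lra).
      apply Rle_trans with (nu ^ 2 / r / x).
      - apply Rmult_le_compat_r; [left; apply Rinv_0_lt_compat; lra|].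
        apply Rmult_le_compat_l; [apply pow2_ge_0|apply Rinv_le_contravar; lra].
      - apply Rmult_le_reg_r with (4 * x / eps); [apply Rdiv_lt_0_compat; lra|].
        replace (nu ^ 2 / r / x * (4 * x / eps)) with (4 * (nu ^ 2 / r) / eps) by (field; lra).
        replace (eps / 4 * (4 * x / eps)) with x by (field; lra). unfold X in Hx; lra. }
    split; nra. }
  destruct (Hs r ltac:(lra)) as [_ [Hr1 Hr2]]; destruct (Hs Ro ltac:(lra)) as [_ [HR1 HR2]].
  assert (Ar := Hac0 (nu / x / r) ltac:(destruct (Hs r ltac:(lra)); lra)).
  assert (AR := Hac0 (nu / x / Ro) ltac:(destruct (Hs Ro ltac:(lra)); lra)).
  apply Rabs_def2 in Ar, AR.
  set (ar := acos (nu / x / r)) in *; set (aR := acos (nu / x / Ro)) in *.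
  assert (Ha : - (eps / 2) <= nu * (ar - aR) <= eps / 2).
  { assert (E : eps / 2 = (nu + 1) * (2 * (eps / (4 * (nu + 1))))) by (field; lra).
    set (e := eps / (4 * (nu + 1))) in *. rewrite E. split; nra. }
  set (Sr := sqrt (1 - (nu / x / r) ^ 2)) in *; set (SR := sqrt (1 - (nu / x / Ro) ^ 2)) in *.
  replace ((x * Ro * SR - x * r * Sr + nu * (ar - aR)) / PI - x * (Ro - r) / PI)
    with (((x * r - x * r * Sr) - (x * Ro - x * Ro * SR) + nu * (ar - aR)) * / PI) by (field; lra).
  rewrite Rabs_mult, (Rabs_pos_eq (/ PI)) by (left; now apply Rinv_0_lt_compat).
  assert (Hpi : / PI < 1).
  { rewrite <- Rinv_1; apply Rinv_lt_contravar; generalize PI2_1; lra. }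
  assert (Rabs (x * r - x * r * Sr - (x * Ro - x * Ro * SR) + nu * (ar - aR)) <= eps * (3 / 4)).
  { apply Rabs_le; lra. }
  assert (0 < / PI) by now apply Rinv_0_lt_compat.
  generalize (Rabs_pos (x * r - x * r * Sr - (x * Ro - x * Ro * SR) + nu * (ar - aR))); nra.
Qed.

Lemma calG_continuity (r Ro nu x : R) : 0 < r < Ro -> 0 <= nu -> nu / r < x -> 0 < x ->
  continuity_pt (calG r Ro nu) x.
Proof.
  intros Hr Hnu Hx Hx0.
  assert (HPI := PI_RGT_0).
  assert (Hin : forall y, nu / r < y -> 0 < y -> nu < r * y).
  { intros y Hy Hy0; apply Rmult_lt_reg_r with (/ r); [apply Rinv_0_lt_compat; lra|].
    replace (r * y * / r) with y by (field; lra). exact Hy. }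
  apply (continuity_pt_ext_loc (fun x => (x * Ro * sqrt (1 - (nu / x / Ro) ^ 2) - x * r * sqrt (1 - (nu / x / r) ^ 2)
                    + nu * (acos (nu / x / r) - acos (nu / x / Ro))) / PI)).
  { apply (filter_imp (fun y => nu / r < y /\ 0 < y)).
    - intros y [Hy Hy0]; symmetry; apply calG_inner; auto. left; auto.
    - apply filter_and; [apply open_gt | apply open_gt]; auto. }
  assert (Hlt : forall a, r <= a -> 0 <= nu / x / a < 1).
  { intros a Ha; split.
    - apply Rmult_le_pos; [apply Rmult_le_pos|]; auto; left; apply Rinv_0_lt_compat; lra.
    - apply Rmult_lt_reg_r with (x * a); [nra|].
      replace (nu / x / a * (x * a)) with nu by (field; lra).
      specialize (Hin x Hx Hx0); nra. }
  assert (Hd : forall a, r <= a -> ex_derive (fun x => sqrt (1 - (nu / x / a) ^ 2)) x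
      /\ ex_derive (fun x => acos (nu / x / a)) x).
  { intros a Ha; specialize (Hlt a Ha); split.
    - auto_derive. repeat split; try lra. nra.
    - apply (ex_derive_comp acos (fun x => nu / x / a)).
      + apply ex_derive_Reals_1, derivable_pt_acos; lra.
      + auto_derive; lra. }
  destruct (Hd r ltac:(lra)) as [R1 R2]; destruct (Hd Ro ltac:(lra)) as [S1 S2].
  apply continuity_pt_filterlim.
  apply (ex_derive_continuous (fun x => (x * Ro * sqrt (1 - (nu / x / Ro) ^ 2) - x * r * sqrt (1 - (nu / x / r) ^ 2)
                    + nu * (acos (nu / x / r) - acos (nu / x / Ro))) / PI) x).
  apply ex_derive_div; [|apply @ex_derive_const|lra].
  apply @ex_derive_plus.
  - apply @ex_derive_minus; apply ex_derive_mult; auto; auto_derive; auto.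
  - apply ex_derive_scal, @ex_derive_minus; auto.
Qed.

Lemma calGinv_asymp (r Ro nu eps : R) : 0 < r < Ro -> 0 <= nu -> 0 < eps ->
  exists Y, forall y, Y <= y -> Rabs (y - calGinv r Ro nu y * (Ro - r) / PI) < eps.
Proof.
  intros Hr Hnu He.
  assert (HPI := PI_RGT_0).
  destruct (calG_asymp r Ro nu eps Hr Hnu He) as [X [HX0 [HXr HX]]].
  assert (Hc : 0 < Ro / PI + r) by (assert (0 < Ro / PI) by (apply Rdiv_lt_0_compat; lra); lra).
  (* By [calG_le] such a [y] exceeds [calG] at [X], which starts the intermediate value argument,
     and every preimage of [y] is at least [X]. *)
  exists (X * (Ro / PI + r) + 1); intros y Hy.
  assert (Hex : exists x, nu / Ro <= x /\ calG r Ro nu x = y).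
  { assert (H1 := calG_le r Ro nu X Hr Hnu ltac:(lra)).
    set (Z := X + (Rabs y + eps + 1) * PI / (Ro - r)).
    assert (HZ0 : 0 < (Rabs y + eps + 1) * PI / (Ro - r)).
    { apply Rdiv_lt_0_compat; [|lra]. apply Rmult_lt_0_compat; auto. generalize (Rabs_pos y); lra. }
    assert (HZ : y < calG r Ro nu Z).
    { assert (H2 := HX Z ltac:(unfold Z; lra)). apply Rabs_def2 in H2.
      assert (Rabs y + eps + 1 <= Z * (Ro - r) / PI).
      { unfold Z. replace ((X + (Rabs y + eps + 1) * PI / (Ro - r)) * (Ro - r) / PI)
          with (X * (Ro - r) / PI + (Rabs y + eps + 1)) by (field; lra).
        assert (0 < X * (Ro - r) / PI) by (apply Rdiv_lt_0_compat; nra). lra. }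
      generalize (Rle_abs y); lra. }
    destruct (IVT_interv (fun x => calG r Ro nu x - y) X Z) as [z [Hz E]].
    - intros a Ha; apply continuity_pt_minus; [|apply continuity_pt_const; intros ? ?; auto].
      apply calG_continuity; lra.
    - unfold Z; lra.
    - lra.
    - lra.
    - exists z; split; [|lra].
      apply Rle_trans with (nu / r); [|lra].
      apply Rmult_le_compat_l; auto. apply Rinv_le_contravar; lra. }
  assert (Hs := epsilon_spec (inhabits 0) _ Hex).
  change (epsilon (inhabits 0) (fun x => nu / Ro <= x /\ calG r Ro nu x = y))
    with (calGinv r Ro nu y) in Hs.
  set (x := calGinv r Ro nu y) in *.
  destruct Hs as [Hs1 Hs2].
  assert (Hx0 : 0 <= x).
  { eapply Rle_trans; [|apply Hs1]. apply Rmult_le_pos; auto; left; apply Rinv_0_lt_compat; lra. }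
  assert (H1 := calG_le r Ro nu x Hr Hnu Hx0).
  assert (X <= x) by nra.
  specialize (HX x H). rewrite Hs2 in HX. exact HX.
Qed.

(** * Bounds for the zeros *)

Lemma xpp_phase (r Ro delta nu : R) : 0 < r < Ro -> Rabs delta <= nu ->
  exists W dW th : R -> R -> R,
    (forall x, 0 < x -> sl_solution nu (delta + 1 / 2) r x (W x) (dW x)) /\
    (forall x, 0 < x -> prufer_angle nu (delta + 1 / 2) r x 1 (W x) (dW x) (th x)) /\
    forall k, (first_index delta nu <= k)%nat ->
      0 < xpp r Ro delta nu k /\
      th (xpp r Ro delta nu k) Ro = PI / 2 - atan ((delta + 1 / 2) / Ro) + INR k * PI.
Proof.
  intros Hr Hnu.
  assert (Hnu0 : 0 <= nu) by (generalize (Rabs_pos delta); lra).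
  (* [W], [dW] and [th] are packed into one triple so that a single choice for each [x] keeps them
     compatible. *)
  set (P := fun x (p : (R -> R) * (R -> R) * (R -> R)) =>
    sl_solution nu (delta + 1 / 2) r x (fst (fst p)) (snd (fst p)) /\
    prufer_angle nu (delta + 1 / 2) r x 1 (fst (fst p)) (snd (fst p)) (snd p) /\
    (hfun r Ro delta nu x = 0 <->
     snd (fst p) Ro = (delta + 1 / 2) / Ro * fst (fst p) Ro)).
  assert (HP : forall x, 0 < x -> exists p, P x p).
  { intros x Hx.
    destruct (neumann_sl_solution r Ro delta nu x Hr Hnu0 Hx) as [W [dW [HW Hh]]].
    destruct (prufer_angle_exists nu (delta + 1 / 2) r x 1 W dW) as [th Hth]; auto; try lra.
    exists (W, dW, th); unfold P; simpl; auto. }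
  set (p := fun x => epsilon (inhabits ((fun _ : R => 0), (fun _ : R => 0), (fun _ : R => 0))) (P x)).
  assert (Hp : forall x, 0 < x -> P x (p x)) by (intros x Hx; apply epsilon_spec; auto).
  set (W := fun x => fst (fst (p x))); set (dW := fun x => snd (fst (p x))); set (th := fun x => snd (p x)).
  assert (HW : forall x, 0 < x -> sl_solution nu (delta + 1 / 2) r x (W x) (dW x)) by (intros; apply Hp; auto).
  assert (Hth : forall x, 0 < x -> prufer_angle nu (delta + 1 / 2) r x 1 (W x) (dW x) (th x)) by (intros; apply Hp; auto).
  exists W, dW, th; split; [|split]; auto.
  destruct (phase_listing nu delta r Ro th (hfun r Ro delta nu)) as [xs [Hxs1 Hxs2]]; auto.
  - apply (prufer_angle_phase_family nu _ r W dW); auto.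
  - intros M; apply (phase_unbounded nu (delta + 1 / 2) r Ro W dW); auto.
  - intros x Hx.
    assert (H1 := prufer_angle_robin nu (delta + 1 / 2) r x 1 Ro (W x) (dW x) (th x)
      ltac:(lra) Rlt_0_1 (Hth x Hx)).
    rewrite Rdiv_1_r in H1.
    destruct (Hp x Hx) as [_ [_ H2]]. fold (W x) (dW x) in H2. tauto.
  - assert (Hl : increasing_listing (fun z => 0 < z /\ hfun r Ro delta nu z = 0)
       (first_index delta nu) (xpp r Ro delta nu)).
    { unfold xpp; apply epsilon_spec; exists xs; auto. }
    intros k Hk.
    rewrite (increasing_listing_unique _ _ _ _ Hl Hxs1 k Hk); auto.
Qed.

Lemma phase_lt_inv (nu c r Ro x y : R) (th : R -> R -> R) :
  0 < r < Ro -> phase_family nu c r th -> 0 < x -> 0 < y -> th x Ro < th y Ro -> x < y.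
Proof.
  intros Hr H Hx Hy Hlt; destruct (Rlt_le_dec x y) as [|[Hyx|Hyx]]; auto; exfalso.
  - assert (th y Ro < th x Ro) by (apply (phase_increasing nu c r); auto). lra.
  - subst; lra.
Qed.

Lemma xpp_lower_bound (r Ro delta : R) : 0 < r < Ro ->
  exists N : R, forall (nu : R) (k : nat),
    Rabs delta <= nu -> (2 <= k)%nat -> N <= Rmax nu (INR k) ->
    1 / Ro * sqrt (nu ^ 2 + PI ^ 2 * (INR k - 5 / 4) ^ 2) < xpp r Ro delta nu k.
Proof.
  intros Hr.
  assert (HPI : 2 < PI) by (generalize PI2_1; lra).
  assert (Hq : 0 < Ro ^ 2 / (4 * r ^ 2)).
  { apply Rdiv_lt_0_compat; [apply pow_lt; lra|]. assert (0 < r ^ 2) by (apply pow_lt; lra). lra. }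
  (* The second summand pays for [nu < 1/2], where [- (nu^2 - 1/4) / t^2] is positive and, after
     multiplication by [Ro^2], at most [Ro^2 / (4 r^2)]. *)
  exists (2 + Ro ^ 2 / (4 * r ^ 2)); intros nu k Hnu Hk HN.
  destruct (xpp_phase r Ro delta nu Hr Hnu) as [W [dW [th [HW [Hth Hx]]]]].
  destruct (Hx k) as [Hxp Ek].
  { unfold first_index; destruct (Rlt_dec (Rabs delta) nu); lia. }
  assert (Hnu0 : 0 <= nu) by (generalize (Rabs_pos delta); lra).
  assert (Hk2 : 2 <= INR k) by (apply (le_INR 2); auto).
  set (S2 := nu ^ 2 + PI ^ 2 * (INR k - 5 / 4) ^ 2).
  assert (HS2 : 0 < S2).
  { unfold S2. assert (0 < PI ^ 2 * (INR k - 5 / 4) ^ 2).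
    { apply Rmult_lt_0_compat; apply pow_lt; lra. }
    generalize (pow2_ge_0 nu); lra. }
  set (X := 1 / Ro * sqrt S2).
  assert (HX : 0 < X).
  { apply Rmult_lt_0_compat; [apply Rdiv_lt_0_compat; lra|now apply sqrt_lt_R0]. }
  assert (HX2 : Ro ^ 2 * X ^ 2 = S2).
  { unfold X. rewrite Rpow_mult_distr, pow2_sqrt by lra. field; lra. }
  apply (phase_lt_inv nu (delta + 1 / 2) r Ro X (xpp r Ro delta nu k) th); auto.
  { apply (prufer_angle_phase_family nu _ r W dW); auto. }
  rewrite Ek.
  assert (th X Ro < INR k * PI); [|generalize (acot_bound ((delta + 1 / 2) / Ro)); lra].
  apply (phase_lt_of_potential nu (delta + 1 / 2) r Ro X k (W X) (dW X)); auto.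
  intros t Ht; unfold potential.
  assert (HR2 : 0 < Ro ^ 2) by (apply pow_lt; lra).
  assert (Ht2 : 0 < t ^ 2) by (apply pow_lt; lra).
  apply Rmult_le_reg_l with (Ro ^ 2); auto.
  replace (Ro ^ 2 * (PI * (INR k - 1) / Ro) ^ 2) with (PI ^ 2 * (INR k - 1) ^ 2) by (field; lra).
  replace (Ro ^ 2 * (X ^ 2 - (nu ^ 2 - 1 / 4) / t ^ 2))
    with (Ro ^ 2 * X ^ 2 - (nu ^ 2 - 1 / 4) * (Ro ^ 2 / t ^ 2)) by (field; lra).
  rewrite HX2; unfold S2.
  assert (HP2 : 4 <= PI ^ 2) by nra.
  (* The difference between [k - 1] and [k - 5/4] yields, as [PI^2 >= 4], a reserve of at least
     [2 k - 9/4]. *)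
  replace ((INR k - 1) ^ 2) with ((INR k - 5 / 4) ^ 2 + (2 * INR k - 9 / 4) / 4) by field.
  rewrite Rmult_plus_distr_l.
  assert (Hg : 2 * INR k - 9 / 4 <= PI ^ 2 * ((2 * INR k - 9 / 4) / 4)) by nra.
  assert (Hq1 : 1 <= Ro ^ 2 / t ^ 2).
  { apply Rmult_le_reg_r with (t ^ 2); auto.
    replace (Ro ^ 2 / t ^ 2 * t ^ 2) with (Ro ^ 2) by (field; lra).
    rewrite Rmult_1_l; apply pow_incr; lra. }
  (* For [nu >= 1/2] only [1/4] has to be covered by the reserve, so every [k >= 2] is admissible;
     for [nu < 1/2] the threshold must have been passed by [k]. *)
  destruct (Rle_lt_dec (1 / 2) nu) as [Hh|Hh].
  - assert (0 <= nu ^ 2 - 1 / 4) by nra.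
    assert (nu ^ 2 - 1 / 4 <= (nu ^ 2 - 1 / 4) * (Ro ^ 2 / t ^ 2)) by nra.
    lra.
  - assert (Hkq : 2 + Ro ^ 2 / (4 * r ^ 2) <= INR k).
    { unfold Rmax in HN; destruct (Rle_dec nu (INR k)); lra. }
    assert (Hq2 : Ro ^ 2 / t ^ 2 <= 4 * (Ro ^ 2 / (4 * r ^ 2))).
    { replace (4 * (Ro ^ 2 / (4 * r ^ 2))) with (Ro ^ 2 * / r ^ 2) by (field; lra).
      apply Rmult_le_compat_l; [lra|]. apply inv_sqr_le; lra. }
    assert (- (nu ^ 2 - 1 / 4) * (Ro ^ 2 / t ^ 2) <= Ro ^ 2 / (4 * r ^ 2)).
    { assert (- (nu ^ 2 - 1 / 4) <= 1 / 4) by nra.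
      assert (- (nu ^ 2 - 1 / 4) * (Ro ^ 2 / t ^ 2) <= 1 / 4 * (Ro ^ 2 / t ^ 2)) by nra.
      lra. }
    assert (nu ^ 2 <= 1 / 4) by nra.
    lra.
Qed.

Lemma xpp_gt_nu (r Ro delta : R) : 0 < r < Ro ->
  exists N : R, forall nu : R, Rabs delta <= nu -> N <= nu ->
    forall k : nat, (first_index delta nu <= k)%nat -> nu / Ro < xpp r Ro delta nu k.
Proof.
  intros Hr.
  destruct (phase_at_nu_lt r Ro delta Hr) as [N HN].
  exists N; intros nu Hnu HNnu k Hk.
  destruct (xpp_phase r Ro delta nu Hr Hnu) as [W [dW [th [HW [Hth Hx]]]]].
  destruct (Hx k Hk) as [Hxp Ek].
  assert (Hfam : phase_family nu (delta + 1 / 2) r th) by (apply (prufer_angle_phase_family nu _ r W dW); auto).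
  destruct (HN nu th HNnu Hfam) as [Hnu0 Hlt].
  apply (phase_lt_inv nu (delta + 1 / 2) r Ro _ _ th); auto.
  - apply Rdiv_lt_0_compat; lra.
  - rewrite Ek; generalize (pos_INR k) PI_RGT_0; nra.
Qed.

(** The eigenvalue bound has error [C / x], so the zero must first be known to be large; the lower
    bound of part (1) provides this. *)
Lemma xpp_asymp (r Ro delta nu : R) : 0 < r < Ro -> Rabs delta <= nu ->
  exists K : R, forall k : nat, K <= INR k ->
    Rabs (xpp r Ro delta nu k * (Ro - r) / PI - INR k) < 1 / 16.
Proof.
  intros Hr Hnu.
  assert (HPI : 2 < PI) by (generalize PI2_1; lra).
  destruct (xpp_lower_bound r Ro delta Hr) as [N HN].
  destruct (xpp_phase r Ro delta nu Hr Hnu) as [W [dW [th [HW [Hth Hx]]]]].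
  set (c := delta + 1 / 2) in *.
  set (C := Rabs (c / Ro) + Rabs (c / r) + Rabs (nu ^ 2 - 1 / 4) * (Ro - r) / r ^ 2).
  assert (HC : 0 <= C).
  { unfold C. assert (0 <= Rabs (nu ^ 2 - 1 / 4) * (Ro - r) / r ^ 2).
    { apply Rmult_le_pos; [|left; apply Rinv_0_lt_compat, pow_lt; lra].
      apply Rmult_le_pos; [apply Rabs_pos|lra]. }
    generalize (Rabs_pos (c / Ro)) (Rabs_pos (c / r)); lra. }
  (* The last entry makes the lower bound for the zero at least [16 (C + 1)], hence [C / x <= 1/16];
     dividing by [PI > 1] makes the inequality strict. *)
  exists (Rmax (Rmax 2 N) (5 / 4 + 16 * (C + 1) * Ro)); intros k Hk.
  assert (Hk2 : 2 <= INR k) by (eapply Rle_trans; [apply Rmax_l|eapply Rle_trans; [apply Rmax_l|apply Hk]]).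
  assert (HkN : N <= INR k) by (eapply Rle_trans; [apply Rmax_r|eapply Rle_trans; [apply Rmax_l|apply Hk]]).
  assert (HkC : 5 / 4 + 16 * (C + 1) * Ro <= INR k) by (eapply Rle_trans; [apply Rmax_r|apply Hk]).
  assert (Hk' : (2 <= k)%nat) by (apply INR_le; simpl; lra).
  assert (Hlow := HN nu k Hnu Hk' ltac:(eapply Rle_trans; [apply HkN|apply Rmax_r])).
  destruct (Hx k) as [Hxp Ek].
  { unfold first_index; destruct (Rlt_dec (Rabs delta) nu); lia. }
  set (x := xpp r Ro delta nu k) in *.
  assert (Hx1 : 16 * (C + 1) <= x).
  { apply Rle_trans with (1 / Ro * sqrt (nu ^ 2 + PI ^ 2 * (INR k - 5 / 4) ^ 2)); [|lra].
    apply Rle_trans with (1 / Ro * (INR k - 5 / 4)).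
    - apply Rmult_le_reg_l with Ro; [lra|].
      replace (Ro * (1 / Ro * (INR k - 5 / 4))) with (INR k - 5 / 4) by (field; lra). lra.
    - apply Rmult_le_compat_l; [left; apply Rdiv_lt_0_compat; lra|].
      rewrite <- (sqrt_pow2 (INR k - 5 / 4)) at 1 by lra.
      apply sqrt_le_1_alt. generalize (pow2_ge_0 nu) (pow2_ge_0 (INR k - 5 / 4)).
      assert (1 <= PI ^ 2) by nra. intros; nra. }
  assert (Hb := phase_eigenvalue_bound nu c r Ro x k (W x) (dW x) (th x) Hr Hxp (HW x Hxp) (Hth x Hxp) Ek).
  fold C in Hb.
  assert (Hc : C / x <= 1 / 16).
  { apply Rmult_le_reg_r with x; auto. unfold Rdiv at 1; rewrite Rmult_assoc, Rinv_l by lra. lra. }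
  replace (x * (Ro - r) / PI - INR k) with ((x * (Ro - r) - INR k * PI) * / PI) by (field; lra).
  rewrite Rabs_mult, (Rabs_pos_eq (/ PI)) by (left; apply Rinv_0_lt_compat; lra).
  assert (0 < / PI) by (apply Rinv_0_lt_compat; lra).
  assert (/ PI < 1) by (rewrite <- Rinv_1; apply Rinv_lt_contravar; lra).
  generalize (Rabs_pos (x * (Ro - r) - INR k * PI)); nra.
Qed.

Theorem proposition2p14 (r Ro delta : R) (hr : 0 < r) (hrR : r < Ro) :
  (exists N : R, forall (nu : R) (k : nat),
      Rabs delta <= nu -> (2 <= k)%nat -> N <= Rmax nu (INR k) ->
      xpp r Ro delta nu k
        > 1 / Ro * sqrt (nu ^ 2 + PI ^ 2 * (INR k - 5 / 4) ^ 2))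
  /\
  (exists N : R, forall nu : R,
      Rabs delta <= nu -> N <= nu ->
      forall k : nat, (first_index delta nu <= k)%nat ->
      xpp r Ro delta nu k > nu / Ro)
  /\
  (forall nu : R, Rabs delta <= nu ->
    exists K : nat, forall k : nat, (K <= k)%nat ->
      PI * (INR k - 1 / 2) / (Ro - r) < calGinv r Ro nu (INR k - 1 / 8) /\
      calGinv r Ro nu (INR k - 1 / 8) < xpp r Ro delta nu k /\
      xpp r Ro delta nu k < calGinv r Ro nu (INR k + 3 / 8) /\
      calGinv r Ro nu (INR k + 3 / 8) < PI * (INR k + 1 / 2) / (Ro - r)).
Proof.
  assert (Hr : 0 < r < Ro) by lra.
  split; [apply xpp_lower_bound; auto|split; [apply xpp_gt_nu; auto|]].
  intros nu Hnu.
  assert (Hnu0 : 0 <= nu) by (generalize (Rabs_pos delta); lra).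
  assert (HPI := PI_RGT_0).
  (* After multiplication by [(Ro - r) / PI] the five quantities are close to [k] plus -1/2, -1/8,
     0, 3/8 and 1/2. The smallest gap is 1/8, so errors below 1/16 preserve the order. *)
  destruct (xpp_asymp r Ro delta nu Hr Hnu) as [K1 HK1].
  destruct (calGinv_asymp r Ro nu (1 / 16) Hr Hnu0 ltac:(lra)) as [Y HY].
  destruct (INR_unbounded (Rmax K1 (Y + 1))) as [K HK].
  exists K; intros k Hk.
  apply le_INR in Hk.
  assert (Ha := Rmax_l K1 (Y + 1)); assert (Hb := Rmax_r K1 (Y + 1)).
  specialize (HK1 k ltac:(lra)).
  assert (H1 := HY (INR k - 1 / 8) ltac:(lra)).
  assert (H2 := HY (INR k + 3 / 8) ltac:(lra)).
  apply Rabs_def2 in HK1, H1, H2.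
  assert (Hlt : forall a b, a * (Ro - r) / PI < b * (Ro - r) / PI -> a < b).
  { intros a b Hab; apply Rmult_lt_reg_r with ((Ro - r) / PI); [apply Rdiv_lt_0_compat; lra|].
    unfold Rdiv in *; lra. }
  assert (Hs : forall a, PI * a / (Ro - r) * (Ro - r) / PI = a) by (intros; field; lra).
  repeat split; apply Hlt; try rewrite Hs; lra.
Qed.
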